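(* Let $\Gamma$ be any finite subgroup of $SU(2)$, and let $D$ be the canonical Dirac operator on $SU(2)/\Gamma$ equipped with the round metric and the trivial spin structure. Let $f:\mathbb{R}\to\mathbb{R}$ be a Schwartz function. Then, as $\Lambda\to+\infty$, $$\mathrm{Tr}\, f(D/\Lambda) = \frac{1}{|\Gamma|}\left(\Lambda^3\, \widehat{f}^{(2)}(0) - \frac14 \Lambda\, \widehat{f}(0)\right) + O(\Lambda^{-\infty}).$$
   Context: The spectral action is $\mathrm{Tr}\, f(D/\Lambda)=\sum_{\lambda\in \mathrm{Spec}\, D} f(\lambda/\Lambda)$, the eigenvalues counted with multiplicity, for $\Lambda>0$. $O(\Lambda^{-\infty})$ denotes a term which is $O(\Lambda^{-k})$ as $\Lambda\to+\infty$ for every $k>0$. The Fourier transform is $\widehat h(x)=\int_{\mathbb R} h(u)e^{-2\pi i u x}\,du$, and $\widehat f^{(j)}$ denotes the Fourier transform of $v\mapsto v^j f(v)$; so $\widehat f(0)=\int f(v)\,dv$ and $\widehat f^{(2)}(0)=\int v^2f(v)\,dv$. Setting for the Dirac operator. In $\mathfrak{su}(2)$ let $I=\begin{pmatrix} i&0\\0&-i\end{pmatrix}$, $J=\begin{pmatrix}0&1\\-1&0\end{pmatrix}$, $K=\begin{pmatrix}0&i\\i&0\end{pmatrix}$. The round metric on $SU(2)\cong S^3$ is the left-invariant metric for which $X_1=I,\ X_2=J,\ X_3=K$ is an orthonormal basis (the unit 3-sphere); it is bi-invariant and descends to $SU(2)/\Gamma=\{g\Gamma\}$. The trivial spin structure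 is the one corresponding to the lift of the isotropy representation $\Gamma\to SO(3)$ given by the inclusion $\iota:\Gamma\to SU(2)\cong \mathrm{Spin}(3)$, i.e. the principal bundle $SU(2)\times_\iota \mathrm{Spin}(3)$. Concretely, spinor fields on $SU(2)/\Gamma$ are the functions $\psi:SU(2)\to\mathbb{C}^2$ with $\psi(g\gamma)=\gamma^{-1}\psi(g)$ for all $\gamma\in\Gamma$, and the Dirac operator is $$D\psi = I\,(X_1\psi)+J\,(X_2\psi)+K\,(X_3\psi)-\tfrac32\,\psi,$$ where $(X\psi)(g)=\frac{d}{dt}\big|_{t=0}\psi(g\exp(tX))$ and $I,J,K$ act as matrices on $\mathbb{C}^2$. $D$ acts on the corresponding $L^2$ space and has discrete spectrum. *)

(* Defs.v *)
From HB Require Import structures.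
From mathcomp Require Import all_boot all_order all_algebra finmap.
From mathcomp Require Import complex.
From mathcomp Require Import all_classical all_reals all_analysis.

Set Implicit Arguments.
Unset Strict Implicit.
Unset Printing Implicit Defensive.

Import Order.TTheory GRing.Theory Num.Theory.
Import numFieldNormedType.Exports.

Local Open Scope classical_set_scope.
Local Open Scope ring_scope.
Local Open Scope complex_scope.

(* The normed-module structure of a numFieldType is not inferred for R[i]. *)
HB.instance Definition _ (R : realType) := NormedModule.copy R[i] R[i]^o.

Section SU2.
Variable R : realType.
Local Notation C := R[i].
Local Notation ii := (0 +i* 1 : C).
Local Notation leb := (@lebesgue_measure R).

Definition mx2 (a b c d : C) : 'M[C]_2 :=
  \matrix_(i, j) if i == 0 then (if j == 0 then a else b)
                 else (if j == 0 then c else d).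

Definition SU2 : set 'M[C]_2 := [set g | g \is unitarymx /\ \det g = 1].

Definition subgroup_SU2 (G : {fset 'M[C]_2}) : Prop :=
  [/\ [set` G] `<=` SU2, 1%:M \in G,
      forall g h, g \in G -> h \in G -> g *m h \in G
    & forall g, g \in G -> invmx g \in G].

Definition mxI : 'M[C]_2 := mx2 ii 0 0 (- ii).
Definition mxJ : 'M[C]_2 := mx2 0 1 (-1) 0.
Definition mxK : 'M[C]_2 := mx2 0 ii ii 0.

Definition expmx (A : 'M[C]_2) : 'M[C]_2 :=
  limn (series (fun n => (n`!%:R)^-1 *: A ^+ n)).

(* Spinors are functions on the ambient space of matrices, but only their
   values on SU2 are ever used. *)
Definition spinor := 'M[C]_2 -> 'cV[C]_2.

Definition along (X : 'M[C]_2) (psi : spinor) (g : 'M[C]_2) (i : 'I_2)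
  (t : R) : C := psi (g *m expmx (t%:C *: X)) i 0.

Definition derivable_along (X : 'M[C]_2) (psi : spinor) : Prop :=
  forall g i, SU2 g ->
    derivable (fun t => complex.Re (along X psi g i t)) 0 1 /\
    derivable (fun t => complex.Im (along X psi g i t)) 0 1.

Definition lie_deriv (X : 'M[C]_2) (psi : spinor) : spinor := fun g =>
  \col_i (derive1 (fun t => complex.Re (along X psi g i t)) 0
      +i* derive1 (fun t => complex.Im (along X psi g i t)) 0).

(* Smoothness with respect to the global left-invariant frame (I, J, K):
   all iterated derivatives along the frame exist and are continuous. *)
Fixpoint Ck (k : nat) (psi : spinor) : Prop :=
  {within SU2, continuous psi} /\
  if k is k'.+1 then
    forall X, X \in [:: mxI; mxJ; mxK] ->
      derivable_along X psi /\ Ck k' (lie_deriv X psi)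
  else True.

Definition smooth (psi : spinor) : Prop := forall k, Ck k psi.

Definition equivariant (G : {fset 'M[C]_2}) (psi : spinor) : Prop :=
  forall g gamma, SU2 g -> gamma \in G ->
    psi (g *m gamma) = invmx gamma *m psi g.

Definition dirac_op (psi : spinor) : spinor := fun g =>
  mxI *m lie_deriv mxI psi g + mxJ *m lie_deriv mxJ psi g
  + mxK *m lie_deriv mxK psi g - (3%:R / 2%:R) *: psi g.

Definition expi (t : R) : C := cos t +i* sin t.

(* Hopf coordinates with s = (cos eta)^2 in place of eta.  The volume form of
   the unit 3-sphere is sin eta cos eta d(eta) d(2 pi a) d(2 pi b), that is
   2 pi^2 ds da db up to sign, so the Lebesgue measure of the unit cube gives
   the Riemannian measure of SU(2), normalized to total mass 1. *)
Definition hopf (p : R * R * R) : 'M[C]_2 :=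
  let z := (Num.sqrt p.1.1)%:C * expi (2%:R * pi * p.1.2) in
  let w := (Num.sqrt (1 - p.1.1))%:C * expi (2%:R * pi * p.2) in
  mx2 z w (- conjc w) (conjc z).

Definition unit_cube : set (R * R * R) := (`[0, 1] `*` `[0, 1]) `*` `[0, 1].

Definition normsq_L2 (psi : spinor) : \bar R :=
  \int[((leb \x leb) \x leb)%E]_(p in unit_cube)
    (\sum_(i < 2) Normc.normc (psi (hopf p) i 0) ^+ 2)%:E.

Definition measurable_spinor (psi : spinor) : Prop := forall i,
  measurable_fun unit_cube (fun p => complex.Re (psi (hopf p) i 0)) /\
  measurable_fun unit_cube (fun p => complex.Im (psi (hopf p) i 0)).

(* Elements of the L^2 space are the classes of such functions modulo those
   with normsq_L2 psi = 0. *)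
Definition L2_spinor (G : {fset 'M[C]_2}) (psi : spinor) : Prop :=
  [/\ equivariant G psi, measurable_spinor psi & (normsq_L2 psi < +oo)%E].

(* (psi, phi) lies in the graph of the closure in L^2 of the Dirac operator on
   smooth spinor fields, which is its unique self-adjoint extension. *)
Definition dirac_graph (G : {fset 'M[C]_2}) (psi phi : spinor) : Prop :=
  [/\ L2_spinor G psi, L2_spinor G phi &
      forall e : R, 0 < e -> exists chi, [/\ smooth chi, equivariant G chi,
        (normsq_L2 (fun g => psi g - chi g)%R < e%:E)%E &
        (normsq_L2 (fun g => phi g - dirac_op chi g)%R < e%:E)%E]].

Definition eigenspinor (G : {fset 'M[C]_2}) (l : R) (psi : spinor) : Prop :=
  dirac_graph G psi (fun g => l%:C *: psi g).

Definition independent (n : nat) (psi : 'I_n -> spinor) : Prop :=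
  forall c : 'I_n -> C,
    normsq_L2 (fun g => \sum_(i < n) c i *: psi i g) = 0%E ->
    forall i, c i = 0.

Definition Spec (G : {fset 'M[C]_2}) : set R :=
  [set l | exists psi, eigenspinor G l psi /\ normsq_L2 psi <> 0%E].

(* the complex dimension of the eigenspace, possibly +oo *)
Definition mult (G : {fset 'M[C]_2}) (l : R) : \bar R :=
  ereal_sup [set (n%:R)%:E | n in [set n | exists psi : 'I_n -> spinor,
    (forall i, eigenspinor G l (psi i)) /\ independent psi]].

Definition spectral_term (G : {fset 'M[C]_2}) (f : R -> R) (L l : R) : \bar R :=
  (mult G l * (f (l / L))%:E)%E.

(* meaningful only when spectral_term G f L is summable over Spec G *)
Definition spectral_action (G : {fset 'M[C]_2}) (f : R -> R) (L : R) : R :=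
  fine (esum (Spec G) (spectral_term G f L)^\+ -
        esum (Spec G) (spectral_term G f L)^\-)%E.

Definition schwartz (f : R -> R) : Prop :=
  (forall n x, derivable (derive1n n f) x 1) /\
  (forall m n : nat, exists M : R, forall x, `|x ^+ m * derive1n n f x| <= M).

Definition fourier (h : R -> R) (x : R) : C :=
  (\int[leb]_u complex.Re ((h u)%:C * expi (- (2%:R * pi * u * x))))
  +i* (\int[leb]_u complex.Im ((h u)%:C * expi (- (2%:R * pi * u * x)))).

Definition fourier_moment (j : nat) (f : R -> R) : R -> C :=
  fourier (fun v => v ^+ j * f v).

Definition negligible_at_infinity (e : R -> C) : Prop :=
  forall k : R, 0 < k ->
    exists M : R, \forall L \near +oo_R, Normc.normc (e L) <= M * L `^ (- k).

End SU2.

(* Main.v *)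
(* On SU(2) the matrix-valued functions K_j (j a nonzero integer) of g^* y,
   built from the Chebyshev polynomial U with U(cos t) = sin (j t) / sin t,
   satisfy D K_j = (j - 1/2) K_j in y.  Since K_j + K_{-j} is the scalar
   j sin (j t) / sin t, weighting by r^(j - 1) and summing gives the Poisson
   kernel of the 3-sphere; its positivity makes the K_j complete, and as D is
   symmetric K_j reproduces the eigenspace of j - 1/2, so there are no other
   eigenvalues.
   Averaging K_j over Gamma gives the reproducing kernel of the equivariant
   eigenspinors, whose trace on the diagonal is constant and equals the
   multiplicity
     tau_j = |Gamma|^-1 sum_c j sin ((j - 1) t_c) / sin t_c,  cos t_c = tr c / 2.
   In Tr f(D / Lambda) = sum_j tau_j f((j - 1/2) / Lambda) each c <> 1 contributes
   O(Lambda^-oo): u_j = sin ((j - 1) t_c) / sin t_c satisfies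
   u_{j+1} + u_{j-1} = (tr c) u_j with tr c <> 2, so that summation by parts and
   Taylor's formula gain any power of 1 / Lambda (the factor j is absorbed into
   v f(v) and f(v)).  For c = 1 the weights are j (j - 1) = (j - 1/2)^2 - 1/4, and the
   Riemann sums differ from their integrals by O(Lambda^-oo). *)

Require Import Defs.
From HB Require Import structures.
From mathcomp Require Import all_boot all_order all_algebra finmap.
From mathcomp Require Import complex.
From mathcomp Require Import all_classical all_reals all_analysis.
From mathcomp Require Import ring lra measurable_realfun.

Set Implicit Arguments.
Unset Strict Implicit.
Unset Printing Implicit Defensive.

Import Order.TTheory GRing.Theory Num.Theory.
Import numFieldNormedType.Exports.

Local Open Scope classical_set_scope.
Local Open Scope ring_scope.
Local Open Scope complex_scope.

(** * Chebyshev polynomials and lattice sums *)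

(** The invariance of the measure has to be earned: the L^2 norm is given in Hopf coordinates, in
    which translations are opaque. What can be computed there are the moments of [sdot g]. They do
    not depend on g, so the Poisson sums have mass 1 about every centre, and right invariance
    follows because smoothing by them approximates continuous functions uniformly. Invariance makes
    integrals of derivatives vanish, which is the symmetry of D. An eigenspinor is only a limit of
    smooth spinors in the graph norm and cannot be differentiated or evaluated. It is therefore
    always paired with polynomial spinors, on which D acts pointwise; the identities between such
    pairings are proved for the smooth approximants and passed to the limit. The dimension of an
    eigenspace is the size of a maximal orthonormal system of polynomial eigenspinors: Bessel's
    inequality for the averaged kernel bounds this size by the trace, and maximality turns the
    inequality into an equality. *)

Section Chebyshev.
Variable R : realType.
Implicit Types (k : nat) (t r : R).

(* [chebTU k] is the pair [(T_k, U_k)] with [T_k(cos x) = cos (k x)] and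
   [U_k(cos x) = sin (k x) / sin x]: the second index is shifted by one from
   the usual convention, so that [U_k] is the character of dimension [k]. *)
Fixpoint chebTU k : {poly R} * {poly R} :=
  if k is k'.+1 then
    let: (T, U) := chebTU k' in ('X * T - (1 - 'X ^+ 2) * U, 'X * U + T)
  else (1, 0).

Definition chebT k := (chebTU k).1.
Definition chebU k := (chebTU k).2.

Lemma chebT0 : chebT 0 = 1. Proof. by []. Qed.
Lemma chebU0 : chebU 0 = 0. Proof. by []. Qed.

Lemma chebTS k : chebT k.+1 = 'X * chebT k - (1 - 'X ^+ 2) * chebU k.
Proof. by rewrite /chebT /chebU /=; case: (chebTU k). Qed.

Lemma chebUS k : chebU k.+1 = 'X * chebU k + chebT k.
Proof. by rewrite /chebT /chebU /=; case: (chebTU k). Qed.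

Lemma chebU1 : chebU 1 = 1.
Proof. by rewrite chebUS chebU0 chebT0 mulr0 add0r. Qed.

Lemma chebUSS k : chebU k.+2 = 2%:R * 'X * chebU k.+1 - chebU k.
Proof. rewrite !chebUS chebTS; ring. Qed.

Lemma cheb_pell k : chebT k ^+ 2 + (1 - 'X ^+ 2) * chebU k ^+ 2 = 1.
Proof.
elim: k => [|k IH]; first by rewrite chebT0 chebU0; ring.
by rewrite -[RHS]IH chebTS chebUS; ring.
Qed.

Lemma derivMX2 (p : {poly R}) : ((1 - 'X ^+ 2) * p)^`() =
  - (2%:R * 'X) * p + (1 - 'X ^+ 2) * p^`().
Proof.
rewrite derivM; congr (_ * _ + _).
by rewrite derivB derivXn /= expr1 -[1]/(1%:P) derivC sub0r mulr_natl.
Qed.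

Lemma deriv_cheb k :
  (1 - 'X ^+ 2) * (chebU k)^`() = 'X * chebU k - k%:R * chebT k /\
  (chebT k)^`() = k%:R * chebU k.
Proof.
elim: k => [|k [IHU IHT]].
  by rewrite chebT0 chebU0 deriv0 -[1]/(1%:P) derivC; split; ring.
have dT : (chebT k.+1)^`() = k.+1%:R * chebU k.+1.
  rewrite chebTS derivB derivMX2 derivM derivX IHT IHU chebUS -[k.+1]addn1.
  by rewrite natrD; ring.
split=> //; rewrite chebUS chebTS derivD derivM derivX IHT.
transitivity ((1 - 'X ^+ 2) * chebU k
    + 'X * ((1 - 'X ^+ 2) * (chebU k)^`()) + (1 - 'X^2) * (k%:R * chebU k)).
  by ring.
by rewrite IHU -[k.+1]addn1 natrD; ring.
Qed.

Lemma chebU_deriv k :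
  (1 - 'X ^+ 2) * (chebU k)^`() = 'X * chebU k - k%:R * chebT k.
Proof. by case: (deriv_cheb k). Qed.

(** The radial form of the Laplace equation on the 3-sphere: [chebU k], as a function of t = <g, y>,
    has eigenvalue k^2 - 1. It is the derivative of the first identity in [deriv_cheb]. *)
Lemma chebU_ode k : (1 - 'X ^+ 2) * (chebU k)^`()^`() =
  3%:R * 'X * (chebU k)^`() - (k%:R ^+ 2 - 1) * chebU k.
Proof.
have [dU dT] := deriv_cheb k.
have := congr1 deriv dU; rewrite derivMX2 derivB (derivM 'X) derivX.
rewrite (mulr_natl (chebT k)) derivMn dT -(mulr_natl (k%:R * _)) => h.
transitivity ((- (2%:R * 'X) * (chebU k)^`()
    + (1 - 'X ^+ 2) * (chebU k)^`()^`()) + 2%:R * 'X * (chebU k)^`()).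
  by ring.
by rewrite h; ring.
Qed.

(** Pell's identity gives |T_k| <= 1 on [-1, 1], so each step U_{k+1} = X U_k + T_k adds at most
    1. *)
Lemma chebU_bound k t : `|t| <= 1 -> `|(chebU k).[t]| <= k%:R.
Proof.
move=> t1; elim: k => [|k IH]; first by rewrite chebU0 horner0 normr0.
rewrite chebUS hornerD hornerM hornerX -[k.+1]addn1 natrD.
have t2 : t ^+ 2 <= 1 by rewrite -real_normK ?num_real// expr_le1.
apply: (le_trans (ler_normD _ _)); apply: lerD.
  rewrite normrM; apply: le_trans IH.
  by rewrite ler_piMl.
have := congr1 (horner^~ t) (cheb_pell k).
rewrite !(hornerD, hornerN, hornerM, hornerX, horner_exp) -[1]/(1%:P) !hornerC => e.
rewrite -(@expr_le1 _ 2)// real_normK ?num_real// -e lerDl mulr_ge0 ?sqr_ge0//.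
by rewrite subr_ge0.
Qed.

Lemma chebU_at1 k : (chebU k).[1] = k%:R.
Proof.
suff: (chebT k).[1] = 1 /\ (chebU k).[1] = k%:R by case.
elim: k => [|k [T U]]; first by rewrite chebT0 chebU0 !hornerE.
by rewrite chebTS chebUS !hornerE T U -[k.+1]addn1 natrD; split; ring.
Qed.

End Chebyshev.

(** * Derivatives of real functions and Taylor's formula *)

Section RealDerivatives.
Variable R : realType.
Implicit Types (F f g h : R -> R) (x y : R).

Lemma is_derive1D f g x (a b : R) : is_derive x 1 f a -> is_derive x 1 g b ->
  is_derive x 1 (fun y => f y + g y) (a + b).
Proof. exact: is_deriveD. Qed.

Lemma is_derive1B f g x (a b : R) : is_derive x 1 f a -> is_derive x 1 g b ->
  is_derive x 1 (fun y => f y - g y) (a - b).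
Proof. exact: is_deriveB. Qed.

Lemma is_derive1M f g x (a b : R) : is_derive x 1 f a -> is_derive x 1 g b ->
  is_derive x 1 (fun y => f y * g y) (a * g x + f x * b).
Proof.
move=> fa gb; rewrite addrC; have := is_deriveM fa gb.
by rewrite /GRing.scale /= (mulrC (g x)).
Qed.

Lemma is_derive1Z f (k : R) x (a : R) : is_derive x 1 f a ->
  is_derive x 1 (fun y => k * f y) (k * a).
Proof. exact: is_deriveZ. Qed.

Lemma is_derive1_sum n (f : nat -> R -> R) x (a : nat -> R) :
  (forall i, is_derive x 1 (f i) (a i)) ->
  is_derive x 1 (fun y => \sum_(i < n) f i y) (\sum_(i < n) a i).
Proof.
move=> fa; have := is_derive_sum (fun i : 'I_n => fa i).
by rewrite fct_sumE.
Qed.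

Lemma is_derive1X n x : is_derive x 1 (fun y : R => y ^+ n) (n%:R * x ^+ n.-1).
Proof.
have := is_deriveX n (is_derive_id x (1 : R)).
rewrite /GRing.scale /= mulr1 (_ : id ^+ n = (fun y : R => y ^+ n))//.
by elim: n => [|n IH]; apply/funext => y; rewrite ?exprS// IH.
Qed.

Lemma is_derive1_shift f x k (a : R) : is_derive (k + x) 1 f a ->
  is_derive x 1 (fun y => f (k + y)) a.
Proof.
move=> fa; rewrite -[a]mulr1; apply: (@is_derive1_comp _ f (fun y => k + y)) => //.
have := @is_derive1D (fun=> k) id x 0 1 (is_derive_cst k x 1) (is_derive_id x 1).
by rewrite add0r.
Qed.

Definition smooth_fun f := forall n x, derivable (derive1n n f) x 1.

Lemma smooth_fun_derive f : smooth_fun f -> smooth_fun (derive1 f).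
Proof. by move=> sf n x; rewrite -derive1Sn; exact: sf. Qed.

Lemma derivable_cont f : (forall x, derivable f x 1) -> continuous f.
Proof. by move=> df x; apply: differentiable_continuous; exact/derivable1_diffP. Qed.

Lemma derivable_is_derive1 f x : derivable f x 1 -> is_derive x 1 f (derive1 f x).
Proof. by move=> df; rewrite derive1E; exact/derivableP. Qed.

Lemma is_derive1_val f x a : is_derive x 1 f a -> derive1 f x = a.
Proof. by move=> fa; rewrite derive1E derive_val. Qed.

Lemma mean_value g dg a b : (forall x, is_derive x 1 g (dg x)) ->
  exists2 c, `|c - a| <= `|b - a| & g b - g a = dg c * (b - a).
Proof.
move=> gd.
have cg (A : set R) : {within A, continuous g}.
  by apply/continuous_subspaceT/derivable_cont => x; case: (gd x).
have [ab|/ltW ba] := leP a b.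
- have [c] := MVT_segment ab (fun x _ => gd x) (cg _).
  rewrite in_itv /= => /andP[ac cb] e; exists c => //.
  by rewrite !ger0_norm ?subr_ge0// lerB.
- have [c] := MVT_segment ba (fun x _ => gd x) (cg _).
  rewrite in_itv /= => /andP[bc ca] e; exists c => //.
    by rewrite -normrN -[leRHS]normrN !ger0_norm ?opprB ?subr_ge0// lerB.
  by rewrite -[LHS]opprB e -mulrN opprB.
Qed.

(** The remainder, as a function of e, vanishes at 0, and its derivative is the remainder of lower
    order for [derive1 f]; the mean value theorem adds one factor |e|. The usual 1 / N! is given up,
    since only powers of e are counted later. *)
Lemma taylor_bound N f x e M : smooth_fun f ->
  (forall y, `|y - x| <= `|e| -> `|derive1n N f y| <= M) ->
  `|f (x + e) - \sum_(m < N) e ^+ m / m`!%:R * derive1n m f x| <= `|e| ^+ N * M.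
Proof.
elim: N f e M => [|N IH] f e M sf hM.
  by rewrite big_ord0 subr0 mul1r hM// addrAC subrr add0r.
pose g e := f (x + e) - \sum_(m < N.+1) e ^+ m / m`!%:R * derive1n m f x.
have g0 : g 0 = 0.
  rewrite /g addr0 big_ord_recl /= expr0 fact0 divr1 mul1r big1 ?addr0 ?subrr//.
  by move=> i _; rewrite expr0n/= !mul0r.
have dg y : is_derive y 1 g (derive1 f (x + y) -
    \sum_(m < N) y ^+ m / m`!%:R * derive1n m (derive1 f) x).
  apply: is_derive1B; first exact/is_derive1_shift/derivable_is_derive1/(sf 0).
  pose a (m : nat) : R := derive1n m f x / m`!%:R * (m%:R * y ^+ m.-1).
  have h : is_derive y 1 (fun z => \sum_(m < N.+1) derive1n m f x / m`!%:R * z ^+ m)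
      (\sum_(m < N.+1) a m).
    apply: (@is_derive1_sum _ (fun m z => derive1n m f x / m`!%:R * z ^+ m)) => m.
    exact/is_derive1Z/is_derive1X.
  rewrite (_ : (fun z => _) =
    (fun z => \sum_(m < N.+1) derive1n m f x / m`!%:R * z ^+ m)); last first.
    apply/funext => z; apply: eq_bigr => i _.
    by rewrite mulrC [_ / _]mulrC mulrA.
  apply: (is_derive_eq h); rewrite big_ord_recl /a mul0r mulr0 add0r.
  apply: eq_bigr => i _; rewrite lift0 -derive1Sn factS natrM; field.
  by rewrite pnatr_eq0 -lt0n fact_gt0 addrC natr1 pnatr_eq0.
have [c] := @mean_value g _ 0 e dg; rewrite !subr0 g0 subr0 => ce eg.
rewrite [X in `|X| <= _](_ : _ = g e)// eg exprSr normrM mulrAC.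
rewrite ler_wpM2r//; apply: le_trans (IH _ _ M (smooth_fun_derive sf) _) _.
  by move=> y yc; rewrite -derive1Sn hM// (le_trans yc).
rewrite ler_wpM2r//; last exact: lerXn2r.
by apply: le_trans (hM x _); rewrite ?subrr ?normr0.
Qed.

End RealDerivatives.

Section SchwartzFunctions.
Variable R : realType.
Implicit Types (F f : R -> R) (x y d : R).

Lemma schwartz_smooth f : schwartz f -> smooth_fun f.
Proof. by case. Qed.

Lemma schwartz_derive1n f k : schwartz f -> schwartz (derive1n k f).
Proof.
move=> [sf df]; split=> [n x|m n].
  by rewrite /derive1n -iterD; exact: sf.
by have [M hM] := df m (n + k)%N; exists M => x; rewrite /derive1n -iterD; exact: hM.
Qed.

Lemma schwartz_derive1 f : schwartz f -> schwartz (derive1 f).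
Proof. exact: (@schwartz_derive1n f 1). Qed.

Lemma derive1n_mulX f n : smooth_fun f -> derive1n n (fun x => x * f x) =
  (fun x => x * derive1n n f x + n%:R * derive1n n.-1 f x).
Proof.
move=> sf; elim: n => [|n IH]; apply/funext => x.
  by rewrite /derive1n /= mul0r addr0.
rewrite derive1nS IH; apply: is_derive1_val.
have h k := derivable_is_derive1 (sf k x).
apply: is_derive_eq; rewrite -!derive1nS /GRing.scale /= mulr1.
case: n {IH} => [|n]; first by rewrite mul0r addr0 mul1r.
by rewrite derive1nS -[n.+2]addn1 natrD; ring.
Qed.

Lemma schwartz_mulX f : schwartz f -> schwartz (fun x => x * f x).
Proof.
move=> [sf df]; split=> [n x|m n]; rewrite derive1n_mulX//.
  have h k := derivable_is_derive1 (sf k x).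
  have [//] := is_derive1D (is_derive1M (is_derive_id x 1) (h n)) (is_derive1Z n%:R (h n.-1)).
have [M1 h1] := df m.+1 n; have [M2 h2] := df m n.-1.
exists (M1 + n%:R * M2) => x.
rewrite mulrDr mulrA -exprSr mulrCA (le_trans (ler_normD _ _))// lerD//.
by rewrite normrM normr_nat ler_wpM2l.
Qed.

(** Decay of order 4 is tailored to weights of linear growth: after paying for the weight, 1 / (1 +
    x^2) is still left to sum. The constant comes from (1 + x^2)^2 = 1 + 2 x^2 + x^4. *)
Lemma schwartz_decay f : schwartz f ->
  exists2 C, 0 <= C & forall x, `|f x| <= C / (1 + x ^+ 2) ^+ 2.
Proof.
move=> [sf df]; have [M0 h0] := df 0 0; have [M2 h2] := df 2 0; have [M4 h4] := df 4 0.
have C0 x : `|f x| * (1 + x ^+ 2) ^+ 2 <= M0 + 2%:R * M2 + M4.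
  have := h0 x; have := h2 x; have := h4 x; rewrite /= expr0 mul1r !(normrM (_ ^+ _)) !normrX.
  rewrite -(real_normK (num_real x)).
  by move: `|f x| `|x| => u v; rewrite /=; nra.
exists (M0 + 2%:R * M2 + M4); first by apply: le_trans (C0 0); rewrite mulr_ge0// sqr_ge0.
by move=> x; rewrite ler_pdivlMr// exprn_gt0// ltr_pwDl// sqr_ge0.
Qed.

End SchwartzFunctions.

(** * Absolutely convergent series indexed by the integers *)

Section BilateralSeries.
Variable R : realType.
Implicit Types (a b : int -> R) (C : R).

(** The pairs n + 1, -n run once through the integers and are the orbits of j |-> 1 - j, which
    reflects the nodes (j - 1/2) d about 0. *)
Definition zterm a (n : nat) : R := a n.+1%:Z + a (- n%:Z).
Definition zsum a : R := limn (series (zterm a)).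
(** An explicit constant instead of bare summability: through [zsum_le], estimates of the terms that
    are uniform in the step d pass to the sum. *)
Definition zdom a C := forall j : int, `|a j| <= C / (1 + j%:~R ^+ 2).

Lemma oneDsqr_gt0 (x : R) : 0 < 1 + x ^+ 2.
Proof. by rewrite ltr_pwDl// sqr_ge0. Qed.

Lemma zdom_ge0 a C : zdom a C -> 0 <= C.
Proof. by move=> /(_ 0); rewrite expr0n/= addr0 divr1; apply: le_trans. Qed.

Lemma sum_oneDsqrV N : series (fun n : nat => (1 + n%:R ^+ 2)^-1 : R) N <= 3%:R.
Proof.
(* Subtracting 2 / (N + 1) makes the bound inductive: this quantity decreases by more than the next
   term 1 / (1 + (N + 1)^2). *)
suff: series (fun n : nat => (1 + n%:R ^+ 2)^-1 : R) N.+1 <= 3%:R - 2%:R / N.+1%:R.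
  rewrite seriesSr => h.
  apply: (@le_trans _ _ (3%:R - 2%:R / N.+1%:R)); last by rewrite gerBl.
  by apply: le_trans h; rewrite lerDl invr_ge0 ltW// oneDsqr_gt0.
elim: N => [|N IH]; first by rewrite seriesSr /series/= big_geq// expr0n/= addr0 invr1; lra.
rewrite seriesSr; apply: (le_trans (lerD IH (lexx _))).
have N1 : 1 <= N.+1%:R :> R by rewrite ler1n.
rewrite -[N.+2]addn1 natrD; move: (N.+1%:R) N1 => x x1.
rewrite -subr_ge0 (_ : _ - _ = (x ^+ 2 - x + 2%:R) / (x * (x + 1) * (1 + x ^+ 2))).
  by apply: divr_ge0; [nra|apply: mulr_ge0; nra].
by field; rewrite ?gt_eqF ?oneDsqr_gt0//=; lra.
Qed.

Lemma zterm_bound a C n : zdom a C -> `|zterm a n| <= (2%:R * C) * (1 + n%:R ^+ 2)^-1.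
Proof.
move=> aC; have C0 := zdom_ge0 aC.
rewrite /zterm (le_trans (ler_normD _ _))// mulrAC -mulrA mulr_natl [leRHS]mulr2n lerD//.
  apply: (le_trans (aC _)); rewrite mulrC ler_wpM2r//.
  rewrite lef_pV2 ?posrE ?oneDsqr_gt0// lerD2l.
  by rewrite lerXn2r ?nnegrE// ler_nat.
by apply: (le_trans (aC _)); rewrite rmorphN/= sqrrN mulrC.
Qed.

Lemma zsum_cvg a C : zdom a C -> series (zterm a) @ \oo --> zsum a.
Proof.
move=> aC; have C0 := zdom_ge0 aC; apply: normed_cvg.
apply: (@series_le_cvg _ _ (fun n => (2%:R * C) * (1 + n%:R ^+ 2)^-1)) => [n|n|n|].
- exact: normr_ge0.
- by rewrite mulr_ge0 ?mulr_ge0// invr_ge0 ltW// oneDsqr_gt0.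
- exact: zterm_bound.
- have -> : series (fun n : nat => 2%:R * C * (1 + n%:R ^+ 2)^-1 : R) =
      (2%:R * C) \*: series (fun n : nat => (1 + n%:R ^+ 2)^-1 : R).
    by apply/funext => N; rewrite /series /= -mulr_sumr.
  apply: is_cvgZr; apply: nondecreasing_is_cvgn.
    apply: nondecreasing_series => n _ _; rewrite invr_ge0 ltW// oneDsqr_gt0.
  by exists 3%:R => _ [N _ <-]; exact: sum_oneDsqrV.
Qed.

Lemma zsum_le a C : zdom a C -> `|zsum a| <= 6%:R * C.
Proof.
move=> aC; have C0 := zdom_ge0 aC.
have h : `|series (zterm a) N| @[N --> \oo] --> `|zsum a|.
  by apply: cvg_norm; exact: zsum_cvg aC.
have := ler_cvg_to h (cvg_cst (6%:R * C)); apply; apply: nearW => N.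
rewrite (le_trans (ler_norm_sum _ _ _))//.
apply: (@le_trans _ _ (\sum_(0 <= n < N) (2%:R * C) * (1 + n%:R ^+ 2)^-1)).
  by apply: ler_sum => n _; exact: zterm_bound.
rewrite -mulr_sumr (_ : 6%:R * C = 2%:R * C * 3%:R); last by ring.
by rewrite ler_wpM2l ?mulr_ge0// sum_oneDsqrV.
Qed.

Lemma zsumD a b C C' : zdom a C -> zdom b C' ->
  zsum (fun j => a j + b j) = zsum a + zsum b.
Proof.
move=> aC bC; apply: cvg_lim => //.
rewrite (_ : series _ = series (zterm a) + series (zterm b)).
  by apply: cvgD; [exact: zsum_cvg aC|exact: zsum_cvg bC].
apply/funext => N; rewrite /series /= fctE -big_split; apply: eq_bigr => n _.
by rewrite /zterm addrACA.
Qed.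

Lemma zsumZ a C k : zdom a C -> zsum (fun j => k * a j) = k * zsum a.
Proof.
move=> aC; apply: cvg_lim => //.
rewrite (_ : series _ = k \*: series (zterm a)); first exact: cvgZr (zsum_cvg aC).
by apply/funext => N; rewrite [RHS]mulr_sumr; apply: eq_bigr => n _; rewrite /zterm -mulrDr.
Qed.

Lemma zdomD a b C C' : zdom a C -> zdom b C' -> zdom (fun j => a j + b j) (C + C').
Proof. by move=> h h' j; rewrite mulrDl (le_trans (ler_normD _ _))// lerD. Qed.

Lemma zdomZ a C k : zdom a C -> zdom (fun j => k * a j) (`|k| * C).
Proof. by move=> h j; rewrite normrM -mulrA ler_wpM2l. Qed.

Lemma zsum_sum n (c : nat -> R) (b : nat -> int -> R) :
  (forall m, exists C, zdom (b m) C) ->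
  (exists C, zdom (fun j => \sum_(m < n) c m * b m j) C) /\
  zsum (fun j => \sum_(m < n) c m * b m j) = \sum_(m < n) c m * zsum (b m).
Proof.
move=> hb; elim: n => [|n [[C IH] e]].
  split; first by exists 0 => j; rewrite big_ord0 normr0 mul0r.
  rewrite big_ord0; apply: cvg_lim => //; rewrite (_ : series _ = cst 0); first exact: cvg_cst.
  by apply/funext => N; rewrite /series /= big1// => i _; rewrite /zterm !big_ord0 addr0.
have [C' bC] := hb n; have cbC := zdomZ (c n) bC.
have E : (fun j => \sum_(m < n.+1) c m * b m j) =
    (fun j => (\sum_(m < n) c m * b m j) + c n * b n j).
  by apply/funext => j; rewrite big_ord_recr.
rewrite E; split; first by exists (C + `|c n| * C'); exact: zdomD.
by rewrite (zsumD IH cbC) e (zsumZ _ bC) big_ord_recr.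
Qed.

Lemma zdom_cvg0 a C : zdom a C ->
  a n.+1%:Z @[n --> \oo] --> (0 : R) /\ a (- n%:Z) @[n --> \oo] --> (0 : R).
Proof.
move=> aC; have C0 := zdom_ge0 aC.
have hC : C * harmonic n @[n --> \oo] --> (0 : R).
  by rewrite -[0](mulr0 C); apply: cvgM; [exact: cvg_cst|exact: cvg_harmonic].
have hle (x : R) n : n%:R <= `|x| -> C / (1 + x ^+ 2) <= C * harmonic n * 2%:R.
  move=> nx; rewrite /harmonic -mulrA ler_wpM2l//.
  rewrite -[2%:R]invrK -invfM lef_pV2 ?posrE ?oneDsqr_gt0 ?mulr_gt0//.
  rewrite -(real_normK (num_real x)) -natr1.
  have n0 : 0 <= n%:R :> R by []. 
  rewrite ler_pdivrMr//; have : 0 <= (`|x| - 1) ^+ 2 by exact: sqr_ge0.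
  by move: nx n0; move: (`|x|) (n%:R) => y m; nra.
have h2 : C * harmonic n * 2%:R @[n --> \oo] --> (0 : R).
  by rewrite -[0](mul0r 2%:R); apply: cvgM => //; exact: cvg_cst.
have h2N : - (C * harmonic n * 2%:R) @[n --> \oo] --> (0 : R).
  by rewrite -oppr0; exact: cvgN.
split; apply: (squeeze_cvgr _ h2N h2); near=> n; rewrite -ler_norml (le_trans (aC _))//;
  apply: hle.
  by rewrite normr_nat ler_nat.
by rewrite rmorphN normrN normr_nat.
Unshelve. all: by end_near. Qed.

(** The partial sums of the two series differ by two boundary terms, which tend to 0. *)
Lemma zsum_shift a C : zdom a C -> zsum (fun j => a (j + 1)) = zsum a.
Proof.
move=> aC; apply: cvg_lim => //.
have [h1 h2] := zdom_cvg0 aC.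
have : (fun N => series (zterm a) N + (a N.+1%:Z - a (- N%:Z + 1))) @ \oo --> zsum a + (0 - 0).
  apply: cvgD; first exact: zsum_cvg aC.
  apply: cvgB => //; rewrite -cvg_shiftS /=.
  rewrite (_ : (fun _ => _) = (fun n : nat => a (- n%:Z)))//; apply/funext => n.
  by congr a; rewrite -addn1 PoszD opprD addrNK.
rewrite subr0 addr0; apply: cvg_trans; apply: near_eq_cvg; apply: nearW => N.
elim: N => [|N IH]; first by rewrite /series /= !big_geq// add0r subrr.
rewrite !seriesSr -IH /zterm.
have -> : a (- N.+1%:Z + 1) = a (- N%:Z) by congr a; rewrite -addn1 PoszD opprD addrNK.
have -> : a (N.+1%:Z + 1) = a N.+2%:Z by congr a; rewrite -PoszD addn1.
by ring.
Qed.

Lemma zsum_telescope a L : a N.+1%:Z - a (1 - N%:Z) @[N --> \oo] --> L ->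
  zsum (fun j => a (j + 1) - a j) = L.
Proof.
move=> aL; apply: cvg_lim => //; move: aL; apply: cvg_trans; apply: near_eq_cvg; apply: nearW => N.
elim: N => [|N IH]; first by rewrite /series /= big_geq// subr0 subrr.
rewrite seriesSr -IH /zterm.
have -> : a (1 - N.+1%:Z) = a (- N%:Z) by congr a; rewrite -addn1 PoszD opprD addrCA subrr addr0.
have -> : a (N.+1%:Z + 1) = a N.+2%:Z by congr a; rewrite -PoszD addn1.
by rewrite [- N%:Z + 1]addrC; ring.
Qed.

End BilateralSeries.

(** * Sums over the half-integer lattice as its step tends to 0 *)

Section LatticeSums.
Variable R : realType.
Implicit Types (F f : R -> R) (x y d : R) (u : int -> R).

Definition node d (j : int) : R := (j%:~R - 2%:R^-1) * d.

Lemma nodeS d j : node d (j + 1) = node d j + d.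
Proof. by rewrite /node rmorphD/= rmorph1; ring. Qed.

Definition lsum u F d := zsum (fun j => u j * F (node d j)).

Definition linear_growth u := exists B, forall j : int, `|u j| <= B * (1 + `|j%:~R|).

Lemma eqr_le1 x : x = 1 -> x <= 1. Proof. by move=> ->. Qed.

Definition decaying F := exists2 C, 0 <= C & forall x, `|F x| <= C / (1 + x ^+ 2) ^+ 2.

(** The underlying estimate d^2 (1 + j^2) <= 16 (1 + y^2) holds on the whole d-neighbourhood of the
    node; squaring it costs d^-4. One of the two resulting factors 1 + j^2 absorbs the growth of u.
    Letting y leave the node makes the bound cover Taylor remainders. *)
Lemma near_node_bound u F : linear_growth u -> decaying F ->
  exists2 C, 0 <= C & forall d (j : int) y, 0 < d <= 1 -> `|y - node d j| <= d ->
    `|u j| * `|F y| <= C / d ^+ 4 / (1 + j%:~R ^+ 2).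
Proof.
move=> [B uB] [C C0 FC].
have B0 : 0 <= B by have := uB 0; rewrite mulr0z normr0 addr0 mulr1; apply: le_trans.
exists (B * 2%:R * C * 16%:R ^+ 2); first by rewrite !mulr_ge0 ?exprn_ge0.
move=> d j y /andP[d0 d1]; rewrite /node; set z : R := j%:~R => yd.
have h1 : d ^+ 2 * (1 + z ^+ 2) <= 16%:R * (1 + y ^+ 2).
  have : (y - (z - 2%:R^-1) * d) ^+ 2 <= d ^+ 2.
    by rewrite -(real_normK (num_real (y - _))) lerXn2r// nnegrE ltW.
  set x := (z - _) * d => yx.
  have xE : x ^+ 2 = d ^+ 2 * (z - 2%:R^-1) ^+ 2 by rewrite /x; ring.
  have h2 : 1 + x ^+ 2 <= 4%:R * (1 + y ^+ 2).
    have : d ^+ 2 <= 1 by rewrite expr_le1// ltW.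
    have := sqr_ge0 (2%:R * y - x); nra.
  apply: (@le_trans _ _ (4%:R * (1 + x ^+ 2))); last by lra.
  rewrite xE; have : d ^+ 2 <= 1 by rewrite expr_le1// ltW.
  have : 0 <= d ^+ 2 by exact: sqr_ge0.
  move: (d ^+ 2) => e e0 e1.
  have : 0 <= e * (3%:R * z ^+ 2 - 4%:R * z + 4%:R).
    by rewrite mulr_ge0//; have := sqr_ge0 (z - 1); have := sqr_ge0 z; nra.
  by nra.
have h2 : `|F y| <= C * 16%:R ^+ 2 / (d ^+ 4 * (1 + z ^+ 2) ^+ 2).
  apply: (le_trans (FC y)); rewrite -mulrA ler_wpM2l//.
  rewrite ler_pdivlMr ?mulr_gt0 ?exprn_gt0 ?oneDsqr_gt0//.
  rewrite mulrC ler_pdivrMr ?exprn_gt0 ?oneDsqr_gt0//.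
  have -> : d ^+ 4 * (1 + z ^+ 2) ^+ 2 = (d ^+ 2 * (1 + z ^+ 2)) ^+ 2 by ring.
  rewrite -exprMn.
  by rewrite lerXn2r// nnegrE mulr_ge0// ?sqr_ge0// ltW// oneDsqr_gt0.
apply: (@le_trans _ _ (B * (2%:R * (1 + z ^+ 2)) * (C * 16%:R ^+ 2 / (d ^+ 4 * (1 + z ^+ 2) ^+ 2)))).
  apply: ler_pM => //; apply: (le_trans (uB j)); rewrite ler_wpM2l// -/z.
  by rewrite -(real_normK (num_real z)); have := sqr_ge0 (`|z| - 1); nra.
have z0 := oneDsqr_gt0 z.
rewrite le_eqVlt; apply/orP; left; apply/eqP; field.
by rewrite (gt_eqF z0) (gt_eqF d0).
Qed.

Lemma decaying_zdom u F d : linear_growth u -> decaying F -> 0 < d ->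
  exists C, zdom (fun j => u j * F (node d j)) C.
Proof.
move=> gu dF d0.
have small G e : decaying G -> 0 < e <= 1 ->
    exists C, zdom (fun j => u j * G (node e j)) C.
  move=> dG e01; have [C C0 h] := near_node_bound gu dG.
  exists (C / e ^+ 4) => j; rewrite normrM; apply: h => //.
  by rewrite subrr normr0 ltW//; case/andP: e01.
have [d1|d1] := leP d 1; first by apply: small => //; rewrite d0.
(* A step d > 1 is rescaled to 1: [node d j] is d times [node 1 j], and x |-> F (x d) satisfies the
   same bound as F. *)
have /(small _ 1) : decaying (fun x => F (x * d)).
  have [C C0 h] := dF; exists C => // x; apply: (le_trans (h _)).
  rewrite ler_wpM2l// lef_pV2 ?posrE ?exprn_gt0 ?oneDsqr_gt0//.
  apply: lerXn2r; rewrite ?nnegrE ?(ltW (oneDsqr_gt0 _))// lerD2l exprMn.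
  by rewrite ler_peMr ?sqr_ge0// exprn_ege1// ltW.
rewrite ltr01 lexx => /(_ isT)[C h]; exists C => j; have := h j.
by rewrite /node mulr1.
Qed.

Lemma lsum_zdom u F d : linear_growth u -> schwartz F -> 0 < d ->
  exists C, zdom (fun j => u j * F (node d j)) C.
Proof. by move=> gu sF d0; apply: decaying_zdom => //; exact: schwartz_decay. Qed.

Lemma lsum_bound u F : linear_growth u -> schwartz F ->
  exists C, forall d, 0 < d <= 1 -> `|lsum u F d| <= C / d ^+ 4.
Proof.
move=> gu sF; have [C C0 h] := near_node_bound gu (schwartz_decay sF).
exists (6%:R * C) => d d01; rewrite -mulrA; apply: zsum_le => j.
by rewrite normrM; apply: h => //; rewrite subrr normr0 ltW//; case/andP: d01.
Qed.

Lemma bigO_weight_ge0 d M : 0 < d <= 1 -> 0 <= d ^+ M / d ^+ 4.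
Proof. by move=> /andP[d0 _]; rewrite divr_ge0 ?exprn_ge0 ?ltW. Qed.

(** Decay is asked of the derivative, and the statement is about increments, because F will also be
    a primitive with a nonzero limit at infinity. *)
Lemma taylor_node u F e N : linear_growth u -> smooth_fun F -> schwartz (derive1 F) ->
  `|e| = 1 -> exists2 C, 0 <= C & forall d j, 0 < d <= 1 ->
    `|u j * (F (node d j + e * d) - F (node d j)) - \sum_(m < N)
      (e * d) ^+ m.+1 / m.+1`!%:R * (u j * derive1n m (derive1 F) (node d j))|
      <= C * (d ^+ N.+1 / d ^+ 4) / (1 + j%:~R ^+ 2).
Proof.
move=> gu sF sF' e1.
have [C C0 h] := near_node_bound gu (schwartz_decay (schwartz_derive1n N sF')).
exists C => // d j /andP[d0 d1].
have ed : `|e * d| = d by rewrite normrM e1 mul1r gtr0_norm.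
have uj0 : 0 <= C / d ^+ 4 / (1 + j%:~R ^+ 2).
  apply: divr_ge0; last exact/ltW/oneDsqr_gt0.
  by apply: divr_ge0 => //; exact/exprn_ge0/ltW.
(* [taylor_bound] wants a bound on the derivative alone; it is the weighted bound divided by |u_j|,
   hence the separate case u_j = 0. *)
have [uj|uj] := eqVneq (u j) 0.
  rewrite uj mul0r sub0r normrN big1; last by move=> i _; rewrite mul0r mulr0.
  rewrite normr0; apply: divr_ge0; last exact/ltW/oneDsqr_gt0.
  by apply: mulr_ge0 => //; apply: bigO_weight_ge0; rewrite d0.
have := @taylor_bound _ N.+1 F (node d j) (e * d) (C / d ^+ 4 / (1 + j%:~R ^+ 2) / `|u j|) sF.
rewrite ed => /(_ _)/wrap[].
  move=> y yd; rewrite derive1Sn ler_pdivlMr ?normr_gt0// mulrC.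
  by apply: h => //; rewrite d0.
rewrite big_ord_recl /= expr0 fact0 divr1 mul1r opprD addrA => tb.
rewrite (_ : _ - \sum_(m < N) _ = u j * (F (node d j + e * d) - F (node d j) -
  \sum_(i < N) (e * d) ^+ (lift ord0 i) / (lift ord0 i)`!%:R * derive1n (lift ord0 i) F (node d j))); last first.
  rewrite [in RHS]mulrBr mulr_sumr; congr (_ - _); apply: eq_bigr => i _.
  by rewrite lift0 derive1Sn mulrCA.
rewrite normrM; apply: (le_trans (ler_wpM2l (normr_ge0 _) tb)).
rewrite le_eqVlt; apply/orP; left; apply/eqP; field.
by rewrite normr_eq0 uj (gt_eqF d0) (gt_eqF (oneDsqr_gt0 _)).
Qed.

Lemma taylor_lsum u F e N : linear_growth u -> smooth_fun F -> schwartz (derive1 F) ->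
  `|e| = 1 ->
  (forall d, 0 < d <= 1 -> exists C, zdom (fun j => u j * (F (node d j + e * d) - F (node d j))) C) /\
  exists C, forall d, 0 < d <= 1 ->
    `|zsum (fun j => u j * (F (node d j + e * d) - F (node d j))) - \sum_(m < N)
      (e * d) ^+ m.+1 / m.+1`!%:R * lsum u (derive1n m (derive1 F)) d| <= C * (d ^+ N.+1 / d ^+ 4).
Proof.
move=> gu sF sF' e1.
have zd d : 0 < d <= 1 -> exists C, zdom (fun j => u j * (F (node d j + e * d) - F (node d j))) C.
  move=> d01; have [C C0 h] := taylor_node 0 gu sF sF' e1.
  by exists (C * (d / d ^+ 4)) => j; have := h d j d01; rewrite big_ord0 subr0.
split=> //; have [C C0 h] := taylor_node N gu sF sF' e1.
exists (6%:R * C) => d d01; have [C1 h1] := zd d d01.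
have [[C2 h2] e2] := @zsum_sum R N (fun m => (e * d) ^+ m.+1 / m.+1`!%:R)
  (fun m j => u j * derive1n m (derive1 F) (node d j))
  (fun m => lsum_zdom gu (schwartz_derive1n m sF') (proj1 (andP d01))).
rewrite -e2 -[X in `|_ + X|]mulN1r -(zsumZ _ h2) -(zsumD h1 (zdomZ (-1) h2)) -mulrA.
by apply: zsum_le => j; rewrite mulN1r; exact: h.
Qed.

(** The divisor d^4 is the loss in [near_node_bound]: by [lsum_bound] the case M = 0 holds for every
    Schwartz function, and the inductions on M start there. *)
Definition bigO M (s : R -> R) := exists C, forall d, 0 < d <= 1 ->
  `|s d| <= C * (d ^+ M / d ^+ 4).

Definition tiny (s : R -> R) := forall M : nat, bigO M s.

Lemma bigOD M s t : bigO M s -> bigO M t -> bigO M (fun d => s d + t d).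
Proof.
move=> [C h] [C' h']; exists (C + C') => d d01.
by rewrite mulrDl (le_trans (ler_normD _ _))// lerD ?h ?h'.
Qed.

Lemma bigOZ M c s : bigO M s -> bigO M (fun d => c * s d).
Proof.
move=> [C h]; exists (`|c| * C) => d d01.
by rewrite normrM -mulrA ler_wpM2l// h.
Qed.

Lemma bigO_sum M n (s : nat -> R -> R) : (forall i, bigO M (s i)) ->
  bigO M (fun d => \sum_(i < n) s i d).
Proof.
move=> hs; elim: n => [|n IH].
  by exists 0 => d _; rewrite big_ord0 normr0 mul0r.
rewrite (_ : (fun d => _) = (fun d => (\sum_(i < n) s i d) + s n d)); first exact: bigOD.
by apply/funext => d; rewrite big_ord_recr.
Qed.

Lemma bigO_ge M N s : (N <= M)%N -> bigO M s -> bigO N s.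
Proof.
move=> NM [C h]; exists `|C| => d d01; apply: (le_trans (h d d01)).
apply: (le_trans (ler_wpM2r (bigO_weight_ge0 M d01) (ler_norm C))).
case/andP: d01 => d0 d1; apply: ler_wpM2l => //; apply: ler_wpM2r.
  by rewrite invr_ge0; exact/exprn_ge0/ltW.
by apply: ler_wiXn2l => //; exact: ltW.
Qed.

Lemma bigO_mulX M e k s : `|e| = 1 -> bigO M s ->
  bigO (M + k) (fun d => (e * d) ^+ k * s d).
Proof.
move=> e1 [C h]; exists C => d d01; rewrite normrM normrX normrM e1 mul1r.
case/andP: (d01) => d0 _; rewrite gtr0_norm// exprD mulrAC mulrA mulrC.
by apply: ler_wpM2r; [exact/exprn_ge0/ltW|exact: h].
Qed.

Lemma tinyD s t : tiny s -> tiny t -> tiny (fun d => s d + t d).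
Proof. by move=> hs ht M; exact: bigOD. Qed.

Lemma tinyZ c s : tiny s -> tiny (fun d => c * s d).
Proof. by move=> hs M; exact: bigOZ. Qed.

Lemma tinyV s k : tiny (fun d => d ^+ k * s d) -> tiny s.
Proof.
move=> hs M; have [C h] := hs (M + k)%N; exists C => d d01.
have dk : 0 < d ^+ k by rewrite exprn_gt0//; case/andP: d01.
have := h d d01; rewrite normrM gtr0_norm// => h1; rewrite -(ler_pM2l dk).
by rewrite (le_trans h1)// le_eqVlt; apply/orP; left; apply/eqP; rewrite exprD; ring.
Qed.

Lemma eq_bigO M s t : (forall d, 0 < d <= 1 -> s d = t d) -> bigO M s -> bigO M t.
Proof. by move=> st [C h]; exists C => d d01; rewrite -st// h. Qed.

Lemma eq_tiny s t : (forall d, 0 < d <= 1 -> s d = t d) -> tiny s -> tiny t.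
Proof. by move=> st h M; exact: eq_bigO st (h M). Qed.

Lemma linear_growth_shift u k : linear_growth u -> linear_growth (fun j => u (j + k)).
Proof.
move=> [B uB].
have B0 : 0 <= B by have := uB 0; rewrite mulr0z normr0 addr0 mulr1; apply: le_trans.
exists (B * (1 + `|k%:~R|)) => j; apply: (le_trans (uB _)).
rewrite -mulrA ler_wpM2l// rmorphD /=.
have := ler_normD (j%:~R : R) k%:~R; have := normr_ge0 (j%:~R : R); have := normr_ge0 (k%:~R : R).
by move: `|j%:~R + _| `|j%:~R| `|k%:~R| => x y z; nra.
Qed.

Lemma zdom_near_node u F e d : linear_growth u -> schwartz F -> 0 < d <= 1 -> `|e| <= 1 ->
  exists C, zdom (fun j => u j * F (node d j + e * d)) C.
Proof.
move=> gu sF d01 e1; have [C C0 h] := near_node_bound gu (schwartz_decay sF).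
exists (C / d ^+ 4) => j; rewrite normrM; apply: h => //.
by rewrite addrAC subrr add0r normrM (gtr0_norm (proj1 (andP d01))) ler_piMl// ltW//; case/andP: d01.
Qed.

Lemma lsum_nodeD u F d : linear_growth u -> schwartz F -> 0 < d <= 1 ->
  zsum (fun j => u j * F (node d j + 1 * d)) = lsum (fun j => u (j - 1)) F d.
Proof.
move=> gu sF d01; have [C h] := lsum_zdom (linear_growth_shift (-1) gu) sF (proj1 (andP d01)).
rewrite /lsum -(zsum_shift h); congr zsum; apply/funext => j.
by rewrite addrK nodeS mul1r.
Qed.

Lemma lsum_nodeB u F d : linear_growth u -> schwartz F -> 0 < d <= 1 ->
  zsum (fun j => u j * F (node d j + (-1) * d)) = lsum (fun j => u (j + 1)) F d.
Proof.
move=> gu sF d01; have [C h] := @zdom_near_node u F (-1) d gu sF d01 (eqr_le1 (normrN1 R)).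
rewrite /lsum -(zsum_shift h); congr zsum; apply/funext => j.
by rewrite nodeS mulN1r addrK.
Qed.

(* Shifting the summation index, the sum S[F] of u_j F(x_j) satisfies
   (tau - 2) S[F] = sum_j u_j (F(x_j + d) - 2 F(x_j) + F(x_j - d)), and Taylor's
   formula gains a factor d over the bound known for the derivatives of F. *)
Lemma lsum_tiny_recurrence u tau F : linear_growth u ->
  (forall j, u (j + 1) + u (j - 1) = tau * u j) -> tau != 2%:R ->
  schwartz F -> tiny (lsum u F).
Proof.
move=> gu rec tau2 sF M; elim: M F sF => [|M IH] F sF.
  by have [C h] := lsum_bound gu sF; exists C => d d01; rewrite expr0 mul1r h.
have sF' := schwartz_derive1 sF; have smF := schwartz_smooth sF.
have e1 : `|1 : R| = 1 by rewrite normr1.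
have eN : `|-1 : R| = 1 by rewrite normrN1.
pose Z e d := zsum (fun j => u j * (F (node d j + e * d) - F (node d j))).
have hZ e : `|e| = 1 -> bigO M.+1 (Z e).
  move=> he; have [_ [C h]] := @taylor_lsum u F e M gu smF sF' he.
  apply: (@eq_bigO _ (fun d => (Z e d - \sum_(m < M)
      (e * d) ^+ m.+1 / m.+1`!%:R * lsum u (derive1n m (derive1 F)) d) +
      \sum_(m < M) (e * d) ^+ m.+1 / m.+1`!%:R * lsum u (derive1n m (derive1 F)) d)).
    by move=> d _; rewrite subrK.
  apply: bigOD; first by exists C.
  apply: (@bigO_sum _ _ (fun m d =>
    (e * d) ^+ m.+1 / m.+1`!%:R * lsum u (derive1n m (derive1 F)) d)) => m.
  apply: (@bigO_ge (M + m.+1)); first by rewrite addnS ltnS leq_addr.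
  apply: (@eq_bigO _ (fun d => (m.+1)`!%:R^-1 * ((e * d) ^+ m.+1 *
    lsum u (derive1n m (derive1 F)) d))); first by move=> d _; rewrite mulrCA mulrA.
  by apply: bigOZ; apply: bigO_mulX => //; apply: IH; exact: schwartz_derive1n.
have zE e d (he : `|e| = 1) (d01 : 0 < d <= 1) :
    Z e d = zsum (fun j => u j * F (node d j + e * d)) - lsum u F d.
  have [C h] := @zdom_near_node u F e d gu sF d01 (eqr_le1 he).
  have [C' h'] := lsum_zdom gu sF (proj1 (andP d01)).
  rewrite -mulN1r -(zsumZ _ h') -(zsumD h (zdomZ (-1) h')); congr zsum; apply/funext => j.
  by rewrite mulN1r mulrBr.
apply: (@eq_bigO _ (fun d => (tau - 2%:R)^-1 * (Z 1 d + Z (-1) d))); last first.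
  by apply: bigOZ; apply: bigOD; exact: hZ.
move=> d d01; rewrite !zE// lsum_nodeD// lsum_nodeB//.
have [C h] := lsum_zdom (linear_growth_shift (-1) gu) sF (proj1 (andP d01)).
have [C' h'] := lsum_zdom (linear_growth_shift 1 gu) sF (proj1 (andP d01)).
have [C2 h2] := lsum_zdom gu sF (proj1 (andP d01)).
have : lsum (fun j => u (j - 1)) F d + lsum (fun j => u (j + 1)) F d = tau * lsum u F d.
  rewrite /lsum -(zsumD h h') -(zsumZ _ h2); congr zsum; apply/funext => j.
  by rewrite -mulrDl [u _ + _]addrC rec mulrA.
set a := lsum _ F d; set b := lsum _ F d; set c := lsum _ F d => e.
have -> : a - c + (b - c) = (tau - 2%:R) * c by rewrite mulrBl -e; ring.
by rewrite mulKf// subr_eq0.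
Qed.

Lemma linear_growth1 : linear_growth (fun=> 1).
Proof. by exists 1 => j; rewrite normr1 mul1r lerDl. Qed.

(* The sum of F(x_j + d) - F(x_j) telescopes to I. *)
Lemma telescope_taylor F I N : smooth_fun F -> schwartz (derive1 F) ->
  (forall d, 0 < d <= 1 -> F (node d N.+1%:Z) - F (node d (1 - N%:Z)) @[N --> \oo] --> I) ->
  bigO N.+1 (fun d => I - \sum_(m < N)
    d ^+ m.+1 / m.+1`!%:R * lsum (fun=> 1) (derive1n m (derive1 F)) d).
Proof.
move=> smF sF' lim.
have [_ [C h]] := @taylor_lsum (fun=> 1) F 1 N linear_growth1 smF sF' (normr1 _).
exists C => d d01; have := h d d01; rewrite !mul1r.
rewrite (_ : zsum _ = I)//.
rewrite -(@zsum_telescope _ (fun j => F (node d j)) I (lim d d01)).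
by congr zsum; apply/funext => j; rewrite nodeS mul1r.
Qed.

Lemma schwartz_cvg0 F d : schwartz F -> 0 < d <= 1 ->
  F (node d N.+1%:Z) - F (node d (1 - N%:Z)) @[N --> \oo] --> 0.
Proof.
move=> sF d01; have [C h] := lsum_zdom linear_growth1 sF (proj1 (andP d01)).
have [h1 h2] := zdom_cvg0 h; rewrite -[0]subr0; apply: cvgB.
  by under eq_fun do rewrite -[F _]mul1r.
rewrite -cvg_shiftS; under eq_fun do rewrite -[F _]mul1r -addn1 PoszD opprD addrCA subrr addr0.
exact: h2.
Qed.

(** For a Schwartz function the telescoping sum is 0, so Taylor's formula expresses d S[F'] through
    d^m S[F^(m)] with m >= 2 and a remainder. Each F^(m) is the derivative of a Schwartz function,
    so the induction hypothesis applies to it with two spare factors d, of which one survives the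
    division by d. *)
Lemma lsum_derive_tiny F : schwartz F -> tiny (lsum (fun=> 1) (derive1 F)).
Proof.
move=> sF M; elim: M F sF => [|M IH] F sF.
  have [C h] := lsum_bound linear_growth1 (schwartz_derive1 sF).
  by exists C => d d01; rewrite expr0 mul1r h.
have sF' := schwartz_derive1 sF; have smF := schwartz_smooth sF.
have := @telescope_taylor F 0 M.+1 smF sF' (fun d => schwartz_cvg0 sF (d:=d)).
move=> /(bigOZ (-1)) h.
pose s (m : nat) d := - (d ^+ m.+2 / m.+2`!%:R * lsum (fun=> 1) (derive1n m.+1 (derive1 F)) d).
have hs : bigO M.+2 (fun d => \sum_(m < M) s m d).
  apply: bigO_sum => m; apply: (@bigO_ge (M + m.+2)); first by rewrite !addnS !ltnS leq_addr.
  apply: (@eq_bigO _ (fun d => (- (m.+2)`!%:R^-1) * ((1 * d) ^+ m.+2 *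
    lsum (fun=> 1) (derive1n m.+1 (derive1 F)) d))).
    by move=> d _; rewrite /s mul1r mulNr [_^-1 * _]mulrCA mulrA.
  apply: bigOZ; apply: bigO_mulX; rewrite ?normr1// (derive1nS (derive1 F)).
  by apply: (IH (derive1n m (derive1 F))); exact: (schwartz_derive1n m sF').
have [C hC] := bigOD h hs; exists C => d d01; have := hC d d01.
rewrite big_ord_recl /= expr1 (_ : 1`! = 1)%N// divr1 /s sub0r mulN1r opprK sumrN addrK.
case/andP: (d01) => d0 _; rewrite normrM gtr0_norm// [d ^+ M.+2]exprS -mulrA.
by rewrite [C * _]mulrCA ler_pM2l.
Qed.

(** Euler-Maclaurin without boundary terms: the total increment of the primitive F is I, and every
    term after d S[F'] is a sum of the derivative of a Schwartz function, hence tiny. *)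
Lemma lsum_riemann F I : smooth_fun F -> schwartz (derive1 F) ->
  (forall d, 0 < d <= 1 -> F (node d N.+1%:Z) - F (node d (1 - N%:Z)) @[N --> \oo] --> I) ->
  tiny (fun d => d * lsum (fun=> 1) (derive1 F) d - I).
Proof.
move=> smF sF' lim M.
have := @telescope_taylor F I M.+1 smF sF' lim => /(bigOZ (-1)) h.
pose s (m : nat) d := - (d ^+ m.+2 / m.+2`!%:R * lsum (fun=> 1) (derive1n m.+1 (derive1 F)) d).
have hs : bigO M.+2 (fun d => \sum_(m < M) s m d).
  apply: bigO_sum => m; apply: (@bigO_ge (M + m.+2)); first by rewrite !addnS !ltnS leq_addr.
  apply: (@eq_bigO _ (fun d => (- (m.+2)`!%:R^-1) * ((1 * d) ^+ m.+2 *
    lsum (fun=> 1) (derive1n m.+1 (derive1 F)) d))).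
    by move=> d _; rewrite /s mul1r mulNr [_^-1 * _]mulrCA mulrA.
  apply: bigOZ; apply: bigO_mulX; rewrite ?normr1// derive1nS.
  by apply: lsum_derive_tiny; exact: schwartz_derive1n.
apply: (@bigO_ge M.+2); first by rewrite ltnW.
 apply: (eq_bigO _ (bigOD h hs)) => d d01.
by rewrite big_ord_recl /= expr1 (_ : 1`! = 1)%N// divr1 /s sumrN mulN1r; ring.
Qed.

End LatticeSums.

Section SchwartzIntegral.
Variable R : realType.
Implicit Types (F f h : R -> R) (x y d : R) (u : int -> R).
Local Notation leb := (@lebesgue_measure R).

Lemma integrable_oneDsqrV : leb.-integrable setT (EFin \o (fun x : R => (1 + x ^+ 2)^-1)).
Proof.
apply/integrableP; split.
  apply/measurable_EFinP; apply: continuous_measurable_fun.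
  exact: continuous_oneDsqrV.
rewrite (_ : \int[leb]_x _ = \int[leb]_x ((1 + x ^+ 2)^-1)%:E)%E; last first.
  by apply: eq_integral => x _ /=; rewrite ger0_norm// invr_ge0 ltW// oneDsqr_gt0.
rewrite (@ge0_symfun_integralT R (fun x => (1 + x ^+ 2)^-1)).
- rewrite (_ : [set x | _] = [set` `[(0 : R), +oo[]); last first.
    by apply/seteqP; split => x /=; rewrite in_itv/= andbT.
  by rewrite integral0y_oneDsqr -EFinM ltry.
- by move=> x; rewrite invr_ge0 ltW// oneDsqr_gt0.
- exact: continuous_oneDsqrV.
- by move=> x /=; rewrite sqrrN.
Qed.

Lemma schwartz_continuous h : schwartz h -> continuous h.
Proof. by move=> /schwartz_smooth sh; apply: derivable_cont => x; exact: (sh 0). Qed.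

Lemma schwartz_integrable h : schwartz h -> leb.-integrable setT (EFin \o h).
Proof.
move=> sh; have [C C0 hC] := schwartz_decay sh.
apply: (@le_integrable _ _ R leb setT measurableT (EFin \o h) (fun x => (C * (1 + x ^+ 2)^-1)%:E)) => //.
- by apply/measurable_EFinP; apply: continuous_measurable_fun; exact: schwartz_continuous.
- move=> x _ /=; rewrite lee_fin (le_trans (hC x))// (le_trans _ (ler_norm _))//.
  rewrite ler_wpM2l// lef_pV2 ?posrE ?exprn_gt0 ?oneDsqr_gt0//.
  by rewrite ler_eXnr// lerDl sqr_ge0.
- have := @integrableZl _ _ _ leb setT measurableT C _ integrable_oneDsqrV.
  by under eq_fun do rewrite /= -EFinM.
Qed.

(** F is the integral from -oo, so an increment of F is the integral over ]a n, b n]; these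
    intervals exhaust the line, and |h| dominates. The sequences a and b will be the extreme nodes
    of the partial sums. *)
Lemma schwartz_primitive h : schwartz h -> exists F,
  [/\ smooth_fun F, derive1 F = h &
   forall a b : nat -> R, (forall x, \forall n \near \oo, a n < x) ->
     (forall x, \forall n \near \oo, x <= b n) ->
     F (b n) - F (a n) @[n --> \oo] --> (\int[leb]_x h x)%R].
Proof.
move=> sh; have ih := schwartz_integrable sh.
pose F x := (\int[leb]_(t in `]-oo, x]) h t)%R.
have iS (A : set R) : measurable A -> leb.-integrable A (EFin \o h).
  by move=> mA; exact: integrableS ih.
have dF x : derivable F x 1 /\ derive1 F x = h x.
  apply: (@continuous_FTC1 R h -oo%O x (x + 1)) => //.
  - by rewrite ltrDl.
  - exact: iS.
  - by rewrite ltNyr.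
  - exact: schwartz_continuous.
have dF1 : derive1 F = h by apply/funext => x; case: (dF x).
exists F; split => //.
  move=> [|n] x; first by case: (dF x).
  by rewrite derive1Sn dF1; exact: schwartz_smooth.
move=> a b ha hb.
pose fn n := EFin \o (h \_ `]a n, b n]).
have /integrableP[mh _] := ih.
have [] := @dominated_convergence _ _ R leb setT measurableT fn (EFin \o h) (EFin \o (Num.norm \o h)).
- move=> n.
  have mI : measurable ([set` `]a n, b n]] : set R) := measurable_itv _.
  apply/measurable_EFinP; apply: (measurable_restrictT h mI).1.
  by move/measurable_EFinP : mh => mh'; exact: (measurable_funS measurableT (@subsetT _ _) mh').
- exact: mh.
- apply/aeW => x _ /=; apply: cvg_near_cst; near=> n.
  rewrite /fn /= patchE ifT// inE /= in_itv /=; apply/andP; split; near: n.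
    exact: ha.
  exact: hb.
- exact: integrable_norm.
- apply/aeW => x n _; rewrite /fn /= lee_fin patchE; case: ifP => // _.
  by rewrite normr0.
move=> _ _ dc.
have -> : (\int[leb]_x h x)%R = fine (\int[leb]_x (EFin \o h) x)%E by [].
have /fine_cvg : (\int[leb]_x fn n x)%E @[n --> \oo] -->
    (fine (\int[leb]_x (EFin \o h) x)%E)%:E.
  by rewrite fineK ?integrable_fin_num.
apply: cvg_trans; apply: near_eq_cvg; near=> n.
have ab : a n < b n.
  by apply: (@lt_le_trans _ _ 0); near: n; [exact: ha|exact: hb].
have := @Rintegral_itvB R h -oo%O (BRight (b n)) (a n) (iS _ _) isT (ltW ab).
rewrite /F => -> //; rewrite Rintegral_mkcond.
by [].
Unshelve. all: by end_near. Qed.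

Lemma near_infty_node d (c x : R) : 0 < d -> \forall n \near \oo, x < (n%:R + c) * d.
Proof.
move=> d0; near=> n; rewrite -ltr_pdivrMr// -ltrBlDr.
by near: n; exact: nbhs_infty_gtr.
Unshelve. all: by end_near. Qed.

Lemma riemann_tiny h : schwartz h ->
  tiny (fun d => d * lsum (fun=> 1) h d - (\int[leb]_x h x)%R).
Proof.
move=> sh; have [F [smF dF lim]] := schwartz_primitive sh.
have := @lsum_riemann R F (\int[leb]_x h x)%R smF; rewrite dF; apply => //.
move=> d /andP[d0 _]; apply: lim => x.
  have := @near_infty_node d (-1 + 2%:R^-1) (- x) d0; apply: filterS => n h1.
  rewrite ltrNl in h1; apply: le_lt_trans h1.
  by rewrite /node rmorphB/= le_eqVlt; apply/orP; left; apply/eqP; rewrite -pmulrn; ring.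
have := @near_infty_node d 2%:R^-1 x d0; apply: filterS => n h1.
apply: (le_trans (ltW h1)); rewrite /node -pmulrn -natr1 le_eqVlt; apply/orP; left; apply/eqP.
by field.
Qed.

End SchwartzIntegral.

Section ChebyshevSums.
Variable R : realType.
Implicit Types (f : R -> R) (s d : R) (j : int).
Local Notation leb := (@lebesgue_measure R).

(** The odd extension to negative indices, in accordance with sin (j x) / sin x; it is the one for
    which the recurrence holds across 0. *)
Definition chebZ s j : R := (sgz j)%:~R * (chebU R `|j|%N).[s].

Lemma chebZ_nat s (n : nat) : chebZ s n%:Z = (chebU R n).[s].
Proof. by case: n => [|n]; rewrite /chebZ ?chebU0 ?horner0 ?mulr0//= mul1r. Qed.

Lemma chebZN s j : chebZ s (- j) = - chebZ s j.
Proof. by rewrite /chebZ sgzN abszN rmorphN mulNr. Qed.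

Lemma chebZ_rec s j : chebZ s (j + 1) + chebZ s (j - 1) = 2%:R * s * chebZ s j.
Proof.
have nat_case (n : nat) : chebZ s (n%:Z + 1) + chebZ s (n%:Z - 1) = 2%:R * s * chebZ s n%:Z.
  case: n => [|n].
    by rewrite add0r sub0r chebZN subrr (chebZ_nat s 0) chebU0 horner0 mulr0.
  have -> : n.+1%:Z - 1 = n%:Z by rewrite -addn1 PoszD addrK.
  rewrite -PoszD addn1 !chebZ_nat chebUSS.
  by rewrite hornerD hornerN !hornerM hornerX addrNK -(polyC_natr _ 2) hornerC.
case: (intP j) => [|n|n]; [exact: (nat_case 0%N)|exact: nat_case|].
have -> : - n.+1%:Z + 1 = - (n.+1%:Z - 1) by rewrite opprB addrC.
by rewrite -[- n.+1%:Z - 1]opprD !chebZN addrC -opprD nat_case mulrN.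
Qed.

Lemma chebZ_growth s : `|s| <= 1 -> linear_growth (chebZ s).
Proof.
move=> s1; exists 1 => j; rewrite mul1r /chebZ normrM.
apply: (@le_trans _ _ (1 * `|j|%N%:R)); last first.
  by rewrite mul1r natr_absz intr_norm lerDr.
apply: ler_pM => //; last exact: chebU_bound.
by rewrite -intr_norm; case: sgzP; rewrite ?normr0 ?normrN ?normr1.
Qed.

Lemma chebZ1 j : chebZ 1 j = j%:~R.
Proof. by rewrite /chebZ chebU_at1 natr_absz -rmorphM/= [j in RHS]intEsg. Qed.

Definition wsum s f d := zsum (fun j => j%:~R * chebZ s (j - 1) * f (node d j)).

Lemma wsum_zdom s f d : `|s| <= 1 -> schwartz f -> 0 < d ->
  (exists C, zdom (fun j => j%:~R * chebZ s (j - 1) * f (node d j)) C) /\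
  wsum s f d = d^-1 * lsum (fun j => chebZ s (j - 1)) (fun x => x * f x) d +
    2%:R^-1 * lsum (fun j => chebZ s (j - 1)) f d.
Proof.
move=> s1 sf d0; have gu := linear_growth_shift (-1) (chebZ_growth s1).
have [C1 h1] := lsum_zdom gu (schwartz_mulX sf) d0.
have [C2 h2] := lsum_zdom gu sf d0.
(* The weight is removed by j = [node d j] / d + 1/2. *)
have E : (fun j => j%:~R * chebZ s (j - 1) * f (node d j)) = (fun j =>
    d^-1 * (chebZ s (j - 1) * (node d j * f (node d j))) +
    2%:R^-1 * (chebZ s (j - 1) * f (node d j))).
  by apply/funext => j; rewrite /node; field; rewrite gt_eqF.
rewrite /wsum E; split; last by rewrite (zsumD (zdomZ _ h1) (zdomZ _ h2)) (zsumZ _ h1) (zsumZ _ h2).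
by exists (`|d^-1| * C1 + `|2%:R^-1| * C2); apply: zdomD; exact: zdomZ.
Qed.

Lemma wsum_tiny s f : `|s| <= 1 -> s != 1 -> schwartz f -> tiny (wsum s f).
Proof.
move=> s1 sn1 sf; have gu := linear_growth_shift (-1) (chebZ_growth s1).
have rec j : chebZ s (j + 1 - 1) + chebZ s (j - 1 - 1) = 2%:R * s * chebZ s (j - 1).
  by rewrite -chebZ_rec addrK subrK.
have t2 : 2%:R * s != 2%:R.
  by apply: contra_neq sn1 => h; apply: (mulfI (_ : 2%:R != 0)); rewrite ?mulr1.
have h1 := @lsum_tiny_recurrence _ _ _ _ gu rec t2 (schwartz_mulX sf).
have h2 := @lsum_tiny_recurrence _ _ _ _ gu rec t2 sf.
apply: (@eq_tiny _ (fun d => d^-1 * lsum (fun j => chebZ s (j - 1)) (fun x => x * f x) d +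
    2%:R^-1 * lsum (fun j => chebZ s (j - 1)) f d)).
  by move=> d /andP[d0 _]; case: (wsum_zdom s1 sf d0).
apply: tinyD; last exact: tinyZ.
(* The factor 1 / d costs one power of d, which tininess can afford. *)
apply: (@tinyV _ _ 1%N); apply: eq_tiny h1 => d /andP[d0 _].
by rewrite expr1 mulVKf// gt_eqF.
Qed.

Lemma wsum1_tiny f : schwartz f -> tiny (fun d => wsum 1 f d -
  (d^-1 ^+ 3 * (\int[leb]_x (x ^+ 2 * f x))%R - 4%:R^-1 * d^-1 * (\int[leb]_x f x)%R)).
Proof.
move=> sf; have sf2 := schwartz_mulX (schwartz_mulX sf).
have h1 := riemann_tiny sf2; have h2 := riemann_tiny sf.
rewrite (_ : (\int[leb]_x (x ^+ 2 * f x))%R = (\int[leb]_x (x * (x * f x)))%R); last first.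
  by apply: eq_Rintegral => x _; rewrite mulrA.
(* Multiplied by d^3, the error becomes the Riemann error of x^2 f minus d^2 / 4 times that of f. *)
apply: (@tinyV _ _ 3%N).
pose I2 := (\int[leb]_x (x * (x * f x)))%R; pose I0 := (\int[leb]_x f x)%R.
apply: (@eq_tiny _ (fun d => (d * lsum (fun=> 1) (fun x => x * (x * f x)) d - I2) +
   (- 4%:R^-1) * ((1 * d) ^+ 2 * (d * lsum (fun=> 1) f d - I0)))); last first.
  apply: tinyD => //; apply: tinyZ => M.
  by apply: (@bigO_ge _ (M + 2)%N); rewrite ?leq_addr//; apply: bigO_mulX; rewrite ?normr1.
move=> d /andP[d0 _].
have [C1 e1] := lsum_zdom (@linear_growth1 R) sf2 d0.
have [C2 e2] := lsum_zdom (@linear_growth1 R) sf d0.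
have -> : wsum 1 f d = d^-1 ^+ 2 * lsum (fun=> 1) (fun x => x * (x * f x)) d +
    (- 4%:R^-1) * lsum (fun=> 1) f d.
  rewrite -(zsumZ _ e1) -(zsumZ _ e2) -(zsumD (zdomZ _ e1) (zdomZ _ e2)).
  congr zsum; apply/funext => j; rewrite chebZ1 rmorphB/= /node.
  by field; rewrite gt_eqF.
by rewrite -/I2 -/I0; field; rewrite gt_eqF.
Qed.

End ChebyshevSums.

(** * Reproducing kernels of the Dirac operator on SU(2) *)

Section ComplexTopology.
Variable R : realType.
Local Notation C := R[i].
Local Notation Re := (@complex.Re R).
Local Notation Im := (@complex.Im R).

Lemma Re_add (x y : C) : Re (x + y) = Re x + Re y. Proof. by case: x y => a b []. Qed.
Lemma Im_add (x y : C) : Im (x + y) = Im x + Im y. Proof. by case: x y => a b []. Qed.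
Lemma Re_opp (x : C) : Re (- x) = - Re x. Proof. by case: x. Qed.
Lemma Im_opp (x : C) : Im (- x) = - Im x. Proof. by case: x. Qed.
Lemma Re_mul (x y : C) : Re (x * y) = Re x * Re y - Im x * Im y.
Proof. by case: x y => a b []. Qed.
Lemma Im_mul (x y : C) : Im (x * y) = Re x * Im y + Im x * Re y.
Proof. by case: x y => a b []. Qed.

Lemma complex_ext (x y : C) : Re x = Re y -> Im x = Im y -> x = y.
Proof. by case: x y => a b [c d] /= -> ->. Qed.

Lemma Re_sum (I : Type) (r : seq I) (P : pred I) (F : I -> C) :
  Re (\sum_(i <- r | P i) F i) = \sum_(i <- r | P i) Re (F i).
Proof. by apply: (big_morph Re Re_add). Qed.

Lemma Im_sum (I : Type) (r : seq I) (P : pred I) (F : I -> C) :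
  Im (\sum_(i <- r | P i) F i) = \sum_(i <- r | P i) Im (F i).
Proof. by apply: (big_morph Im Im_add). Qed.

Lemma normc_sqr (z : C) : Normc.normc z ^+ 2 = Re z ^+ 2 + Im z ^+ 2.
Proof. by case: z => a b /=; rewrite sqr_sqrtr// addr_ge0 ?sqr_ge0. Qed.

Lemma normr_normc (z : C) : `|z| = (Normc.normc z)%:C.
Proof. by []. Qed.

Lemma Re_le_normc (z : C) : `|Re z| <= Normc.normc z.
Proof. by rewrite -lecR -normr_normc normc_ge_Re. Qed.

Lemma Im_le_normc (z : C) : `|Im z| <= Normc.normc z.
Proof. by case: z => a b /=; rewrite -sqrtr_sqr ler_wsqrtr// lerDr sqr_ge0. Qed.

Lemma normc_le_ReIm (z : C) : Normc.normc z <= `|Re z| + `|Im z|.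
Proof.
rewrite -(@ler_pXn2r _ 2) ?nnegrE ?addr_ge0//; last by case: z => a b; exact: sqrtr_ge0.
rewrite normc_sqr -(real_normK (num_real (Re z))) -(real_normK (num_real (Im z))).
by rewrite sqrrD lerD2r lerDl mulrn_wge0// mulr_ge0.
Qed.

Lemma Re_continuous : continuous Re.
Proof.
move=> z; apply/(@cvgrPdist_lt _ _ _ (nbhs z) (nbhs_filter z)) => e e0.
have e0C : 0 < e%:C by rewrite ltcR.
near=> w; rewrite -Re_opp -Re_add (le_lt_trans (Re_le_normc _))// -ltcR -normr_normc.
by near: w; exact: (@cvgr_dist_lt _ _ _ (nbhs z) (nbhs_filter z) id z (@cvg_id _ _) _ e0C).
Unshelve. all: by end_near. Qed.

Lemma Im_continuous : continuous Im.
Proof.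
move=> z; apply/(@cvgrPdist_lt _ _ _ (nbhs z) (nbhs_filter z)) => e e0.
have e0C : 0 < e%:C by rewrite ltcR.
near=> w; rewrite -Im_opp -Im_add (le_lt_trans (Im_le_normc _))// -ltcR -normr_normc.
by near: w; exact: (@cvgr_dist_lt _ _ _ (nbhs z) (nbhs_filter z) id z (@cvg_id _ _) _ e0C).
Unshelve. all: by end_near. Qed.

Lemma cvg_complex (T : Type) (F : set_system T) (FF : Filter F) (f : T -> C) (l : C) :
  Re (f x) @[x --> F] --> Re l -> Im (f x) @[x --> F] --> Im l -> f @ F --> l.
Proof.
move=> /cvgrPdist_lt hR /cvgrPdist_lt hI; apply/cvgrPdist_lt => e.
rewrite ltcE => /andP[/eqP /= ie re]; have eE : e = (Re e)%:C by case: e ie {re} => a b /= ->.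
have e2 : 0 < Re e / 2%:R by rewrite divr_gt0.
have := hR _ e2; have := hI _ e2; apply: filterS2 => x hIx hRx.
rewrite eE normr_normc ltcR (le_lt_trans (normc_le_ReIm _))// Re_add Im_add Re_opp Im_opp.
by rewrite [Re e]splitr ltrD.
Qed.

Lemma cvg_mx (T : Type) (F : set_system T) (FF : Filter F) (m n : nat)
    (f : T -> 'M[C]_(m, n)) (l : 'M[C]_(m, n)) :
  (forall i j, f x i j @[x --> F] --> l i j) -> f @ F --> l.
Proof.
move=> h A [P hP PA]; rewrite /nbhs /=; apply: (@filterS _ _ _ (fun x => forall ij : 'I_m * 'I_n,
  P ij.1 ij.2 (f x ij.1 ij.2))).
  by move=> x hx; apply: PA => i j; exact: (hx (i, j)).
by apply: filter_forall => -[i j] /=; exact: h.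
Qed.

Lemma cvg_mxc (T : Type) (F : set_system T) (FF : Filter F) (m n : nat)
    (f : T -> 'M[C]_(m, n)) (l : 'M[C]_(m, n)) :
  (forall i j, Re (f x i j) @[x --> F] --> Re (l i j)) ->
  (forall i j, Im (f x i j) @[x --> F] --> Im (l i j)) -> f @ F --> l.
Proof. by move=> hr hi; apply: cvg_mx => i j; apply: cvg_complex; [exact: hr|exact: hi]. Qed.

Definition is_cderive (u : R -> C) (t : R) (d : C) :=
  is_derive t 1 (fun x => Re (u x)) (Re d) /\ is_derive t 1 (fun x => Im (u x)) (Im d).

Lemma is_cderive_eq u t d d' : is_cderive u t d -> d = d' -> is_cderive u t d'.
Proof. by move=> h <-. Qed.

Lemma is_cderive_cst c t : is_cderive (fun=> c) t 0.
Proof. by split; exact: is_derive_cst. Qed.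

Lemma is_cderiveD u v t a b : is_cderive u t a -> is_cderive v t b ->
  is_cderive (fun x => u x + v x) t (a + b).
Proof.
move=> [ur ui] [vr vi]; split; rewrite ?Re_add ?Im_add.
  by under eq_fun do rewrite Re_add; exact: is_derive1D.
by under eq_fun do rewrite Im_add; exact: is_derive1D.
Qed.

Lemma is_cderiveM u v t a b : is_cderive u t a -> is_cderive v t b ->
  is_cderive (fun x => u x * v x) t (a * v t + u t * b).
Proof.
move=> [ur ui] [vr vi]; split.
  under eq_fun do rewrite Re_mul.
  apply: (is_derive_eq (is_derive1B (is_derive1M ur vr) (is_derive1M ui vi))).
  by rewrite Re_add !Re_mul; ring.
under eq_fun do rewrite Im_mul.
apply: (is_derive_eq (is_derive1D (is_derive1M ur vi) (is_derive1M ui vr))).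
by rewrite Im_add !Im_mul; ring.
Qed.

Lemma is_cderiveZ u t k a : is_cderive u t a -> is_cderive (fun x => k * u x) t (k * a).
Proof.
move=> h; apply: (is_cderive_eq (is_cderiveM (is_cderive_cst k t) h)).
by rewrite mul0r add0r.
Qed.

Lemma is_cderive_sum n (u : 'I_n -> R -> C) t (a : 'I_n -> C) :
  (forall i, is_cderive (u i) t (a i)) ->
  is_cderive (fun x => \sum_i u i x) t (\sum_i a i).
Proof.
elim: n u a => [|n IH] u a h.
  by rewrite big_ord0; under eq_fun do rewrite big_ord0; exact: is_cderive_cst.
rewrite big_ord_recl; under eq_fun do rewrite big_ord_recl.
by apply: is_cderiveD => //; apply: IH => i; exact: h.
Qed.

Lemma is_cderive_horner (p : {poly C}) u t a : is_cderive u t a ->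
  is_cderive (fun x => p.[u x]) t (a * p^`().[u t]).
Proof.
move=> h; elim/poly_ind: p => [|p c IH].
  under eq_fun do rewrite horner0.
  by rewrite deriv0 horner0 mulr0; exact: is_cderive_cst.
under eq_fun do rewrite hornerMXaddC.
apply: (is_cderive_eq (is_cderiveD (is_cderiveM IH h) (is_cderive_cst c t))).
by rewrite derivMXaddC hornerD hornerM hornerX; ring.
Qed.

End ComplexTopology.

(** * Identities for 2 by 2 matrices and the quaternion units *)

Section Matrices2.
Variable R : realType.
Local Notation C := R[i].
Local Notation M2 := 'M[C]_2.
Local Notation ii := (0 +i* 1 : C).

Lemma forall_I2 (P : 'I_2 -> Prop) : P 0 -> P 1 -> forall i, P i.
Proof.
move=> p0 p1 i; have [->//|->//] : i = 0 \/ i = 1.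
by case: i => -[|[|//]] h; [left|right]; apply/val_inj.
Qed.

Lemma mx2P (A B : M2) : A 0 0 = B 0 0 -> A 0 1 = B 0 1 -> A 1 0 = B 1 0 ->
  A 1 1 = B 1 1 -> A = B.
Proof. by move=> h1 h2 h3 h4; apply/matrixP; do 2![apply: forall_I2]. Qed.

Lemma mx2_00 (a b c d : C) : mx2 a b c d 0 0 = a. Proof. by rewrite mxE. Qed.
Lemma mx2_01 (a b c d : C) : mx2 a b c d 0 1 = b. Proof. by rewrite mxE. Qed.
Lemma mx2_10 (a b c d : C) : mx2 a b c d 1 0 = c. Proof. by rewrite mxE. Qed.
Lemma mx2_11 (a b c d : C) : mx2 a b c d 1 1 = d. Proof. by rewrite mxE. Qed.
Definition mx2E := (mx2_00, mx2_01, mx2_10, mx2_11).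

Lemma mx2_eta (A : M2) : A = mx2 (A 0 0) (A 0 1) (A 1 0) (A 1 1).
Proof. by apply: mx2P; rewrite mx2E. Qed.

Lemma sum_I2 (V : nmodType) (F : 'I_2 -> V) : \sum_i F i = F 0 + F 1.
Proof. by rewrite !big_ord_recl big_ord0 addr0; congr (F _ + F _); apply/val_inj. Qed.

Lemma mulmx2E m n (A : 'M[C]_(m, 2)) (B : 'M[C]_(2, n)) i j :
  (A *m B) i j = A i 0 * B 0 j + A i 1 * B 1 j.
Proof. by rewrite mxE sum_I2. Qed.

Lemma mx2_mul (a b c d a' b' c' d' : C) : mx2 a b c d *m mx2 a' b' c' d' =
  mx2 (a * a' + b * c') (a * b' + b * d') (c * a' + d * c') (c * b' + d * d').
Proof. by apply: mx2P; rewrite mulmx2E !mx2E. Qed.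

Lemma mx2_add (a b c d a' b' c' d' : C) : mx2 a b c d + mx2 a' b' c' d' =
  mx2 (a + a') (b + b') (c + c') (d + d').
Proof. by apply: mx2P; rewrite mxE !mx2E. Qed.

Lemma mx2_opp (a b c d : C) : - mx2 a b c d = mx2 (- a) (- b) (- c) (- d).
Proof. by apply: mx2P; rewrite mxE !mx2E. Qed.

Lemma mx2_scale k (a b c d : C) : k *: mx2 a b c d = mx2 (k * a) (k * b) (k * c) (k * d).
Proof. by apply: mx2P; rewrite mxE !mx2E. Qed.

Lemma mx2_scalar k : k%:M = mx2 k 0 0 k :> M2.
Proof. by apply: mx2P; rewrite mxE !mx2E. Qed.

Lemma mx2_tr (a b c d : C) : \tr (mx2 a b c d) = a + d.
Proof. by rewrite /mxtrace sum_I2 !mx2E. Qed.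

Lemma mx2_det (a b c d : C) : \det (mx2 a b c d) = a * d - b * c.
Proof.
rewrite (expand_det_row _ 0) sum_I2 /cofactor !det_mx11 !mxE /= expr0 expr1.
by ring.
Qed.

Lemma iiM (x : C) : ii * (ii * x) = - x.
Proof. by rewrite mulrA -expr2 sqr_i mulN1r. Qed.

Lemma mxI_sqr : mxI R *m mxI R = - 1%:M.
Proof.
rewrite /mxI mx2_mul mx2_scalar mx2_opp !(mul0r, mulr0, add0r, addr0, oppr0) mulrNN.
by rewrite -expr2 sqr_i.
Qed.

Lemma mxJ_sqr : mxJ R *m mxJ R = - 1%:M.
Proof.
by rewrite /mxJ mx2_mul mx2_scalar mx2_opp !(mul0r, mulr0, add0r, addr0, oppr0, mul1r, mulr1).
Qed.

Lemma mxK_sqr : mxK R *m mxK R = - 1%:M.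
Proof.
rewrite /mxK mx2_mul mx2_scalar mx2_opp !(mul0r, mulr0, add0r, addr0, oppr0).
by rewrite -expr2 sqr_i.
Qed.

Lemma cayley_hamilton2 (q : M2) : q *m q = \tr q *: q - (\det q)%:M.
Proof.
rewrite (mx2_eta q) mx2_tr mx2_det mx2_mul mx2_scale mx2_scalar mx2_opp mx2_add.
by congr mx2; ring.
Qed.

(** Both sides are linear in q. For q = 1 the sum is -3; for a unit, say I, the term I I I is -I and
    each of the two anticommuting units gives I. *)
Lemma frame_conj_sum (q : M2) : mxI R *m q *m mxI R + mxJ R *m q *m mxJ R +
  mxK R *m q *m mxK R = q - (2%:R * \tr q)%:M.
Proof.
rewrite (mx2_eta q); move: (q 0 0) (q 0 1) (q 1 0) (q 1 1) => a b c d.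
rewrite /mxI /mxJ /mxK !mx2_mul mx2_tr mx2_scalar mx2_opp !mx2_add.
rewrite !(mul0r, mulr0, add0r, addr0, mulr1, mul1r, mulrN, mulNr, opprK, mulN1r, mulrN1).
rewrite !(mulrC _ ii) !iiM.
by congr mx2; ring.
Qed.

(** The units are orthogonal for the trace form, with tr (X X) / 2 = -1, so the left side is minus
    the traceless part of q. *)
Lemma frame_trace_sum (q : M2) : 2%:R^-1 *: (\tr (q *m mxI R) *: mxI R +
  \tr (q *m mxJ R) *: mxJ R + \tr (q *m mxK R) *: mxK R) = (2%:R^-1 * \tr q)%:M - q.
Proof.
rewrite (mx2_eta q); move: (q 0 0) (q 0 1) (q 1 0) (q 1 1) => a b c d.
rewrite /mxI /mxJ /mxK !mx2_mul !mx2_tr mx2_scalar mx2_opp !mx2_scale !mx2_add ?mx2_scale ?mx2_add.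
have e : ii * ii = -1 by rewrite -expr2 sqr_i.
congr mx2; rewrite !(mul0r, mulr0, add0r, addr0, mulr1, mul1r, mulrN, mulNr, opprK, mulN1r, mulrN1).
- transitivity (2%:R^-1 * (ii * ii * (a - d))); first by ring.
  by rewrite e; field.
- transitivity (2%:R^-1 * (ii * ii * (b + c) + (c - b))); first by ring.
  by rewrite e; field.
- transitivity (2%:R^-1 * (ii * ii * (b + c) + (b - c))); first by ring.
  by rewrite e; field.
- transitivity (2%:R^-1 * (ii * ii * (d - a))); first by ring.
  by rewrite e; field.
Qed.

End Matrices2.

(** * One-parameter subgroups and polynomial spinors *)

Section OneParameterGroups.
Variable R : realType.
Local Notation C := R[i].
Local Notation M2 := 'M[C]_2.

Lemma expmx_sqrN1 (X : M2) (t : R) : X *m X = - 1%:M ->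
  expmx (t%:C *: X) = (cos t)%:C%:M + (sin t)%:C *: X.
Proof.
move=> XX.
have Xn n : X ^+ n = ((~~ odd n)%:R * (-1) ^+ n./2)%:M + ((odd n)%:R * (-1) ^+ n.-1./2) *: X.
  elim: n => [|n IH]; first by rewrite expr0 mul1r mul0r scale0r addr0.
  rewrite exprS IH mulrDr -[X in X + _]/(X *m _%:M) -[X in _ + X]/(X *m (_ *: X)).
  rewrite mul_mx_scalar -scalemxAr XX scalerN scalemx1 addrC /= uphalf_half.
  have [on|en] /= := boolP (odd n).
    have -> : n.-1./2 = n./2.
      by case: n on {IH} => //= n /negbTE on; rewrite uphalf_half on.
    by rewrite !mul0r !scale0r !addr0 !mul1r exprS mulN1r raddfN.
  by rewrite !mul0r raddf0 oppr0.
have E n : series (fun n => (n`!%:R)^-1 *: (t%:C *: X) ^+ n) n =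
    (series (cos_coeff t) n)%:C%:M + (series (sin_coeff t) n)%:C *: X.
  elim: n => [|n IH]; first by rewrite /series /= !big_geq// raddf0 scale0r addr0.
  have n0 : n`!%:R != 0 :> C by rewrite pnatr_eq0 -lt0n fact_gt0.
  have cE : (cos_coeff t n)%:C = n`!%:R^-1 * t%:C ^+ n * ((~~ odd n)%:R * (-1) ^+ n./2) :> C.
    rewrite /cos_coeff /= !rmorphM fmorphV /= !rmorphXn !rmorph_nat rmorphN rmorph1.
    by ring.
  have sE : (sin_coeff t n)%:C = n`!%:R^-1 * t%:C ^+ n * ((odd n)%:R * (-1) ^+ n.-1./2) :> C.
    rewrite /sin_coeff /= !rmorphM fmorphV /= !rmorphXn !rmorph_nat rmorphN rmorph1.
    by ring.
  rewrite !seriesSr IH [(_ + cos_coeff _ _)%:C]rmorphD [(_ + sin_coeff _ _)%:C]rmorphD /= cE sE.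
  rewrite raddfD scalerDl /= addrACA; congr (_ + _).
  by rewrite exprZn scalerA Xn scalerDr scalerA scale_scalar_mx.
apply: cvg_lim; first exact: norm_hausdorff.
rewrite (_ : series _ = fun n => (series (cos_coeff t) n)%:C%:M + (series (sin_coeff t) n)%:C *: X); last first.
  exact/funext.
have cc : series (cos_coeff t) @ \oo --> cos t.
  by rewrite unlock; exact: is_cvg_series_cos_coeff.
have cs : series (sin_coeff t) @ \oo --> sin t.
  by rewrite unlock; exact: is_cvg_series_sin_coeff.
have lin (a b : R) : series (cos_coeff t) n * a + series (sin_coeff t) n * b @[n --> \oo] -->
    cos t * a + sin t * b.
  by apply: cvgD; apply: cvgM => //; exact: cvg_cst.
have eqr (a b : R) i j : complex.Re ((a%:C%:M + b%:C *: X) i j) =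
    a * (i == j)%:R + b * complex.Re (X i j).
  by rewrite !mxE; case: (i == j); case: (X i j) => p q; rewrite /= ?mulr1n ?mulr0n /=; ring.
have eqi (a b : R) i j : complex.Im ((a%:C%:M + b%:C *: X) i j) =
    a * 0 + b * complex.Im (X i j).
  by rewrite !mxE; case: (i == j); case: (X i j) => p q; rewrite /= ?mulr1n ?mulr0n /=; ring.
apply: cvg_mxc => i j.
  by rewrite eqr; under eq_fun do rewrite eqr; exact: lin.
by rewrite eqi; under eq_fun do rewrite eqi; exact: lin.
Qed.

Lemma expmx0 (X : M2) : X *m X = - 1%:M -> expmx ((0 : R)%:C *: X) = 1%:M.
Proof. by move=> XX; rewrite expmx_sqrN1// cos0 sin0 scale0r addr0. Qed.

Lemma is_cderive_expmx (X g : M2) (t : R) i j : X *m X = - 1%:M ->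
  is_cderive (fun t => (g *m expmx (t%:C *: X)) i j) t ((g *m expmx (t%:C *: X) *m X) i j).
Proof.
move=> XX; under eq_fun do rewrite expmx_sqrN1// mulmxDr mul_mx_scalar -scalemxAr !mxE.
have dc : is_cderive (fun t => (cos t)%:C) t (- (sin t))%:C.
  by split => /=; [exact: is_derive_cos|exact: is_derive_cst].
have ds : is_cderive (fun t => (sin t)%:C) t (cos t)%:C.
  by split => /=; [exact: is_derive_sin|exact: is_derive_cst].
apply: (is_cderive_eq (is_cderiveD (is_cderiveM dc (is_cderive_cst _ _))
   (is_cderiveM ds (is_cderive_cst _ _)))).
rewrite !mulr0 !addr0 expmx_sqrN1// mulmxDr mul_mx_scalar -scalemxAr mulmxDl.
rewrite -!scalemxAl -mulmxA XX mulmxN mulmx1 !mxE rmorphN.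
by rewrite mulrN mulNr addrC.
Qed.

(** The class is closed under the left-invariant derivatives, so that membership yields all orders
    of [smooth] at once. Conjugates are absent: in the kernels the adjoint falls on the fixed
    point. *)
Inductive polyfun : (M2 -> C) -> Prop :=
| polyfun_cst c : polyfun (fun=> c)
| polyfun_entry i j : polyfun (fun g => g i j)
| polyfunD p q : polyfun p -> polyfun q -> polyfun (fun g => p g + q g)
| polyfunM p q : polyfun p -> polyfun q -> polyfun (fun g => p g * q g).

Lemma polyfun_continuous p : polyfun p -> continuous p.
Proof.
elim=> [c|i j|p' q' _ hp _ hq|p' q' _ hp _ hq] g.
- exact: cst_continuous.
- exact: coord_continuous.
- by apply: (@cvgD _ _ _ _ (nbhs_filter g)); [exact: hp|exact: hq].
- by apply: (@cvgM _ _ _ (nbhs_filter g)); [exact: hp|exact: hq].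
Qed.

Lemma polyfun_sum n (p : 'I_n -> M2 -> C) : (forall i, polyfun (p i)) ->
  polyfun (fun g => \sum_i p i g).
Proof.
elim: n p => [|n IH] p hp; first by under eq_fun do rewrite big_ord0; exact: polyfun_cst.
by under eq_fun do rewrite big_ord_recl; apply: polyfunD => //; exact: IH.
Qed.

Lemma polyfun_derive X p : X *m X = - 1%:M -> polyfun p -> exists2 q, polyfun q &
  forall g t, is_cderive (fun t => p (g *m expmx (t%:C *: X))) t (q (g *m expmx (t%:C *: X))).
Proof.
move=> XX; elim=> [c|i j|p1 p2 _ [q1 h1 d1] _ [q2 h2 d2]|p1 p2 hp1 [q1 h1 d1] hp2 [q2 h2 d2]].
- by exists (fun=> 0); [exact: polyfun_cst|move=> g t; exact: is_cderive_cst].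
- exists (fun g => (g *m X) i j); last by move=> g t; exact: is_cderive_expmx.
  under eq_fun do rewrite mxE; apply: polyfun_sum => k.
  by apply: polyfunM; [exact: polyfun_entry|exact: polyfun_cst].
- by exists (fun g => q1 g + q2 g); [exact: polyfunD|move=> g t; exact: is_cderiveD].
- exists (fun g => q1 g * p2 g + p1 g * q2 g); last by move=> g t; exact: is_cderiveM.
  by apply: polyfunD; exact: polyfunM.
Qed.

Definition polyspinor (psi : spinor R) := forall i, polyfun (fun g => psi g i 0).

Lemma lie_deriv_is X (psi : spinor R) g (d : 'cV[C]_2) :
  (forall i, is_cderive (along X psi g i) 0 (d i 0)) -> lie_deriv X psi g = d.
Proof.
move=> h; apply/colP => i; rewrite mxE; have [hr hi] := h i.
by apply: complex_ext => /=; exact: is_derive1_val.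
Qed.

Lemma polyspinor_lie_deriv X psi : X *m X = - 1%:M -> polyspinor psi ->
  derivable_along X psi /\ polyspinor (lie_deriv X psi).
Proof.
move=> XX hp.
have H i : exists q, polyfun q /\ forall g t,
    is_cderive (fun t => psi (g *m expmx (t%:C *: X)) i 0) t (q (g *m expmx (t%:C *: X))).
  by have [q hq dq] := polyfun_derive XX (hp i); exists q.
have [q hq] := choice H.
split.
  move=> g i _; have [hr hi] := (hq i).2 g 0.
  by split; [case: hr => r _; exact: r|case: hi => r _; exact: r].
move=> i; have -> : (fun g => lie_deriv X psi g i 0) = q i; last exact: (hq i).1.
apply/funext => g; rewrite (@lie_deriv_is X psi g (\col_i q i g)) ?mxE// => j.
rewrite mxE; have := (hq j).2 g 0; rewrite expmx0// mulmx1; exact.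
Qed.

Lemma frame_sqr X : X \in [:: mxI R; mxJ R; mxK R] -> X *m X = - 1%:M.
Proof.
by rewrite !inE => /or3P[] /eqP ->; [exact: mxI_sqr|exact: mxJ_sqr|exact: mxK_sqr].
Qed.

Lemma polyspinor_continuous psi : polyspinor psi -> continuous psi.
Proof.
move=> h g; apply: (@cvg_mx _ _ _ (nbhs_filter g)) => i j; rewrite (ord1 j); exact: (polyfun_continuous (h i)).
Qed.

Lemma polyspinor_smooth psi : polyspinor psi -> smooth psi.
Proof.
move=> hp k; elim: k psi hp => [|k IH] psi hp.
  by split => //; exact/continuous_subspaceT/polyspinor_continuous.
split; first exact/continuous_subspaceT/polyspinor_continuous.
move=> X /frame_sqr XX; have [h1 h2] := polyspinor_lie_deriv XX hp.
by split => //; exact: IH.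
Qed.

End OneParameterGroups.

Section SU2Facts.
Variable R : realType.
Local Notation C := R[i].
Local Notation M2 := 'M[C]_2.
Local Notation Re := (@complex.Re R).
Local Notation Im := (@complex.Im R).

Definition adj m n (A : 'M[C]_(m, n)) : 'M[C]_(n, m) := map_mx conjc A^T.

Lemma adjK m n (A : 'M[C]_(m, n)) : adj (adj A) = A.
Proof. by apply/matrixP => i j; rewrite !mxE conjcK. Qed.

Lemma adjM m n p (A : 'M[C]_(m, n)) (B : 'M[C]_(n, p)) : adj (A *m B) = adj B *m adj A.
Proof. by rewrite /adj trmx_mul map_mxM. Qed.

Lemma adjD m n (A B : 'M[C]_(m, n)) : adj (A + B) = adj A + adj B.
Proof. by apply/matrixP => i j; rewrite !mxE rmorphD. Qed.

Lemma adjZ m n k (A : 'M[C]_(m, n)) : adj (k *: A) = conjc k *: adj A.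
Proof. by apply/matrixP => i j; rewrite !mxE rmorphM. Qed.

Lemma adj_scalar n k : adj (k%:M : 'M[C]_n) = (conjc k)%:M.
Proof. by apply/matrixP => i j; rewrite !mxE eq_sym; case: (i == j); rewrite ?mulr1n ?mulr0n ?conjc0. Qed.

Lemma adj_mx2 (a b c d : C) : adj (mx2 a b c d) = mx2 (conjc a) (conjc c) (conjc b) (conjc d).
Proof. by apply: mx2P; rewrite !mxE. Qed.

Lemma SU2_mx2 (g : M2) : SU2 g <-> exists z w : C, g = mx2 z w (- conjc w) (conjc z) /\
  z * conjc z + w * conjc w = 1.
Proof.
split=> [[/unitarymxP gU dg]|[z [w [-> zw]]]]; last first.
  split; last by rewrite mx2_det mulrN opprK.
  apply/unitarymxP; rewrite -[_ *m _]/(_ *m adj _) adj_mx2 mx2_mul mx2_scalar.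
  rewrite rmorphN /= !conjcK; congr mx2; rewrite -?zw; ring.
have gK : adj g *m g = 1%:M by apply: mulmx1C; exact: gU.
have Gadj : adj g = mx2 (g 1 1) (- g 0 1) (- g 1 0) (g 0 0).
  rewrite -[RHS]mul1mx -gK -mulmxA -[LHS]mulmx1; congr (_ *m _).
  rewrite {1}(mx2_eta g) mx2_mul mx2_scalar.
  by move: dg; rewrite {1}(mx2_eta g) mx2_det => <-; congr mx2; ring.
exists (g 0 0), (g 0 1).
have e1 : conjc (g 0 0) = g 1 1.
  by have := congr1 (fun A : M2 => A 0 0) Gadj; rewrite mx2E !mxE.
have e2 : conjc (g 0 1) = - g 1 0.
  by have := congr1 (fun A : M2 => A 1 0) Gadj; rewrite mx2E !mxE.
rewrite e1 e2 opprK -mx2_eta; split=> //.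
by rewrite -dg {5}(mx2_eta g) mx2_det; ring.
Qed.

Lemma SU2_adjr (g : M2) : SU2 g -> g *m adj g = 1%:M.
Proof. by move=> [/unitarymxP gU _]; exact: gU. Qed.

Lemma SU2_adjl (g : M2) : SU2 g -> adj g *m g = 1%:M.
Proof. by move=> /SU2_adjr; exact: mulmx1C. Qed.

Lemma SU2_1 : SU2 (1%:M : M2).
Proof.
by apply/SU2_mx2; exists 1, 0; rewrite mx2_scalar conjc0 conjc1 oppr0 mulr1 mulr0 addr0.
Qed.

Lemma SU2_mul (g h : M2) : SU2 g -> SU2 h -> SU2 (g *m h).
Proof.
move=> sg sh; split; last by rewrite det_mulmx sg.2 sh.2 mulr1.
apply/unitarymxP; rewrite -[_ *m _]/(_ *m adj _) adjM mulmxA -[_ *m h *m _]mulmxA.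
by rewrite SU2_adjr// mulmx1 SU2_adjr.
Qed.

Lemma SU2_adj (g : M2) : SU2 g -> SU2 (adj g).
Proof.
move=> /SU2_mx2[z [w [-> zw]]]; apply/SU2_mx2; exists (conjc z), (- w).
by rewrite adj_mx2 !rmorphN /= !conjcK opprK mulrNN -zw; split=> //; ring.
Qed.

Lemma SU2_invmx (g : M2) : SU2 g -> invmx g = adj g.
Proof.
move=> sg; have gU : g \in unitmx by rewrite unitmxE sg.2 unitr1.
by rewrite -[RHS]mul1mx -(mulVmx gU) -mulmxA SU2_adjr// mulmx1.
Qed.

Lemma SU2_exp X (t : R) : X \in [:: mxI R; mxJ R; mxK R] -> SU2 (expmx (t%:C *: X)).
Proof.
move=> hX; rewrite expmx_sqrN1 ?frame_sqr//; move: hX.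
have cs : (cos t)%:C * (cos t)%:C + (sin t)%:C * (sin t)%:C = 1 :> C.
  by rewrite -!rmorphM -rmorphD /= -!expr2 cos2Dsin2.
have ci (x : R) : conjc (x *i) = - (x *i) by apply: complex_ext => /=; rewrite ?oppr0.
have cci (x y : R) : conjc (x%:C + y *i) = x%:C - y *i.
  by apply: complex_ext => /=; rewrite ?addr0 ?add0r ?oppr0 ?addr0.
have iE (x : R) : x%:C * (0 +i* 1) = x *i by apply: complex_ext => /=; ring.
have ii2 (x : R) : x *i * x *i = - (x%:C * x%:C) :> C by apply: complex_ext => /=; ring.
rewrite !inE => /or3P[] /eqP ->; apply/SU2_mx2.
- exists ((cos t)%:C + (sin t) *i), 0.
  rewrite cci /mxI mx2_scalar mx2_scale mx2_add iE mulrN iE.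
  rewrite !mulr0 !addr0 conjc0 oppr0 mulr0 addr0; split=> //.
  by rewrite -cs; transitivity ((cos t)%:C * (cos t)%:C - (sin t) *i * (sin t) *i);
    [ring|rewrite ii2 opprK].
- exists (cos t)%:C, (sin t)%:C.
  rewrite !conjc_real /mxJ mx2_scalar mx2_scale mx2_add; split=> //.
  by congr mx2; ring.
- exists (cos t)%:C, ((sin t) *i).
  rewrite conjc_real ci /mxK mx2_scalar mx2_scale mx2_add !iE; split.
    by congr mx2; ring.
  by rewrite mulrN ii2 opprK.
Qed.

(* The inner product of g and y as vectors of the unit sphere of R^4. *)
Definition sdot (g y : M2) : R := Re (2%:R^-1 * \tr (adj g *m y)).

Lemma SU2_trace (q : M2) : SU2 q ->
  2%:R^-1 * \tr q = (Re (q 0 0))%:C /\ `|Re (q 0 0)| <= 1.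
Proof.
move=> /SU2_mx2[z [w [-> zw]]]; rewrite mx2_tr mx2E; split.
  by case: z {zw} => a b; rewrite addcJ /= mulKf// pnatr_eq0.
rewrite (le_trans (Re_le_normc _))// -(@expr_le1 _ 2)//; last by case: z {zw} => a b; exact: sqrtr_ge0.
have := congr1 Re zw; rewrite normc_sqr Re_add !Re_mul.
case: z {zw} => a b; case: w => c d /= <-.
have := sqr_ge0 c; have := sqr_ge0 d; nra.
Qed.

Lemma sdotE (g y : M2) : SU2 g -> SU2 y -> 2%:R^-1 * \tr (adj g *m y) = (sdot g y)%:C.
Proof. by move=> sg sy; rewrite /sdot (SU2_trace (SU2_mul (SU2_adj sg) sy)).1. Qed.

Lemma sdot_le1 (g y : M2) : SU2 g -> SU2 y -> `|sdot g y| <= 1.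
Proof.
move=> sg sy; rewrite /sdot (SU2_trace (SU2_mul (SU2_adj sg) sy)).1.
exact: (SU2_trace (SU2_mul (SU2_adj sg) sy)).2.
Qed.

Lemma mxtrace_adj (A : M2) : \tr (adj A) = conjc (\tr A).
Proof. by rewrite (mx2_eta A) adj_mx2 !mx2_tr rmorphD. Qed.

Lemma sdotC (g y : M2) : sdot g y = sdot y g.
Proof.
rewrite /sdot -[adj g *m y]adjK mxtrace_adj adjM adjK.
have -> : 2%:R^-1 = (2%:R^-1 : R)%:C by rewrite fmorphV rmorph_nat.
by case: (\tr _) => a b; rewrite !Re_mul /= !mul0r.
Qed.

Lemma sdotMr (g y h : M2) : SU2 h -> sdot (g *m h) (y *m h) = sdot g y.
Proof.
move=> sh; rewrite /sdot adjM -mulmxA mxtrace_mulC -!mulmxA SU2_adjr// mulmx1.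
by [].
Qed.

Lemma sdotMr_adj (g y h : M2) : SU2 h -> sdot g (y *m h) = sdot (g *m adj h) y.
Proof.
by move=> sh; rewrite -(sdotMr (g *m adj h) y sh) -mulmxA SU2_adjl// mulmx1.
Qed.

Lemma sdot_self (g : M2) : SU2 g -> sdot g g = 1.
Proof.
by move=> sg; rewrite /sdot SU2_adjl// mxtrace1 mulVf// pnatr_eq0.
Qed.

End SU2Facts.

(** * The kernels K_j and their eigenvalue equation *)

Section SpectralKernel.
Variable R : realType.
Local Notation C := R[i].
Local Notation M2 := 'M[C]_2.

Definition chebC (j : int) : {poly C} :=
  (sgz j)%:~R * map_poly (real_complex R) (chebU R `|j|%N).

Lemma chebC_horner j (x : R) : (chebC j).[x%:C] = (chebZ x j)%:C.
Proof.
by rewrite /chebC hornerM horner_map -(rmorph_int polyC) hornerC /chebZ rmorphM rmorph_int.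
Qed.

Lemma chebC_ode j : (1 - 'X ^+ 2) * (chebC j)^`()^`() =
  3%:R * 'X * (chebC j)^`() - (j%:~R ^+ 2 - 1) * chebC j.
Proof.
have := congr1 (map_poly (real_complex R)) (chebU_ode R `|j|).
have m1 : map_poly (real_complex R) (1 - 'X ^+ 2) = 1 - 'X ^+ 2.
  by rewrite rmorphB rmorph1 rmorphXn /= map_polyX.
have m2 : map_poly (real_complex R) (3%:R * 'X) = 3%:R * 'X.
  by rewrite rmorphM rmorph_nat /= map_polyX.
have m3 : map_poly (real_complex R) (`|j|%:R ^+ 2 - 1) = `|j|%:R ^+ 2 - 1.
  by rewrite rmorphB rmorph1 rmorphXn rmorph_nat.
have hM (p q : {poly R}) : map_poly (real_complex R) (p * q) =
    map_poly (real_complex R) p * map_poly (real_complex R) q by rewrite rmorphM.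
have hB (p q : {poly R}) : map_poly (real_complex R) (p - q) =
    map_poly (real_complex R) p - map_poly (real_complex R) q by rewrite rmorphB.
rewrite hM m1 hB (hM (3%:R * 'X)) m2 (hM (_ - 1)) m3 -!deriv_map => h.
have e : `|j|%:R ^+ 2 = j%:~R ^+ 2 :> {poly C}.
  by clear; case: j => n; rewrite ?NegzE ?rmorphN ?sqrrN -?pmulrn ?abszN.
rewrite e in h; rewrite /chebC; move: h; set u := map_poly _ _ => h.
have d (p : {poly C}) : ((sgz j)%:~R * p)^`() = (sgz j)%:~R * p^`().
  by rewrite -(rmorph_int polyC) mul_polyC derivZ -mul_polyC.
by rewrite !d mulrCA h; ring.
Qed.

(** Let P = I X_1 + J X_2 + K X_3, u = [chebC j] and t = tr q / 2. By [frame_trace_sum], P u = (t -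
    q) u', so A + B q = (P + j - 1) u. As P^2 - 2 P is the positive Laplacian, for which u has
    eigenvalue j^2 - 1, one has (P - (j + 1)) (P + (j - 1)) u = 0; thus A + B q has eigenvalue j + 1
    under P, and j - 1/2 under D = P - 3/2. *)
Definition kerA j := j%:~R * chebC j + 'X * (chebC j)^`() - chebC j.
Definition kerB j := - (chebC j)^`().

Lemma deriv_int_mul (k : int) (p : {poly C}) : (k%:~R * p)^`() = k%:~R * p^`().
Proof. by rewrite -(rmorph_int polyC) mul_polyC derivZ -mul_polyC. Qed.

(** The coefficient of 1 in P (A + B q) = (j + 1) (A + B q), once q^2 is replaced by 2 t q - 1;
    [ker_eigenB] is the coefficient of q. *)
Lemma ker_eigenA j : 'X * (kerA j)^`() + (kerB j)^`() - 4%:R * 'X * kerB j =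
  (1 + j%:~R) * kerA j.
Proof.
have := chebC_ode j; rewrite /kerA /kerB; move: (chebC j) => u ode.
rewrite derivB derivD deriv_int_mul derivM derivX derivN.
transitivity (- ((1 - 'X ^+ 2) * u^`()^`()) + j%:~R * 'X * u^`() + 4%:R * 'X * u^`()).
  by ring.
by rewrite ode; ring.
Qed.

Lemma ker_eigenB j : - (kerA j)^`() - 'X * (kerB j)^`() + kerB j = (1 + j%:~R) * kerB j.
Proof.
rewrite /kerA /kerB; move: (chebC j) => u.
by rewrite derivB derivD deriv_int_mul derivM derivX derivN; ring.
Qed.

(* The reproducing kernel of the eigenspace of the Dirac operator on SU(2) for
   the eigenvalue j - 1/2; the adjoint of the second point is an argument. *)
Definition kerp j (h y : M2) : M2 :=
  2%:R^-1 *: ((kerA j).[2%:R^-1 * \tr (h *m y)]%:M +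
              (kerB j).[2%:R^-1 * \tr (h *m y)] *: (h *m y)).

Definition kernel j (y g : M2) : M2 := kerp j (adj g) y.

Definition kerfun j (g : M2) (v : 'cV[C]_2) : spinor R := fun y => kernel j y g *m v.

Lemma polyfun_horner (p : {poly C}) u : polyfun u -> polyfun (fun g : M2 => p.[u g]).
Proof.
move=> hu; elim/poly_ind: p => [|p c IH].
  by under eq_fun do rewrite horner0; exact: polyfun_cst.
under eq_fun do rewrite hornerMXaddC.
by apply: polyfunD; [exact: polyfunM|exact: polyfun_cst].
Qed.

Lemma polyfun_mul (h : M2) i j : polyfun (fun y : M2 => (h *m y) i j).
Proof.
under eq_fun do rewrite mxE; apply: polyfun_sum => k.
by apply: polyfunM; [exact: polyfun_cst|exact: polyfun_entry].
Qed.

Lemma polyfun_tr (h : M2) : polyfun (fun y : M2 => 2%:R^-1 * \tr (h *m y)).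
Proof.
apply: polyfunM; first exact: polyfun_cst.
by apply: polyfun_sum => i; exact: polyfun_mul.
Qed.

Lemma kerfunE j g v y i : kerfun j g v y i 0 = 2%:R^-1 *
  ((kerA j).[2%:R^-1 * \tr (adj g *m y)] * v i 0 +
   (kerB j).[2%:R^-1 * \tr (adj g *m y)] * \sum_k (adj g *m y) i k * v k 0).
Proof.
rewrite /kerfun /kernel /kerp -scalemxAl mulmxDl mul_scalar_mx -scalemxAl.
by rewrite !mxE.
Qed.

Lemma kerfun_poly j g v : polyspinor (kerfun j g v).
Proof.
move=> i; under eq_fun do rewrite kerfunE.
apply: polyfunM; first exact: polyfun_cst.
apply: polyfunD; apply: polyfunM; try exact: polyfun_cst; try exact/polyfun_horner/polyfun_tr.
apply: polyfun_sum => k; apply: polyfunM; [exact: polyfun_mul|exact: polyfun_cst].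
Qed.

Lemma kerfun_lie X j g v y : X *m X = - 1%:M ->
  let q := adj g *m y in let t := 2%:R^-1 * \tr q in let s := 2%:R^-1 * \tr (q *m X) in
  lie_deriv X (kerfun j g v) y = 2%:R^-1 *: ((s * (kerA j)^`().[t]) *: v +
    (s * (kerB j)^`().[t]) *: (q *m v) + (kerB j).[t] *: (q *m X *m v)).
Proof.
move=> XX q t s; apply: lie_deriv_is => i.
have dq a b : is_cderive (fun x => (adj g *m (y *m expmx (x%:C *: X))) a b) 0 ((q *m X) a b).
  under eq_fun do rewrite mulmxA -/q.
  by have := @is_cderive_expmx R X q 0 a b XX; rewrite expmx0// mulmx1.
have dt : is_cderive (fun x => 2%:R^-1 * \tr (adj g *m (y *m expmx (x%:C *: X)))) 0 s.
  by apply: is_cderiveZ; exact: is_cderive_sum.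
have e0 : 2%:R^-1 * \tr (adj g *m (y *m expmx ((0:R)%:C *: X))) = t by rewrite expmx0// mulmx1.
have e1 : adj g *m (y *m expmx ((0:R)%:C *: X)) = q by rewrite expmx0// mulmx1.
rewrite /along; under eq_fun do rewrite kerfunE.
apply: (is_cderive_eq (is_cderiveZ _ (is_cderiveD
  (is_cderiveM (is_cderive_horner (kerA j) dt) (is_cderive_cst _ _))
  (is_cderiveM (is_cderive_horner (kerB j) dt)
    (is_cderive_sum (fun k => is_cderiveM (dq i k) (is_cderive_cst (v k 0) _))))))).
rewrite e0 e1 !mxE; congr (_ * _).
have -> : \sum_k ((q *m X) i k * v k 0 + q i k * 0) = \sum_k (q *m X) i k * v k 0.
  by apply: eq_bigr => k _; rewrite mulr0 addr0.
by rewrite mulr0 addr0 addrA.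
Qed.

Lemma dirac_kerfun_algebra j (q : M2) (v : 'cV[C]_2) : \det q = 1 ->
  let t := 2%:R^-1 * \tr q in
  let L X := 2%:R^-1 *: ((2%:R^-1 * \tr (q *m X) * (kerA j)^`().[t]) *: v +
    (2%:R^-1 * \tr (q *m X) * (kerB j)^`().[t]) *: (q *m v) + (kerB j).[t] *: (q *m X *m v)) in
  let phi := 2%:R^-1 *: ((kerA j).[t] *: v + (kerB j).[t] *: (q *m v)) in
  mxI R *m L (mxI R) + mxJ R *m L (mxJ R) + mxK R *m L (mxK R) - (3%:R / 2%:R) *: phi =
    (j%:~R - 2%:R^-1) *: phi.
Proof.
move=> dq t L phi.
have trq : \tr q = 2%:R * t by rewrite /t mulVKf// pnatr_eq0.
have q2 : q *m (q *m v) = (2%:R * t) *: (q *m v) - v.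
  by rewrite mulmxA cayley_hamilton2 dq mulmxBl mul1mx -scalemxAl trq.
have h1 : mxI R *m (q *m mxI R *m v) + mxJ R *m (q *m mxJ R *m v) + mxK R *m (q *m mxK R *m v) =
    q *m v - (4%:R * t) *: v.
  rewrite !mulmxA -!mulmxDl frame_conj_sum mulmxBl mul_scalar_mx trq mulrA.
  by rewrite -natrM.
have h2 (w : 'cV[C]_2) : (2%:R^-1 * \tr (q *m mxI R)) *: (mxI R *m w) +
    (2%:R^-1 * \tr (q *m mxJ R)) *: (mxJ R *m w) +
    (2%:R^-1 * \tr (q *m mxK R)) *: (mxK R *m w) = t *: w - q *m w.
  have := frame_trace_sum q; rewrite 2!scalerDr !scalerA => /(congr1 (mulmx^~ w)).
  by rewrite mulmxBl mul_scalar_mx !mulmxDl -!scalemxAl.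
have eA : t * (kerA j)^`().[t] + (kerB j)^`().[t] - 4%:R * t * (kerB j).[t] =
    (1 + j%:~R) * (kerA j).[t].
  have := congr1 (horner^~ t) (ker_eigenA j).
  by rewrite -(rmorph_int polyC) -[1]/(1%:P) -(polyC_natr _ 4) !(hornerD, hornerN, hornerM, hornerX, hornerC).
have eB : - (kerA j)^`().[t] - t * (kerB j)^`().[t] + (kerB j).[t] = (1 + j%:~R) * (kerB j).[t].
  have := congr1 (horner^~ t) (ker_eigenB j).
  by rewrite -(rmorph_int polyC) -[1]/(1%:P) !(hornerD, hornerN, hornerM, hornerX, hornerC).
have LE X : X *m L X = 2%:R^-1 *: ((2%:R^-1 * \tr (q *m X) * (kerA j)^`().[t]) *: (X *m v) +
    (2%:R^-1 * \tr (q *m X) * (kerB j)^`().[t]) *: (X *m (q *m v)) +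
    (kerB j).[t] *: (X *m (q *m X *m v))).
  by rewrite /L -scalemxAr !mulmxDr -!scalemxAr.
(* From here on the vectors matter only through [h1] and the two instances of [h2]; abstracting them
   leaves a scalar identity in each coordinate. *)
rewrite !LE /phi; move: (h2 v) (h2 (q *m v)) h1 eA eB; rewrite q2.
move: (2%:R^-1 * \tr (q *m mxI R)) (2%:R^-1 * \tr (q *m mxJ R)) (2%:R^-1 * \tr (q *m mxK R)) => c1 c2 c3.
move: (mxI R *m (q *m mxI R *m v)) (mxJ R *m (q *m mxJ R *m v)) (mxK R *m (q *m mxK R *m v)) => z1 z2 z3.
move: (mxI R *m (q *m v)) (mxJ R *m (q *m v)) (mxK R *m (q *m v)) => y1 y2 y3.
move: (mxI R *m v) (mxJ R *m v) (mxK R *m v) (q *m v) => x1 x2 x3 w.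
move: (kerA j).[t] (kerB j).[t] (kerA j)^`().[t] (kerB j)^`().[t] => A B A' B'.
clearbody t => /colP hx /colP hy /colP hz eA eB; apply/colP => i.
move: (hx i) (hy i) (hz i); rewrite !mxE.
move: (x1 i 0) (x2 i 0) (x3 i 0) (y1 i 0) (y2 i 0) (y3 i 0) (z1 i 0) (z2 i 0) (z3 i 0) (v i 0) (w i 0).
move=> a1 a2 a3 b1 b2 b3 d1 d2 d3 m n ex ey ez.
transitivity (2%:R^-1 * (A' * (c1 * a1 + c2 * a2 + c3 * a3) + B' * (c1 * b1 + c2 * b2 + c3 * b3) +
  B * (d1 + d2 + d3)) - 3%:R / 2%:R * (2%:R^-1 * (A * m + B * n))); first by ring.
rewrite ex ey ez.
transitivity (2%:R^-1 * ((t * A' + B' - 4%:R * t * B) * m + (- A' - t * B' + B) * n) -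
  3%:R / 2%:R * (2%:R^-1 * (A * m + B * n))); first by ring.
by rewrite eA eB; field.
Qed.

Lemma dirac_kerfun j g v y : SU2 g -> SU2 y ->
  dirac_op (kerfun j g v) y = (j%:~R - 2%:R^-1) *: kerfun j g v y.
Proof.
move=> sg sy; rewrite /dirac_op !kerfun_lie ?mxI_sqr ?mxJ_sqr ?mxK_sqr//=.
have [_ dq] := SU2_mul (SU2_adj sg) sy.
have e : kerfun j g v y = 2%:R^-1 *: ((kerA j).[2%:R^-1 * \tr (adj g *m y)] *: v +
    (kerB j).[2%:R^-1 * \tr (adj g *m y)] *: (adj g *m y *m v)).
  by rewrite /kerfun /kernel /kerp -scalemxAl mulmxDl mul_scalar_mx -scalemxAl.
by rewrite e; exact: dirac_kerfun_algebra.
Qed.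

End SpectralKernel.

(** * Integration on SU(2) *)

Section HopfCoordinates.
Variable R : realType.
Local Notation C := R[i].
Local Notation M2 := 'M[C]_2.
Local Notation T := (R * R * R)%type.
Local Notation leb := (@lebesgue_measure R).
Local Notation cube := (@unit_cube R).
Local Notation Re := (@complex.Re R).
Local Notation Im := (@complex.Im R).

Lemma conjcM (x y : C) : conjc (x * y) = conjc x * conjc y.
Proof. exact: rmorphM. Qed.

Lemma conjcD (x y : C) : conjc (x + y) = conjc x + conjc y.
Proof. exact: rmorphD. Qed.

Definition clamp (x : R) : R := Num.max 0 (Num.min 1 x).
Definition clampT (p : T) : T := ((clamp p.1.1, p.1.2), p.2).
(* Total and continuous on R^3, with values in SU(2); equal to hopf on the cube. *)
Definition hopfc (p : T) : M2 := hopf (clampT p).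

Lemma clamp_itv x : 0 <= clamp x <= 1.
Proof. by rewrite /clamp le_max lexx /= ge_max ler01 /= ge_min lexx. Qed.

Lemma clamp_id x : 0 <= x <= 1 -> clamp x = x.
Proof. by move=> /andP[x0 x1]; rewrite /clamp min_r// max_r. Qed.

Lemma in_cube (p : T) : cube p <-> [/\ 0 <= p.1.1 <= 1, 0 <= p.1.2 <= 1 & 0 <= p.2 <= 1].
Proof. by rewrite /unit_cube /= !in_itv /=; split => [[[]]|[]]. Qed.

Lemma clampT_cube p : cube p -> clampT p = p.
Proof.
by case: p => -[s a] b /in_cube[/= h _ _]; rewrite /clampT /= clamp_id.
Qed.

Lemma hopfcE p : cube p -> hopfc p = hopf p.
Proof. by move=> hp; rewrite /hopfc clampT_cube. Qed.

Lemma expi_conj (t : R) : expi t * conjc (expi t) = 1.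
Proof.
rewrite /expi; apply: complex_ext => /=; last by ring.
by rewrite mulrN opprK -!expr2 cos2Dsin2.
Qed.

Lemma hopf_SU2_itv (p : T) : 0 <= p.1.1 <= 1 -> SU2 (hopf p).
Proof.
case: p => -[s a] b /= /andP[s0 s1]; apply/SU2_mx2.
exists ((Num.sqrt s)%:C * expi (2%:R * pi * a)), ((Num.sqrt (1 - s))%:C * expi (2%:R * pi * b)).
split=> //; rewrite !conjcM !conjc_real.
transitivity ((Num.sqrt s)%:C ^+ 2 * (expi (2%:R * pi * a) * conjc (expi (2%:R * pi * a)))
  + (Num.sqrt (1 - s))%:C ^+ 2 * (expi (2%:R * pi * b) * conjc (expi (2%:R * pi * b)))).
  by ring.
rewrite !expi_conj !mulr1 -!rmorphXn /= !sqr_sqrtr ?subr_ge0//.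
by rewrite -rmorphD /= addrC subrK.
Qed.

Lemma hopf_SU2 (p : T) : cube p -> SU2 (hopf p).
Proof. by move=> /in_cube[h _ _]; exact: hopf_SU2_itv. Qed.

Lemma hopfc_SU2 (p : T) : SU2 (hopfc p).
Proof. by apply: hopf_SU2_itv => /=; exact: clamp_itv. Qed.

Lemma expi_surj (z : C) : z * conjc z = 1 -> exists2 a, 0 <= a <= 1 & z = expi (2%:R * pi * a).
Proof.
case: z => x y h; have {h} xy : x ^+ 2 + y ^+ 2 = 1.
  by have := congr1 Re h; rewrite /= mulrN opprK -!expr2.
have x1 : -1 <= x <= 1.
  by rewrite -ler_norml -(@expr_le1 _ 2)// real_normK ?num_real// -xy lerDl sqr_ge0.
have ca := acosK x1; have [a0 api] := (acos_ge0 x1, acos_lepi x1).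
have sa : sin (acos x) = `|y|.
  rewrite sin_acos// -[RHS]ger0_norm// -sqrtr_sqr real_normK ?num_real//.
  by rewrite -xy addrAC subrr add0r.
have pi0 := pi_gt0 R.
have p2 : 2%:R * pi != 0 :> R by rewrite mulf_neq0// gt_eqF.
have h : 0 <= acos x / (2%:R * pi) <= 1.
  apply/andP; split; first by rewrite divr_ge0// mulr_ge0// ltW.
  by rewrite ler_pdivrMr ?mulr_gt0// mul1r (le_trans api)// ler_peMl ?ler1n// ltW.
have [y0|y0] := leP 0 y.
  exists (acos x / (2%:R * pi)) => //.
  by rewrite mulrCA mulfV// mulr1 /expi ca sa ger0_norm.
exists (1 - acos x / (2%:R * pi)).
  by case/andP: h => h1 h2; rewrite subr_ge0 h2 gerBl.
rewrite mulrBr mulr1 mulrCA mulfV// mulr1 /expi.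
rewrite mulr_natl cosB sinB cos2pi sin2pi ca sa ltr0_norm//.
by congr (_ +i* _); ring.
Qed.

Lemma polar_surj (z : C) : exists2 a, 0 <= a <= 1 &
  z = (Num.sqrt (Re (z * conjc z)))%:C * expi (2%:R * pi * a).
Proof.
have [->|z0] := eqVneq z 0.
  by exists 0; rewrite ?lexx ?ler01// mul0r /= sqrtr0 mul0r.
pose r := Num.sqrt (Re (z * conjc z)).
have zr : z * conjc z = (Re (z * conjc z))%:C by case: (z) => x y; apply: complex_ext => /=; ring.
have r2 : 0 <= Re (z * conjc z) by case: (z) => x y /=; rewrite mulrN opprK addr_ge0// -expr2 sqr_ge0.
have rr : r%:C * r%:C = z * conjc z by rewrite -rmorphM /= -expr2 sqr_sqrtr.
have r0 : r%:C != 0.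
  by apply: contraNneq z0 => r0; move: rr; rewrite r0 mul0r => /esym/eqP; rewrite mulf_eq0 conjc_eq0 orbb.
have [|a ha e] := expi_surj (z := z / r%:C).
  by rewrite conjcM conjc_inv conjc_real mulrACA -rr -invfM mulfV// mulf_neq0.
by exists a => //; rewrite -e mulrC divfK.
Qed.

Lemma hopf_surj (g : M2) : SU2 g -> exists2 p, cube p & hopf p = g.
Proof.
move=> /SU2_mx2[z [w [-> zw]]].
have [a ha za] := polar_surj z; have [b hb wb] := polar_surj w.
pose s := Re (z * conjc z).
have s0 : 0 <= s by rewrite /s; case: (z) => x y /=; rewrite mulrN opprK addr_ge0// -expr2 sqr_ge0.
have t0 : 0 <= Re (w * conjc w).
  by case: (w) => x y /=; rewrite mulrN opprK addr_ge0// -expr2 sqr_ge0.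
have st : Re (w * conjc w) = 1 - s.
  by have := congr1 Re zw; rewrite Re_add => /= <-; rewrite addrAC subrr add0r.
exists ((s, a), b); first by apply/in_cube; split => //=; rewrite s0 -subr_ge0 -st.
pose Z := (Num.sqrt s)%:C * expi (2%:R * pi * a).
pose W := (Num.sqrt (1 - s))%:C * expi (2%:R * pi * b).
have -> : hopf ((s, a), b) = mx2 Z W (- conjc W) (conjc Z) by [].
by have -> : Z = z by []; have -> : W = w by rewrite /W -st.
Qed.

(** Every point of U lies in a box with rational centre and radius contained in U, so U is a
    countable union of products of intervals. *)
Lemma open_measurable3 (U : set T) : open U -> measurable U.
Proof.
move=> oU.
pose itv (q r : rat) : set R := [set` `](ratr q - ratr r)%R, (ratr q + ratr r)%R[].
pose box (q : rat * rat * rat * rat) : set T :=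
  (itv q.1.1.1 q.2 `*` itv q.1.1.2 q.2) `*` itv q.1.2 q.2.
have -> : U = \bigcup_q (if pselect (box q `<=` U) then box q else set0).
  apply/seteqP; split=> [p Up|p [q _]]; last by case: pselect => // h; exact: h.
  have /nbhs_ballP[e /= e0 eU] : nbhs p U by exact: open_nbhs_nbhs.
  have [r] : exists r, ratr r \in `]0, (e / 2%:R)[.
    by apply: rat_in_itvoo; rewrite divr_gt0.
  rewrite in_itv /= => /andP[r0 re].
  have near (x : R) : exists q, ratr q \in `](x - ratr r), (x + ratr r)[.
    by apply: rat_in_itvoo; rewrite ltrD2l gtrN.
  have [[q1 h1] [[q2 h2] [q3 h3]]] := (near p.1.1, (near p.1.2, near p.2)).
  rewrite !in_itv /= in h1 h2 h3.
  exists (((q1, q2), q3), r) => //=; case: (pselect _) => [bU|] /=.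
    by rewrite /box /itv /= !in_itv /=; split; [split|]; lra.
  case=> x; rewrite /box /itv /= !in_itv /= => -[[x1 x2] x3]; apply: eU.
  split; [split|]; rewrite /ball /= ltr_norml; lra.
apply: countable_bigcupT_measurable; first exact: countableP.
move=> q; have mb : measurable (box q).
  by apply: measurableX; [apply: measurableX|]; exact: measurable_itv.
by case: (pselect _) => _ //=.
Qed.

Lemma continuous_measurable3 (f : T -> R) : continuous f -> measurable_fun setT f.
Proof.
move=> /continuousP cf; apply: (measurability _ (RGenOpens.measurableE R)).
move=> _ [_ [a [b ->] <-]]; rewrite setTI; apply: open_measurable3.
exact/cf/interval_open.
Qed.

Lemma clamp_continuous : continuous clamp.
Proof.
move=> x; rewrite /clamp; apply: (@continuous_max _ _ (fun=> 0)) => //; first exact: cst_continuous.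
by apply: (@continuous_min _ _ (fun=> 1) id) => //; exact: cst_continuous.
Qed.

Lemma hopfc_continuous : continuous hopfc.
Proof.
have c1 : continuous (fun p : T => Num.sqrt (clamp p.1.1)).
  move=> p; apply: (@continuous_comp _ _ _ (fun p : T => clamp p.1.1) Num.sqrt); last exact: sqrt_continuous.
  apply: (@continuous_comp _ _ _ (fun p : T => p.1.1) clamp); last exact: clamp_continuous.
  by apply: (@continuous_comp _ _ _ fst fst); exact: cvg_fst.
have c1' : continuous (fun p : T => Num.sqrt (1 - clamp p.1.1)).
  move=> p; apply: (@continuous_comp _ _ _ (fun p : T => 1 - clamp p.1.1) Num.sqrt); last exact: sqrt_continuous.
  apply: cvgB; first exact: cvg_cst.
  apply: (@continuous_comp _ _ _ (fun p : T => p.1.1) clamp); last exact: clamp_continuous.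
  by apply: (@continuous_comp _ _ _ fst fst); exact: cvg_fst.
have c2 : continuous (fun p : T => 2%:R * pi * p.1.2).
  move=> p; apply: cvgM; first exact: cvg_cst.
  by apply: (@continuous_comp _ _ _ fst snd); [exact: cvg_fst|exact: cvg_snd].
have c3 : continuous (fun p : T => 2%:R * pi * p.2).
  by move=> p; apply: cvgM; [exact: cvg_cst|exact: cvg_snd].
have cc2 : continuous (fun p : T => cos (2%:R * pi * p.1.2)).
  by move=> p; apply: continuous_comp; [exact: c2|exact: continuous_cos].
have cs2 : continuous (fun p : T => sin (2%:R * pi * p.1.2)).
  by move=> p; apply: continuous_comp; [exact: c2|exact: continuous_sin].
have cc3 : continuous (fun p : T => cos (2%:R * pi * p.2)).
  by move=> p; apply: continuous_comp; [exact: c3|exact: continuous_cos].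
have cs3 : continuous (fun p : T => sin (2%:R * pi * p.2)).
  by move=> p; apply: continuous_comp; [exact: c3|exact: continuous_sin].
have cM (f g : T -> R) : continuous f -> continuous g -> continuous (fun p => f p * g p).
  by move=> cf cg p; apply: cvgM; [exact: cf|exact: cg].
have cN (f : T -> R) : continuous f -> continuous (fun p => - f p).
  by move=> cf p; apply: cvgN; exact: cf.
have e1 : (fun p : T => Re ((Num.sqrt (clamp p.1.1))%:C * expi (2%:R * pi * p.1.2))) =
    (fun p => Num.sqrt (clamp p.1.1) * cos (2%:R * pi * p.1.2)).
  by apply/funext => p; rewrite Re_mul /= mul0r subr0.
have e2 : (fun p : T => Im ((Num.sqrt (clamp p.1.1))%:C * expi (2%:R * pi * p.1.2))) =
    (fun p => Num.sqrt (clamp p.1.1) * sin (2%:R * pi * p.1.2)).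
  by apply/funext => p; rewrite Im_mul /= mul0r addr0.
have e3 : (fun p : T => Re ((Num.sqrt (1 - clamp p.1.1))%:C * expi (2%:R * pi * p.2))) =
    (fun p => Num.sqrt (1 - clamp p.1.1) * cos (2%:R * pi * p.2)).
  by apply/funext => p; rewrite Re_mul /= mul0r subr0.
have e4 : (fun p : T => Im ((Num.sqrt (1 - clamp p.1.1))%:C * expi (2%:R * pi * p.2))) =
    (fun p => Num.sqrt (1 - clamp p.1.1) * sin (2%:R * pi * p.2)).
  by apply/funext => p; rewrite Im_mul /= mul0r addr0.
have Re_conj (z : C) : Re (conjc z) = Re z by case: z.
have Im_conj (z : C) : Im (conjc z) = - Im z by case: z.
pose Z (p : T) := (Num.sqrt (clamp p.1.1))%:C * expi (2%:R * pi * p.1.2).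
pose W (p : T) := (Num.sqrt (1 - clamp p.1.1))%:C * expi (2%:R * pi * p.2).
have hE p : hopfc p = mx2 (Z p) (W p) (- conjc (W p)) (conjc (Z p)) by [].
have hRZ : continuous (fun p => Re (Z p)) by rewrite e1; exact: cM.
have hIZ : continuous (fun p => Im (Z p)) by rewrite e2; exact: cM.
have hRW : continuous (fun p => Re (W p)) by rewrite e3; exact: cM.
have hIW : continuous (fun p => Im (W p)) by rewrite e4; exact: cM.
have cr i j : continuous (fun p => Re (hopfc p i j)).
  move: i j; do 2![apply: forall_I2].
  - by under eq_fun do rewrite hE mx2E; exact: hRZ.
  - by under eq_fun do rewrite hE mx2E; exact: hRW.
  - by under eq_fun do rewrite hE mx2E Re_opp Re_conj; apply: cN.
  - by under eq_fun do rewrite hE mx2E Re_conj; exact: hRZ.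
have ci i j : continuous (fun p => Im (hopfc p i j)).
  move: i j; do 2![apply: forall_I2].
  - by under eq_fun do rewrite hE mx2E; exact: hIZ.
  - by under eq_fun do rewrite hE mx2E; exact: hIW.
  - by under eq_fun do rewrite hE mx2E Im_opp Im_conj opprK; exact: hIW.
  - by under eq_fun do rewrite hE mx2E Im_conj; apply: cN.
move=> p; apply: (@cvg_mxc _ _ _ (nbhs_filter p)) => i j; [exact: cr|exact: ci].
Qed.

Lemma cube_compact : compact cube.
Proof. by do 2?apply: compact_setX; exact: segment_compact. Qed.

Lemma SU2_compact : compact (@SU2 R).
Proof.
have -> : @SU2 R = hopfc @` cube.
  apply/seteqP; split=> [g /hopf_surj[p hp <-]|_ [p hp <-]]; last exact: hopfc_SU2.
  by exists p => //; rewrite hopfcE.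
by apply: continuous_compact cube_compact; apply: continuous_subspaceT; exact: hopfc_continuous.
Qed.

End HopfCoordinates.

Section prod_sigma_finite.
Context d1 d2 (T1 : measurableType d1) (T2 : measurableType d2) (R : realType).
Variables (m1 : {sigma_finite_measure set T1 -> \bar R})
          (m2 : {sigma_finite_measure set T2 -> \bar R}).
(* The product measure packaged as a sigma-finite one, so that it can be a
   factor of a further product. *)
Definition prodm : set (T1 * T2) -> \bar R := (m1 \x m2)%E.
HB.instance Definition _ := Measure.on prodm.
Let prodm_sigma_finite : sigma_finite setT prodm.
Proof.
have /sigma_finiteP[F [TF ndF Foo]] := sigma_finiteT m1.
have /sigma_finiteP[G [TG ndG Goo]] := sigma_finiteT m2.
exists (fun n => F n `*` G n).
  rewrite -setXTT TF TG predeqE => -[x y]; split.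
    move=> [/= [n _ Fnx] [k _ Gky]]; exists (maxn n k) => //; split.
    - by move: x Fnx; exact/subsetPset/ndF/leq_maxl.
    - by move: y Gky; exact/subsetPset/ndG/leq_maxr.
  by move=> [n _ []/= ? ?]; split; exists n.
move=> k; have [? ?] := Foo k; have [? ?] := Goo k.
split; first exact: measurableX.
by rewrite /prodm product_measure1E// lte_mul_pinfty// ge0_fin_numE.
Qed.
HB.instance Definition _ := Measure_isSigmaFinite.Build _ _ _ prodm prodm_sigma_finite.
Lemma prodmE A B : measurable A -> measurable B -> prodm (A `*` B) = (m1 A * m2 B)%E.
Proof. exact: product_measure1E. Qed.
End prod_sigma_finite.

(** * The normalised integral on SU(2) *)

Section Haar.
Variable R : realType.
Local Notation C := R[i].
Local Notation M2 := 'M[C]_2.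
Local Notation T := (measurableTypeR R * measurableTypeR R * measurableTypeR R)%type.
Local Notation leb := (@lebesgue_measure R).
Local Notation mu := (prodm (prodm leb leb) leb).
Local Notation cube := (@unit_cube R : set T).
Local Notation Re := (@complex.Re R).
Local Notation Im := (@complex.Im R).

Lemma measurable_cube : measurable cube.
Proof. by apply: measurableX; [apply: measurableX|]; exact: measurable_itv. Qed.
Local Hint Resolve measurable_cube : core.

Lemma lebesgue_measure01 : leb [set` `[(0 : R), 1]] = 1%E.
Proof. by rewrite lebesgue_measure_itv /= lte_fin ltr01 sube0. Qed.

Lemma mu_cube : mu cube = 1%E.
Proof.
have E := lebesgue_measure01.
have m1 : measurable ([set` `[(0 : R), 1]] : set (measurableTypeR R)) by exact: measurable_itv.
apply: etrans (prodmE _ _ (measurableX m1 m1) m1) _.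
have P := etrans (prodmE leb leb m1 m1) (f_equal2 *%E E E).
by apply: etrans (f_equal2 *%E P E) _; rewrite !mul1e.
Qed.

Definition hint (u : M2 -> R) := mu.-integrable cube (fun p => (u (hopf p))%:E).
(** The name anticipates [haar_mulr]: so far this is an integral in coordinates, with no invariance
    known. *)
Definition haar (u : M2 -> R) : R := (\int[mu]_(p in cube) u (hopf p))%R.
Definition contS (u : M2 -> R) := {within @SU2 R, continuous u}.

Lemma contS_comp u : contS u -> continuous (u \o @hopfc R).
Proof.
move=> /subspace_continuousP cu p; have /= h := cu (hopfc p) (hopfc_SU2 p).
move=> A /h hA; have /= := @hopfc_continuous R p _ hA.
by apply: (@filterS _ _ (nbhs_filter p)) => x /=; apply; exact: hopfc_SU2.
Qed.

Lemma contS_measurable u : contS u -> measurable_fun cube (fun p => u (hopf p) : R).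
Proof.
move=> cu; apply: (@eq_measurable_fun _ _ _ _ _ (u \o @hopfc R)).
  by move=> p; rewrite inE => hp /=; rewrite hopfcE.
have := continuous_measurable3 (contS_comp cu); exact: measurable_funTS.
Qed.

Lemma contS_bounded u : contS u -> exists2 M, 0 <= M & forall g, SU2 g -> `|u g| <= M.
Proof.
move=> cu; have := compact_bounded (continuous_compact cu (@SU2_compact R)).
move=> [M [Mr hM]]; exists (Num.max 0 M + 1).
  by rewrite addr_ge0// le_max lexx.
move=> g sg; apply: (hM (Num.max 0 M + 1)); last by exists g.
by rewrite (@le_lt_trans _ _ (Num.max 0 M)) ?ltrDl// le_max lexx orbT.
Qed.

Lemma bounded_hint (u : M2 -> R) (M : R) : measurable_fun cube (fun p => u (hopf p) : R) ->
  (forall g, SU2 g -> `|u g| <= M) -> hint u.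
Proof.
move=> mu' hM; apply: (@le_integrable _ _ R mu cube measurable_cube _ (fun=> M%:E)).
- exact/measurable_EFinP.
- move=> p hp /=; rewrite lee_fin (le_trans (hM _ (hopf_SU2 hp)))// ler_norm//.
- apply/integrableP; split; first exact: measurable_cst.
  by rewrite integral_cst//= mu_cube mule1 ltry.
Qed.

Lemma contS_hint u : contS u -> hint u.
Proof. by move=> cu; have [M _ hM] := contS_bounded cu; exact: bounded_hint (contS_measurable cu) hM. Qed.

Lemma hintD u v : hint u -> hint v -> hint (fun g => u g + v g).
Proof. by move=> hu hv; have := integrableD measurable_cube hu hv. Qed.

Lemma hintZ k u : hint u -> hint (fun g => k * u g).
Proof. by move=> hu; have := integrableZl measurable_cube k hu. Qed.

Lemma haarD u v : hint u -> hint v -> haar (fun g => u g + v g) = haar u + haar v.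
Proof. by move=> hu hv; exact: RintegralD. Qed.

Lemma haarZ k u : hint u -> haar (fun g => k * u g) = k * haar u.
Proof. by move=> hu; exact: RintegralZl. Qed.

Lemma haarN u : hint u -> haar (fun g => - u g) = - haar u.
Proof.
move=> hu; rewrite -mulN1r -haarZ//; congr haar; apply/funext => g.
by rewrite mulN1r.
Qed.

Lemma haarB u v : hint u -> hint v -> haar (fun g => u g - v g) = haar u - haar v.
Proof.
move=> hu hv; rewrite haarD// ?haarN//.
by have := hintZ (-1) hv; under eq_fun do rewrite mulN1r.
Qed.

Lemma haar_cst k : haar (fun=> k) = k.
Proof. by rewrite /haar (Rintegral_cst _ measurable_cube) /= (_ : fine _ = 1) ?mulr1//; rewrite -[1]/(fine 1%E) -mu_cube. Qed.

Lemma haar_le u v : hint u -> hint v -> (forall g, SU2 g -> u g <= v g) -> haar u <= haar v.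
Proof.
by move=> hu hv uv; apply: le_Rintegral => // p hp; exact/uv/hopf_SU2.
Qed.

Lemma haar_ge0 u : (forall g, SU2 g -> 0 <= u g) -> 0 <= haar u.
Proof. by move=> h; apply: Rintegral_ge0 => p hp; exact/h/hopf_SU2. Qed.

Lemma eq_haar u v : (forall g, SU2 g -> u g = v g) -> haar u = haar v.
Proof. by move=> uv; apply: eq_Rintegral => p; rewrite inE => hp; exact/uv/hopf_SU2. Qed.

Lemma eq_hint u v : (forall g, SU2 g -> u g = v g) -> hint u -> hint v.
Proof.
move=> uv; apply: eq_integrable => // p; rewrite inE => hp /=.
by rewrite uv//; exact: hopf_SU2.
Qed.

Lemma haar_norm u : hint u -> `|haar u| <= haar (fun g => `|u g|).
Proof. by move=> hu; apply: le_normr_Rintegral. Qed.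

Lemma hint_norm u : hint u -> hint (fun g => `|u g|).
Proof. by move=> hu; have := integrable_abse hu. Qed.

Lemma haar_sum n (u : 'I_n -> M2 -> R) : (forall i, hint (u i)) ->
  hint (fun g => \sum_i u i g) /\ haar (fun g => \sum_i u i g) = \sum_i haar (u i).
Proof.
elim: n u => [|n IH] u hu.
  split; last by rewrite big_ord0 -[RHS](haar_cst 0); apply: eq_haar => g _; rewrite big_ord0.
  apply: (@bounded_hint _ 0); last by move=> g _; rewrite big_ord0 normr0.
  by under eq_fun do rewrite big_ord0; exact: measurable_cst.
have [h1 h2] := IH (fun i => u (lift ord0 i)) (fun i => hu _).
have E : (fun g => \sum_i u i g) = (fun g => u ord0 g + \sum_i u (lift ord0 i) g).
  by apply/funext => g; rewrite big_ord_recl.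
by rewrite E; split; [exact: hintD|rewrite haarD// h2 big_ord_recl].
Qed.

Lemma Rintegral_prod d1 d2 (T1 : measurableType d1) (T2 : measurableType d2)
    (m1 : {sigma_finite_measure set T1 -> \bar R}) (m2 : {sigma_finite_measure set T2 -> \bar R})
    (f : T1 -> R) (h : T2 -> R) :
  m1.-integrable setT (EFin \o f) -> m2.-integrable setT (EFin \o h) ->
  (prodm m1 m2).-integrable setT (EFin \o (fun z : T1 * T2 => f z.1 * h z.2)) /\
  (\int[prodm m1 m2]_z (f z.1 * h z.2) = (\int[m1]_x f x) * (\int[m2]_y h y))%R.
Proof.
move=> if_ ih.
have mf : measurable_fun setT f by apply/measurable_EFinP; case/integrableP: if_.
have mh : measurable_fun setT h by apply/measurable_EFinP; case/integrableP: ih.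
have mfh : measurable_fun setT (EFin \o (fun z : T1 * T2 => f z.1 * h z.2)).
  apply/measurable_EFinP; apply: measurable_funM.
    by apply: measurableT_comp => //; exact: measurable_fst.
  by apply: measurableT_comp => //; exact: measurable_snd.
have iy x : (\int[m2]_y (f x * h y)%:E = (f x * (\int[m2]_y h y)%R)%:E)%E.
  under eq_integral do rewrite EFinM.
  rewrite integralZl// EFinM; congr (_ * _)%E.
  by rewrite /Rintegral fineK//; exact: integrable_fin_num.
have iyn x : (\int[m2]_y `|(f x * h y)%:E| = (`|f x| * (\int[m2]_y `|h y|)%R)%:E)%E.
  under eq_integral do rewrite abse_EFin normrM EFinM.
  rewrite integralZl//; last by have := integrable_abse ih.
  rewrite EFinM; congr (_ * _)%E.
  rewrite /Rintegral fineK//; apply: integrable_fin_num => //.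
  by have := integrable_abse ih.
have ifh : (prodm m1 m2).-integrable setT (EFin \o (fun z : T1 * T2 => f z.1 * h z.2)).
  apply/integrable12ltyP => //=; under eq_integral do rewrite iyn EFinM.
  rewrite integralZr//; last by have := integrable_abse if_.
  have := integrable_abse if_ => /(integrable_fin_num measurableT).
  by case: (\int[m1]_x _)%E => //= r _; rewrite -EFinM ltry.
split => //; rewrite /Rintegral -integral12_prod_meas1//= /fubini_F.
under eq_integral do rewrite iy EFinM.
rewrite integralZr// fineM//; exact: integrable_fin_num.
Qed.

Lemma Rintegral_setX d1 d2 (T1 : measurableType d1) (T2 : measurableType d2)
    (m1 : {sigma_finite_measure set T1 -> \bar R}) (m2 : {sigma_finite_measure set T2 -> \bar R})
    (D1 : set T1) (D2 : set T2) (f : T1 -> R) (h : T2 -> R) :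
  measurable D1 -> measurable D2 ->
  m1.-integrable D1 (EFin \o f) -> m2.-integrable D2 (EFin \o h) ->
  (prodm m1 m2).-integrable (D1 `*` D2) (EFin \o (fun z : T1 * T2 => f z.1 * h z.2)) /\
  (\int[prodm m1 m2]_(z in D1 `*` D2) (f z.1 * h z.2) =
   (\int[m1]_(x in D1) f x) * (\int[m2]_(y in D2) h y))%R.
Proof.
move=> mD1 mD2 if_ ih.
have E : (fun z : T1 * T2 => (f \_ D1) z.1 * (h \_ D2) z.2) =
         (fun z : T1 * T2 => f z.1 * h z.2) \_ (D1 `*` D2).
  apply/funext => -[x y]; rewrite !patchE /= in_setX.
  by case: (x \in D1); case: (y \in D2); rewrite ?mulr0 ?mul0r.
have i1 : m1.-integrable setT (EFin \o (f \_ D1)).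
  by rewrite -restrict_EFin; apply/(integrable_restrict _ mD1 measurableT); rewrite setTI.
have i2 : m2.-integrable setT (EFin \o (h \_ D2)).
  by rewrite -restrict_EFin; apply/(integrable_restrict _ mD2 measurableT); rewrite setTI.
have [] := Rintegral_prod i1 i2; rewrite E -restrict_EFin.
move=> /(integrable_restrict _ (measurableX mD1 mD2) measurableT); rewrite setTI => i3 e3.
by split => //; rewrite [LHS]Rintegral_mkcond e3 -!Rintegral_mkcond.
Qed.

Definition int01 (f : R -> R) : R := (\int[leb]_(x in [set` `[(0 : R), 1]]) f x)%R.

Lemma continuous_integrable01 f : continuous f -> leb.-integrable [set` `[(0 : R), 1]] (EFin \o f).
Proof.
move=> cf; apply: continuous_compact_integrable; first exact: segment_compact.
exact: continuous_subspaceT.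
Qed.

Lemma Rintegral_cube (f h k : R -> R) : continuous f -> continuous h -> continuous k ->
  mu.-integrable cube (EFin \o (fun p => f p.1.1 * h p.1.2 * k p.2)) /\
  (\int[mu]_(p in cube) (f p.1.1 * h p.1.2 * k p.2))%R = int01 f * int01 h * int01 k.
Proof.
move=> /continuous_integrable01 cf /continuous_integrable01 ch /continuous_integrable01 ck.
have m1 : measurable ([set` `[(0 : R), 1]] : set (measurableTypeR R)) by exact: measurable_itv.
have [i1 e1] := Rintegral_setX m1 m1 cf ch.
have [i2 e2] := Rintegral_setX (measurableX m1 m1) m1 i1 ck.
by rewrite /int01 -e1 -e2.
Qed.

End Haar.

(** * Moments of the inner product with a fixed point *)

Section Moments.
Variable R : realType.
Local Notation C := R[i].
Local Notation M2 := 'M[C]_2.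
Local Notation T := (measurableTypeR R * measurableTypeR R * measurableTypeR R)%type.
Local Notation leb := (@lebesgue_measure R).
Local Notation mu := (prodm (prodm leb leb) leb).
Local Notation cube := (@unit_cube R : set T).
Local Notation Re := (@complex.Re R).
Local Notation Im := (@complex.Im R).

Lemma int01_derive F f : (forall x : R, is_derive x 1 F (f x)) -> continuous f ->
  int01 f = F 1 - F 0.
Proof.
move=> dF cf; rewrite /int01 /Rintegral (@continuous_FTC2 R f F 0 1 ltr01)//.
- exact: continuous_subspaceT.
- have cF : continuous F by apply: derivable_cont => x; exact: ex_derive.
  split => [x _|//|//]; first exact: ex_derive.
  + exact/cvg_at_right_filter/cF.
  + exact/cvg_at_left_filter/cF.
- by move=> x _; exact: is_derive1_val.
Qed.

Lemma int01Z (k : R) (f : R -> R) : continuous f -> int01 (fun x => k * f x) = k * int01 f.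
Proof. by move=> cf; apply: RintegralZl; [exact: measurable_itv|exact: continuous_integrable01]. Qed.

Lemma int01B (f h : R -> R) : continuous f -> continuous h ->
  int01 (fun x => f x - h x) = int01 f - int01 h.
Proof.
have mI : measurable ([set` `[(0 : R), 1]] : set (measurableTypeR R)) by exact: measurable_itv.
by move=> cf ch; exact: (RintegralB mI (continuous_integrable01 cf) (continuous_integrable01 ch)).
Qed.

Definition trigpoly (x y a : R) : R := x * cos (2%:R * pi * a) + y * sin (2%:R * pi * a).
Definition trigmom n x y : R := int01 (fun a => trigpoly x y a ^+ n).

Lemma is_derive_trigpoly x y (a : R) : is_derive a 1 (trigpoly x y) (2%:R * pi * trigpoly y (- x) a).
Proof.
have dl : is_derive a 1 (fun a => 2%:R * pi * a : R) (2%:R * pi).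
  by rewrite -[X in is_derive _ _ _ X]mulr1; apply: is_derive1Z; exact: is_derive_id.
have dc := is_derive1_comp (is_derive_cos (2%:R * pi * a)) dl.
have ds := is_derive1_comp (is_derive_sin (2%:R * pi * a)) dl.
have := is_derive1D (is_derive1Z x dc) (is_derive1Z y ds).
by congr is_derive; rewrite /trigpoly; ring.
Qed.

Lemma trigpoly_continuous x y : continuous (trigpoly x y).
Proof. by apply: derivable_cont => a; apply: ex_derive; exact: is_derive_trigpoly. Qed.

Lemma trigpoly_period x y : trigpoly x y 1 = trigpoly x y 0.
Proof. by rewrite /trigpoly !mulr1 !mulr0 cos0 sin0 mulr_natl cos2pi sin2pi. Qed.

Lemma continuousX (f : R -> R) n : continuous f -> continuous (fun x => f x ^+ n).
Proof. by move=> cf x; have := @exprn_continuous R n (f x); apply: continuous_comp; exact: cf. Qed.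

Lemma trigmom0 x y : trigmom 0 x y = 1.
Proof.
rewrite /trigmom (_ : (fun a => _) = fun=> 1); last by apply/funext => a; rewrite expr0.
rewrite (@int01_derive (fun x => x) (fun=> 1)) ?subr0//; last by move=> ?; exact: cvg_cst.
Qed.

Lemma trigmom1 x y : trigmom 1 x y = 0.
Proof.
have p0 : (2%:R * pi : R) != 0 by rewrite mulf_neq0 ?pnatr_eq0// gt_eqF// pi_gt0.
apply: etrans (@int01_derive (fun a => (2%:R * pi)^-1 * trigpoly (- y) x a) _ _ _) _; last first.
- by rewrite trigpoly_period subrr.
- exact/continuousX/trigpoly_continuous.
- move=> a; have := is_derive1Z (2%:R * pi)^-1 (is_derive_trigpoly (- y) x a).
  by rewrite mulKf// opprK expr1.
Qed.

(** With p = [trigpoly x y] and q = [trigpoly y (- x)] one has p' = 2 pi q, q' = - 2 pi p and p^2 +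
    q^2 = x^2 + y^2; the derivative of p^(n+1) q integrates to 0 over a period. *)
Lemma trigmomSS n x y : n.+2%:R * trigmom n.+2 x y = n.+1%:R * (x ^+ 2 + y ^+ 2) * trigmom n x y.
Proof.
have p0 : (2%:R * pi : R) != 0 by rewrite mulf_neq0 ?pnatr_eq0// gt_eqF// pi_gt0.
have cX k : continuous (fun a => trigpoly x y a ^+ k) by exact/continuousX/trigpoly_continuous.
have cZ k (c : R) : continuous (fun a => c * trigpoly x y a ^+ k).
  by move=> a; apply: (@continuousM R R (cst c) (fun a => trigpoly x y a ^+ k)); [exact: cst_continuous|exact: cX].
apply/eqP; rewrite -subr_eq0 /trigmom -!int01Z// -int01B//; apply/eqP.
pose F a := (- (2%:R * pi)^-1) * (trigpoly x y a ^+ n.+1 * trigpoly y (- x) a).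
transitivity (F 1 - F 0); last by rewrite /F !trigpoly_period subrr.
apply: int01_derive.
2: by move=> a; apply: (@continuousB _ _ R (fun a => n.+2%:R * trigpoly x y a ^+ n.+2) (fun a => n.+1%:R * (x ^+ 2 + y ^+ 2) * trigpoly x y a ^+ n)); exact: cZ.
move=> a; have dX := is_derive1_comp (is_derive1X n.+1 (trigpoly x y a)) (is_derive_trigpoly x y a).
have := is_derive1Z (- (2%:R * pi)^-1) (is_derive1M dX (is_derive_trigpoly y (- x) a)).
congr is_derive => /=; rewrite /= -mulrA.
have E : trigpoly y (- x) a ^+ 2 = x ^+ 2 + y ^+ 2 - trigpoly x y a ^+ 2.
  rewrite /trigpoly; have := cos2Dsin2 (2%:R * pi * a : R).
  set c := cos _; set s := sin _ => cs.
  transitivity ((x ^+ 2 + y ^+ 2) * (c ^+ 2 + s ^+ 2) - (x * c + y * s) ^+ 2); last by rewrite cs mulr1.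
  by ring.
have E2 : trigpoly (- x) (- y) a = - trigpoly x y a by rewrite /trigpoly; ring.
rewrite E2; apply: (mulfI p0); rewrite [LHS]mulrA [X in X * _]mulrN divff// mulN1r.
transitivity (- (2%:R * pi) * (n.+1%:R * trigpoly x y a ^+ n * (trigpoly y (- x) a ^+ 2) - trigpoly x y a ^+ n.+2)).
  by rewrite !exprS expr0; ring.
by rewrite E !exprS expr0 -[n.+2%:R]natr1; ring.
Qed.

Lemma trigmom_odd m x y : trigmom m.*2.+1 x y = 0.
Proof.
elim: m => [|m IH]; first exact: trigmom1.
have := trigmomSS m.*2.+1 x y; rewrite IH mulr0 => /eqP.
by rewrite mulf_eq0 pnatr_eq0 /= => /eqP.
Qed.

Lemma trigmom_even m x y :
  trigmom m.*2 x y = (m.*2)`!%:R / (4%:R ^+ m * m`!%:R ^+ 2) * (x ^+ 2 + y ^+ 2) ^+ m.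
Proof.
elim: m => [|m IH]; first by rewrite trigmom0 !fact0 !expr0 expr1n mulr1 divr1 mulr1.
have := trigmomSS m.*2 x y; rewrite IH => E.
have h : m.*2.+2%:R != 0 :> R by rewrite pnatr_eq0.
apply: (mulfI h); rewrite doubleS E !factS !exprS !natrM.
have e2 : m.*2.+2%:R = 2%:R * m.+1%:R :> R by rewrite -natrM mul2n doubleS.
rewrite e2; field.
by rewrite expf_neq0 ?pnatr_eq0// -lt0n fact_gt0 addrC natr1 pnatr_eq0.
Qed.

Lemma Rintegral_sum d (T' : measurableType d) (m : {measure set T' -> \bar R}) (D : set T') n
    (u : 'I_n -> T' -> R) : measurable D -> (forall i, m.-integrable D (EFin \o u i)) ->
  (\int[m]_(x in D) (\sum_i u i x) = \sum_i \int[m]_(x in D) u i x)%R.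
Proof.
move=> mD hu; rewrite /Rintegral; under eq_integral do rewrite -sumEFin.
rewrite integral_sum// sum_fine// => i _; apply: integrable_fin_num => //; exact: hu.
Qed.

Lemma sum_even_index (V : nmodType) (F : nat -> V) m : (forall i, F i.*2.+1 = 0) ->
  \sum_(i < m.*2.+1) F i = \sum_(i < m.+1) F i.*2.
Proof.
move=> F0; elim: m => [|m IH]; first by rewrite !big_ord_recl !big_ord0.
by rewrite doubleS big_ord_recr big_ord_recr [RHS]big_ord_recr /= F0 addr0 IH.
Qed.

(** For n = 2 m this is the Catalan number C_m divided by 4^m: the moments of the semicircle law (2
    / pi) sqrt (1 - t^2) dt, the distribution of a coordinate on the unit 3-sphere. *)
Definition sdot_moment n : R :=
  if odd n then 0 else n`!%:R / (4%:R ^+ n./2 * n./2`!%:R * n./2.+1`!%:R).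

Lemma sdot_hopf (g : M2) (p : T) : SU2 g -> cube p ->
  sdot g (hopf p) = Num.sqrt p.1.1 * trigpoly (Re (g 0 0)) (Im (g 0 0)) p.1.2 +
    Num.sqrt (1 - p.1.1) * trigpoly (Re (g 0 1)) (Im (g 0 1)) p.2.
Proof.
move=> sg hp; rewrite /sdot (SU2_trace (SU2_mul (SU2_adj sg) (hopf_SU2 hp))).1 /=.
have [z [w [-> _]]] := (SU2_mx2 g).1 sg.
rewrite adj_mx2 mx2_mul !mx2E /hopf /trigpoly /expi; case: z => a b; case: w => c d /=.
by rewrite ?(mulr0,mul0r,addr0,add0r,subr0,oppr0); ring.
Qed.

Lemma sqrt_beta i j : int01 (fun s : R => Num.sqrt s ^+ i.*2 * Num.sqrt (1 - s) ^+ j.*2) =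
  (i`! * j`!)%:R / (i + j).+1`!%:R.
Proof.
rewrite -beta_fun_fact /int01 /beta_fun Rintegral_mkcond; apply: eq_Rintegral => s _.
rewrite !patchE; case: ifPn => //; rewrite inE/= in_itv/= => /andP[s0 s1].
by rewrite /XMonemX/= -!muln2 ![(_ * 2)%N]mulnC !exprM !sqr_sqrtr// subr_ge0.
Qed.

Lemma sdot_continuous (g : M2) : continuous (sdot g).
Proof.
move=> y; apply: (@continuous_comp _ _ _ (fun y : M2 => 2%:R^-1 * \tr (adj g *m y)) Re).
  exact/polyfun_continuous/polyfun_tr.
exact: Re_continuous.
Qed.

Lemma contS_sdot (g : M2) : contS (sdot g).
Proof. exact/continuous_subspaceT/sdot_continuous. Qed.

(** In Hopf coordinates each term of the binomial expansion separates into a Beta integral and two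
    trigonometric moments. The terms recombine into a power of |z|^2 + |w|^2 = 1, where (z, w) is
    the first row of g: here the dependence on g disappears. *)
Lemma haar_sdotX (g : M2) n : SU2 g -> haar (fun y => sdot g y ^+ n) = sdot_moment n.
Proof.
move=> sg; rewrite /haar.
set x := Re (g 0 0); set y := Im (g 0 0); set x' := Re (g 0 1); set y' := Im (g 0 1).
pose F i (p : T) := ('C(n, i)%:R * (Num.sqrt p.1.1 ^+ (n - i) * Num.sqrt (1 - p.1.1) ^+ i)) *
   (trigpoly x y p.1.2 ^+ (n - i)) * (trigpoly x' y' p.2 ^+ i).
have cs i j : continuous (fun s : R => Num.sqrt s ^+ i * Num.sqrt (1 - s) ^+ j).
  have c1 : continuous (fun s : R => Num.sqrt s ^+ i) by apply/continuousX/sqrt_continuous.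
  have c2 : continuous (fun s : R => Num.sqrt (1 - s) ^+ j).
    apply/continuousX => s; apply: (@continuous_comp _ _ _ (fun s : R => 1 - s) Num.sqrt).
      by apply: cvgB; [exact: cvg_cst|exact: cvg_id].
    exact: sqrt_continuous.
  by move=> s; apply: (@continuousM R R (fun s => Num.sqrt s ^+ i) (fun s => Num.sqrt (1 - s) ^+ j)); [exact: c1|exact: c2].
have ccs (c : R) i j : continuous (fun s : R => c * (Num.sqrt s ^+ i * Num.sqrt (1 - s) ^+ j)).
  by move=> s; apply: (@continuousM R R (cst c) _ s); [exact: cst_continuous|exact: cs].
have ct a b i : continuous (fun s => trigpoly a b s ^+ i) by exact/continuousX/trigpoly_continuous.
have iF i := Rintegral_cube (ccs 'C(n, i)%:R (n - i)%N i) (ct x y (n - i)%N) (ct x' y' i).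
transitivity (\int[mu]_(p in cube) (\sum_(i < n.+1) F i p))%R.
  apply: eq_Rintegral => p; rewrite inE => hp; rewrite sdot_hopf// exprDn.
  by apply: eq_bigr => i _; rewrite !exprMn -mulr_natl /F; ring.
rewrite Rintegral_sum; [|exact: measurable_cube|by move=> i; exact: (iF i).1].
under eq_bigr => i _ do rewrite (iF i).2 int01Z -/(trigmom _ _ _) -/(trigmom _ _ _)//.
rewrite /sdot_moment; case: ifPn => [on|en].
  rewrite big1// => i _; have [oi|ei] := boolP (odd i).
    by rewrite [trigmom i _ _](_ : _ = 0) ?mulr0// -(odd_double_half i) oi trigmom_odd.
  have o : odd (n - i) by rewrite oddB ?on ?(negbTE ei)// -ltnS.
  by rewrite [trigmom (n - i) _ _](_ : _ = 0) ?(mulr0,mul0r)// -(odd_double_half (n - i)%N) o trigmom_odd.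
have := odd_double_half n; rewrite (negbTE en) add0n; set m := n./2 => <- {iF F en}.
rewrite (@sum_even_index _ (fun i => 'C(m.*2, i)%:R * int01 (fun s => Num.sqrt s ^+ (m.*2 - i) * Num.sqrt (1 - s) ^+ i) *
  trigmom (m.*2 - i) x y * trigmom i x' y')); last by move=> i; rewrite trigmom_odd mulr0.
have rho : x ^+ 2 + y ^+ 2 + (x' ^+ 2 + y' ^+ 2) = 1.
  have [z [w [eg zw]]] := (SU2_mx2 g).1 sg; rewrite /x /y /x' /y' eg !mx2E.
  have := congr1 Re zw; case: (z) => a b; case: (w) => c d /= <-; ring.
transitivity ((m.*2)`!%:R / (4%:R ^+ m * m`!%:R * m.+1`!%:R) * (x ^+ 2 + y ^+ 2 + (x' ^+ 2 + y' ^+ 2)) ^+ m); last by rewrite rho expr1n mulr1.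
rewrite [X in _ * X]exprDn mulr_sumr; apply: eq_bigr => i _.
have im : (i <= m)%N by rewrite -ltnS.
rewrite -doubleB sqrt_beta subnK// !trigmom_even.
have e1 : 'C(m.*2, i.*2)%:R = (m.*2)`!%:R / ((i.*2)`!%:R * ((m - i).*2)`!%:R) :> R.
  by rewrite -natrM -(@bin_fact m.*2 i.*2) ?leq_double// -doubleB natrM mulfK// pnatr_eq0 -lt0n muln_gt0 !fact_gt0.
have e2 : 'C(m, i)%:R = m`!%:R / (i`!%:R * (m - i)`!%:R) :> R.
  by rewrite -natrM -(@bin_fact m i)// natrM mulfK// pnatr_eq0 -lt0n muln_gt0 !fact_gt0.
have e4 : 4%:R ^+ m = 4%:R ^+ (m - i) * 4%:R ^+ i :> R by rewrite -exprD subnK.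
rewrite -[X in _ = _ * X]mulr_natl e1 e2 e4 natrM; field.
by rewrite !expf_neq0 ?pnatr_eq0// -?lt0n ?fact_gt0.
Qed.
End Moments.

(** * Zonal functions and their integrals *)

Section Zonal.
Variable R : realType.
Local Notation C := R[i].
Local Notation M2 := 'M[C]_2.

Lemma contS_funcomp (f : R -> R) (u : M2 -> R) : continuous f -> contS u -> contS (fun g => f (u g)).
Proof.
move=> cf /subspace_continuousP cu; apply/subspace_continuousP => g sg; rewrite /from_subspace /=.
exact: (cvg_comp _ _ (cu g sg) (cf (u g))).
Qed.

Lemma contS_cst (k : R) : contS (fun _ : M2 => k).
Proof. by rewrite /contS; apply: continuous_subspaceT => g; exact: cst_continuous. Qed.

Lemma contSD (u v : M2 -> R) : contS u -> contS v -> contS (fun g => u g + v g).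
Proof.
move=> /subspace_continuousP cu /subspace_continuousP cv; apply/subspace_continuousP => g sg; rewrite /from_subspace /=.
by apply: (@cvgD _ _ _ _ (@within_filter _ _ _ (nbhs_filter g))); [exact: cu|exact: cv].
Qed.

Lemma contSM (u v : M2 -> R) : contS u -> contS v -> contS (fun g => u g * v g).
Proof.
move=> /subspace_continuousP cu /subspace_continuousP cv; apply/subspace_continuousP => g sg; rewrite /from_subspace /=.
by apply: (@cvgM _ _ _ (@within_filter _ _ _ (nbhs_filter g))); [exact: cu|exact: cv].
Qed.

Lemma contSZ k (u : M2 -> R) : contS u -> contS (fun g => k * u g).
Proof. by move=> cu; apply: contSM => //; exact: contS_cst. Qed.

Lemma contS_sum n (u : 'I_n -> M2 -> R) : (forall i, contS (u i)) -> contS (fun g => \sum_i u i g).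
Proof.
elim: n u => [|n IH] u cu.
  by under eq_fun do rewrite big_ord0; exact: contS_cst.
by under eq_fun do rewrite big_ord_recl; apply: contSD => //; exact: IH.
Qed.

Lemma poly_continuous (p : {poly R}) : continuous (horner p).
Proof. exact: continuous_horner. Qed.

Definition zonal (p : {poly R}) (g y : M2) : R := p.[sdot g y].

Lemma contS_zonal p g : contS (zonal p g).
Proof. by apply: contS_funcomp (@contS_sdot R g); exact: poly_continuous. Qed.

Lemma haar_zonalD p q g : haar (zonal (p + q) g) = haar (zonal p g) + haar (zonal q g).
Proof.
rewrite -haarD; [|exact/contS_hint/contS_zonal|exact/contS_hint/contS_zonal].
by congr haar; apply/funext => y; rewrite /zonal hornerD.
Qed.

Lemma haar_zonalZ k p g : haar (zonal (k *: p) g) = k * haar (zonal p g).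
Proof.
rewrite -haarZ; last exact/contS_hint/contS_zonal.
by congr haar; apply/funext => y; rewrite /zonal hornerZ.
Qed.

Lemma sdot_moment_rec n : n.+4%:R * sdot_moment R n.+2 = n.+1%:R * sdot_moment R n.
Proof.
rewrite /sdot_moment /= negbK; case: ifPn; rewrite ?mulr0// => en.
have e : n.+2%:R = 2%:R * n./2.+1%:R :> R.
  rewrite -natrM mul2n doubleS; congr (_.+2%:R).
  by rewrite -[in LHS](odd_double_half n) (negbTE en).
have e4 : n.+4%:R = 2%:R * n./2.+2%:R :> R by rewrite -[n.+4%:R]natr1 -natr1 e -[n./2.+2%:R]natr1; ring.
rewrite !factS !natrM e4 e exprS; field.
by rewrite expf_neq0 ?pnatr_eq0// -?lt0n ?fact_gt0 -[2]/(2%:R) -(natrD _ 1) -(natrD _ 2) !pnatr_eq0.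
Qed.

Lemma haar_zonalX g n : SU2 g -> haar (zonal 'X^n g) = sdot_moment R n.
Proof.
by move=> sg; rewrite -(haar_sdotX n sg); congr haar; apply/funext => y; rewrite /zonal hornerXn.
Qed.

(* The integrand is the Laplacian of a zonal function, written through its
   derivative p in the variable t = <g, y>. *)
Lemma haar_zonal_divergence (p : {poly R}) g : SU2 g ->
  haar (zonal ((1 - 'X^2) * p^`() - 3%:R *: ('X * p)) g) = 0.
Proof.
move=> sg; rewrite -[p]coefK poly_def; elim/big_ind: _ => [|q1 q2 h1 h2|i _].
- rewrite deriv0 !mulr0 scaler0 subr0 -(scale0r 0) haar_zonalZ mul0r//.
- rewrite -[RHS]addr0 -{1}h1 -h2 -haar_zonalD derivD; congr (haar (zonal _ g)).
  by rewrite !mulrDr scalerDr; ring.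
- rewrite derivZ derivXn (_ : _ - _ = p`_i *: ((1 - 'X^2 : {poly R}) * ('X^(i.-1) *+ i) - 3%:R *: ('X * 'X^i))); last first.
    by rewrite -!scalerAr scalerBr !scalerA [p`_i * _]mulrC.
  rewrite haar_zonalZ (_ : haar _ = 0) ?mulr0//.
  case: (nat_of_ord i) => [|n].
    rewrite mulr0n mulr0 sub0r expr0 mulr1 -scaleNr haar_zonalZ -['X]expr1.
    by rewrite haar_zonalX// /sdot_moment mulr0.
  rewrite (_ : _ - _ = n.+1%:R *: 'X^n + (- n.+4%:R) *: 'X^(n.+2)); last first.
    rewrite /= scaleNr !scaler_nat -exprS mulrnAr mulrBl mul1r -exprD mulrnBl -addrA -opprD -mulrnDr addn3.
    by [].
  by rewrite haar_zonalD !haar_zonalZ !haar_zonalX// mulNr sdot_moment_rec subrr.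
Qed.

(** By [chebU_ode], (1 - n^2) U_n with n = k + 2 is a Laplacian and integrates to 0; for n >= 2 the
    factor is nonzero. *)
Lemma haar_chebU g k : SU2 g -> haar (zonal (chebU R k.+2) g) = 0.
Proof.
move=> sg; have := haar_zonal_divergence (chebU R k.+2)^`() sg.
have -> : (1 - 'X^2) * (chebU R k.+2)^`()^`() - 3%:R *: ('X * (chebU R k.+2)^`()) =
    (1 - k.+2%:R ^+ 2) *: chebU R k.+2.
  by rewrite chebU_ode scaler_nat -mulr_natl -mul_polyC rmorphB rmorphXn /= rmorph_nat rmorph1; ring.
rewrite haar_zonalZ => /eqP; rewrite mulf_eq0 => /orP[|/eqP//].
by rewrite subr_eq0 eq_sym -natrX -[1]/(1%:R) eqr_nat.
Qed.

Lemma haar_chebU1 g : haar (zonal (chebU R 1) g) = 1.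
Proof. by rewrite -(haar_cst 1); congr haar; apply/funext => y; rewrite /zonal chebU1 hornerC. Qed.

(* The partial sums of the Poisson kernel (1 - r^2) / (1 - 2 r t + r^2)^2. *)
Definition poisson_sum (r : R) N : {poly R} := \sum_(k < N.+1) (k%:R * r ^+ k.-1) *: chebU R k.

Lemma poisson_sumE r N (t : R) : let q := 1 - 2%:R * r * t + r ^+ 2 in
  q ^+ 2 * (poisson_sum r N).[t] = 1 - r ^+ 2 + r ^+ N *
  (q * (N.+1%:R * r * (chebU R N).[t] - N%:R * (chebU R N.+1).[t]) +
   (1 - r ^+ 2) * (r * (chebU R N).[t] - (chebU R N.+1).[t])).
Proof.
move=> q.
(* [G] is a partial sum of the generating function sum_k r^(k-1) U_k = 1 / q. The weight k makes k
   r^(k-1) the derivative of r^k, and d (r / q) / dr = (1 - r^2) / q^2. *)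
pose G n := \sum_(k < n.+1) r ^+ k.-1 * (chebU R k).[t].
have U2 n : (chebU R n.+2).[t] = 2%:R * t * (chebU R n.+1).[t] - (chebU R n).[t].
  by rewrite chebUSS !hornerE.
have U0 : (chebU R 0).[t] = 0 by rewrite chebU0 horner0.
have U1 : (chebU R 1).[t] = 1 by rewrite chebU1 hornerC.
have eG n : q * G n = 1 + r ^+ n * (r * (chebU R n).[t] - (chebU R n.+1).[t]).
  elim: n => [|n IH]; first by rewrite /G big_ord_recl big_ord0 U0 U1; ring.
  by rewrite /G big_ord_recr /= mulrDr -/(G n) IH U2 exprS /q; ring.
have GS n : G n.+1 = G n + r ^+ n * (chebU R n.+1).[t] by rewrite /G big_ord_recr.
have eS n : q * (poisson_sum r n).[t] = (1 - r ^+ 2) * G n +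
    r ^+ n * (n.+1%:R * r * (chebU R n).[t] - n%:R * (chebU R n.+1).[t]).
  elim: n => [|n IH].
    by rewrite /poisson_sum /G !big_ord_recl !big_ord0 U0 U1 chebU0 scaler0 addr0 horner0; ring.
  rewrite /poisson_sum big_ord_recr /= hornerD hornerZ mulrDr -/(poisson_sum r n) IH.
  by rewrite GS U2 [r ^+ n.+1]exprS -[n.+2%:R]natr1 -[n.+1%:R]natr1 /q; ring.
by rewrite expr2 -mulrA eS mulrDr mulrCA eG; ring.
Qed.
End Zonal.

(** * Uniform approximation by Poisson sums *)

Section Approximation.
Variable R : realType.
Local Notation C := R[i].
Local Notation M2 := 'M[C]_2.
Local Notation Re := (@complex.Re R).
Local Notation Im := (@complex.Im R).

Lemma sdot_coord (g y : M2) : SU2 g -> SU2 y -> sdot g y =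
  Re (g 0 0) * Re (y 0 0) + Im (g 0 0) * Im (y 0 0) + Re (g 0 1) * Re (y 0 1) + Im (g 0 1) * Im (y 0 1).
Proof.
move=> sg sy; rewrite /sdot (SU2_trace (SU2_mul (SU2_adj sg) sy)).1 /=.
have [z [w [-> _]]] := (SU2_mx2 g).1 sg; have [z' [w' [-> _]]] := (SU2_mx2 y).1 sy.
rewrite adj_mx2 mx2_mul !mx2E; case: z => a b; case: w => c d; case: z' => a' b'; case: w' => c' d' /=.
by rewrite ?(mulr0,mul0r,addr0,add0r,subr0,oppr0); ring.
Qed.

Lemma SU2_coord (g : M2) : SU2 g ->
  Re (g 0 0) ^+ 2 + Im (g 0 0) ^+ 2 + Re (g 0 1) ^+ 2 + Im (g 0 1) ^+ 2 = 1.
Proof. by move=> sg; rewrite -(sdot_self sg) sdot_coord// !expr2. Qed.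

Lemma SU2_row1 (g : M2) : SU2 g -> g 1 0 = - conjc (g 0 1) /\ g 1 1 = conjc (g 0 0).
Proof. by move=> /SU2_mx2[z [w [-> _]]]; rewrite !mx2E. Qed.

(** On the unit sphere of R^4, 1 - <a, c> is |a - c|^2 / 2, and |u + v|^2 <= 2 |u|^2 + 2 |v|^2. *)
Lemma sdot_triangle (a b c : M2) : SU2 a -> SU2 b -> SU2 c ->
  1 - sdot a c <= 2%:R * (1 - sdot a b) + 2%:R * (1 - sdot b c).
Proof.
move=> sa sb sc; rewrite !sdot_coord//.
have := SU2_coord sa; have := SU2_coord sb; have := SU2_coord sc.
move: (Re (a 0 0)) (Im (a 0 0)) (Re (a 0 1)) (Im (a 0 1)) => a1 a2 a3 a4.
move: (Re (b 0 0)) (Im (b 0 0)) (Re (b 0 1)) (Im (b 0 1)) => b1 b2 b3 b4.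
move: (Re (c 0 0)) (Im (c 0 0)) (Re (c 0 1)) (Im (c 0 1)) => c1 c2 c3 c4 hc hb ha.
have := sqr_ge0 (a1 - 2%:R * b1 + c1); have := sqr_ge0 (a2 - 2%:R * b2 + c2).
have := sqr_ge0 (a3 - 2%:R * b3 + c3); have := sqr_ge0 (a4 - 2%:R * b4 + c4).
lra.
Qed.

(** The four real coordinates of the first row change by at most |y - g|, whose square is 2 (1 -
    sdot g y), and the second row is determined by the first. So spherical caps shrink to g in the
    topology of matrices. *)
Lemma sdot_nbhs (g : M2) (A : set M2) : SU2 g -> nbhs g A ->
  exists2 d : R, 0 < d & forall y, SU2 y -> 1 - d < sdot g y -> A y.
Proof.
move=> sg.
pose F : set_system M2 := fun B => exists2 d : R, 0 < d & forall y, SU2 y -> 1 - d < sdot g y -> B y.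
have FF : Filter F.
  split.
  - by exists 1.
  - move=> P Q [d d0 hP] [d' d0' hQ]; exists (Num.min d d'); first by rewrite lt_min d0.
    move=> y sy; rewrite ltrBlDr -ltrBlDl => h; split.
      by apply: hP => //; rewrite ltrBlDr -ltrBlDl (lt_le_trans h)// ge_min lexx.
    by apply: hQ => //; rewrite ltrBlDr -ltrBlDl (lt_le_trans h)// ge_min lexx orbT.
  - by move=> P Q PQ [d d0 hP]; exists d => // y sy h; apply/PQ/hP.
have key (f : M2 -> R) : (forall y, SU2 y -> (f y - f g) ^+ 2 <= 2%:R * (1 - sdot g y)) -> f y @[y --> F] --> f g.
  move=> hf; apply/cvgrPdist_lt => e e0; exists (e ^+ 2 / 2%:R); first by rewrite divr_gt0// exprn_gt0.
  move=> y sy; rewrite ltrBlDr -ltrBlDl => h; rewrite distrC -(@ltr_pXn2r _ 2)// ?nnegrE ?normr_ge0// ?ltW//.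
  by rewrite real_normK ?num_real// (le_lt_trans (hf y sy))// -ltr_pdivlMl// mulrC.
have c1 y : SU2 y -> (Re (y 0 0) - Re (g 0 0)) ^+ 2 <= 2%:R * (1 - sdot g y) /\
   (Im (y 0 0) - Im (g 0 0)) ^+ 2 <= 2%:R * (1 - sdot g y) /\
   (Re (y 0 1) - Re (g 0 1)) ^+ 2 <= 2%:R * (1 - sdot g y) /\
   (Im (y 0 1) - Im (g 0 1)) ^+ 2 <= 2%:R * (1 - sdot g y).
  move=> sy; rewrite sdot_coord//; have := SU2_coord sy; have := SU2_coord sg.
  move: (Re (g 0 0)) (Im (g 0 0)) (Re (g 0 1)) (Im (g 0 1)) => a1 a2 a3 a4.
  move: (Re (y 0 0)) (Im (y 0 0)) (Re (y 0 1)) (Im (y 0 1)) => b1 b2 b3 b4 ha hb.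
  have := sqr_ge0 (a1 - b1); have := sqr_ge0 (a2 - b2); have := sqr_ge0 (a3 - b3); have := sqr_ge0 (a4 - b4).
  by repeat split; lra.
have sqN (x y : R) : (- x - - y) ^+ 2 = (x - y) ^+ 2 by ring.
have F2 : id @ F --> g.
  apply: (@cvg_mxc _ _ _ FF); do 2![apply: forall_I2]; apply: key => y sy;
    rewrite ?(SU2_row1 sy).1 ?(SU2_row1 sg).1 ?(SU2_row1 sy).2 ?(SU2_row1 sg).2 ?Re_opp ?Im_opp ?sqN;
    have := c1 y sy; case: (y 0 0) => ? ?; case: (y 0 1) => ? ?; case: (g 0 0) => ? ?; case: (g 0 1) => ? ? /= [h1 [h2 [h3 h4]]];
    by rewrite ?sqN.
by move=> /F2.
Qed.

Lemma contS_unif (h : M2 -> R) (e : R) : contS h -> 0 < e ->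
  exists2 d, 0 < d & forall g y, SU2 g -> SU2 y -> 1 - d < sdot g y -> `|h g - h y| <= e.
Proof.
move=> /subspace_continuousP ch e0.
have e2 : 0 < e / 2%:R by rewrite divr_gt0.
have H0 g0 : SU2 g0 -> exists2 d, 0 < d & forall y, SU2 y -> 1 - d < sdot g0 y -> `|h g0 - h y| <= e / 2%:R.
  move=> s0; have := ch g0 s0 => /cvgrPdist_le /(_ _ e2) h1.
  have [d d0 hd] := sdot_nbhs s0 h1; exists d => // y sy hy; exact: hd.
pose P (d : R) g := SU2 g -> forall y, SU2 y -> 1 - d < sdot g y -> `|h g - h y| <= e.
have hn : \forall d \near 0^'+, @SU2 R `<=` P d.
  apply: ((compact_near_coveringP (@SU2 R)).1 (@SU2_compact R)) => g0 s0; have [d d0 hd] := H0 g0 s0.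
  (* By [sdot_triangle], a step of size d / 4 from g0 to x followed by one of size d / 4 from x to y
     stays in the cap of size 2 (d / 4 + d / 4) = d. *)
  exists ([set x | 1 - d / 4%:R < sdot g0 x], [set d' | d' < d / 4%:R]) => /=.
    split; last by apply: nbhs_right_lt; rewrite divr_gt0.
    apply: (cvgr_gt (sdot g0 g0) (@sdot_continuous _ g0 g0)); rewrite sdot_self//.
    by rewrite ltrBlDr ltrDl divr_gt0.
  move=> [x d'] /= [hx hd'] sx y sy hy.
  rewrite -[h x - h y](subrKA (h g0)) (le_trans (ler_normD _ _))// [leRHS]splitr lerD//.
    rewrite distrC; apply: hd => //; apply: lt_trans hx; lra.
  apply: hd => //; move: (sdot_triangle s0 sx sy) hx hy hd'; rewrite /=.
  move: (sdot g0 x) (sdot x y) (sdot g0 y) => a b c; clear; lra.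
have [d [/= d0 hd]] := filter_ex (filterI (nbhs_right_gt (0 : R)) hn).
by exists d => // g y sg; exact: hd.
Qed.

Definition poisson (r t : R) : R := (1 - r ^+ 2) / (1 - 2%:R * r * t + r ^+ 2) ^+ 2.

Lemma poisson_den (r t : R) : 0 <= r < 1 -> `|t| <= 1 -> (1 - r) ^+ 2 <= 1 - 2%:R * r * t + r ^+ 2.
Proof. by move=> /andP[r0 r1]; rewrite ler_norml => /andP[t1 t2]; nra. Qed.

Lemma poisson_ge0 (r t : R) : 0 <= r < 1 -> 0 <= poisson r t.
Proof.
move=> /andP[r0 r1]; rewrite divr_ge0 ?sqr_ge0// subr_ge0 expr_le1// ltW//.
Qed.

(** The denominator is the square of (1 - r)^2 + 2 r (1 - t) >= 2 r d >= d. *)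
Lemma poisson_away (r t d : R) : 2%:R^-1 <= r < 1 -> `|t| <= 1 -> 0 < d -> t <= 1 - d ->
  poisson r t <= 2%:R * (1 - r) / d ^+ 2.
Proof.
move=> /andP[r0 r1]; rewrite ler_norml => /andP[t1 t2] d0 td.
have q : d <= 1 - 2%:R * r * t + r ^+ 2 by nra.
rewrite /poisson ler_pM//.
- by rewrite subr_ge0 expr_le1 ?ltW//; lra.
- by rewrite invr_ge0 sqr_ge0.
- by nra.
- rewrite lef_pV2 ?posrE ?exprn_gt0//; last exact: lt_le_trans q.
  by rewrite lerXn2r// nnegrE ltW//; exact: lt_le_trans q.
Qed.

Lemma poisson_sum_error (r : R) N (t : R) : 0 <= r < 1 -> `|t| <= 1 ->
  `|(poisson_sum r N).[t] - poisson r t| <= 10%:R * N.+1%:R ^+ 2 * r ^+ N / (1 - r) ^+ 4.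
Proof.
move=> r01 t1; have /andP[r0 r1] := r01; have qb := poisson_den r01 t1.
have E := poisson_sumE r N t; move: E; rewrite /= /poisson.
set q := 1 - _ + _ in qb *; set A := (_ + (1 - r ^+ 2) * _) => E.
have q0 : 0 < q by apply: lt_le_trans qb; rewrite exprn_gt0// subr_gt0.
have -> : (poisson_sum r N).[t] - (1 - r ^+ 2) / q ^+ 2 = r ^+ N * A / q ^+ 2.
  apply: (mulfI (expf_neq0 2 (lt0r_neq0 q0))); rewrite mulrBr E.
  by field; rewrite gt_eqF.
have U0 := chebU_bound N t1; have U1 := chebU_bound N.+1 t1.
(* 10 = 4 * 2 + 2: |q| <= 4, and the two brackets are at most 2 (N + 1)^2 and 2 (N + 1). *)
have hA : `|A| <= 10%:R * N.+1%:R ^+ 2.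
  have q4 : `|q| <= 4%:R.
    by rewrite gtr0_norm// /q; move: t1; rewrite ler_norml => /andP[t1 t2]; nra.
  have N0 : 0 <= N%:R :> R by rewrite ler0n.
  have N1 : N.+1%:R = N%:R + 1 :> R by rewrite natr1.
  have i1 : `|N.+1%:R * r * (chebU R N).[t] - N%:R * (chebU R N.+1).[t]| <= 2%:R * N.+1%:R ^+ 2.
    rewrite (le_trans (ler_normB _ _))// !normrM !normr_nat (ger0_norm r0).
    have a1 : N.+1%:R * r * `|(chebU R N).[t]| <= N.+1%:R * 1 * N%:R.
      by rewrite ler_pM ?mulr_ge0// ler_wpM2l// ltW.
    have a2 : N%:R * `|(chebU R N.+1).[t]| <= N%:R * N.+1%:R by rewrite ler_wpM2l.
    by apply: (le_trans (lerD a1 a2)); rewrite N1; nra.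
  have i2 : `|r * (chebU R N).[t] - (chebU R N.+1).[t]| <= 2%:R * N.+1%:R.
    rewrite (le_trans (ler_normB _ _))// !normrM (ger0_norm r0).
    move: U0 U1 (normr_ge0 (chebU R N).[t]) (normr_ge0 (chebU R N.+1).[t]); rewrite N1.
    move: `|_| `|_| => u v; nra.
  have i3 : `|1 - r ^+ 2| <= 1 by rewrite ger0_norm; nra.
  rewrite /A (le_trans (ler_normD _ _))// !normrM.
  apply: (@le_trans _ _ (4%:R * (2%:R * N.+1%:R ^+ 2) + 1 * (2%:R * N.+1%:R))).
    by rewrite lerD// ler_pM.
  by rewrite N1; nra.
rewrite normrM normrM normfV (gtr0_norm (exprn_gt0 _ q0)) (ger0_norm (exprn_ge0 _ r0)).
apply: ler_pM; rewrite ?invr_ge0 ?sqr_ge0 ?mulr_ge0 ?exprn_ge0//.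
  by rewrite mulrC ler_wpM2r// exprn_ge0.
have r1' : 0 < (1 - r) ^+ 2 by rewrite exprn_gt0// subr_gt0.
rewrite lef_pV2 ?posrE ?exprn_gt0// ?subr_gt0//.
by rewrite (_ : 4 = 2 * 2)%N// exprM lerXn2r// nnegrE ltW.
Qed.

Lemma geometric_sqr (r e : R) N0 : 0 <= r < 1 -> 0 < e ->
  exists2 N, (N0 < N)%N & N.+1%:R ^+ 2 * r ^+ N <= e.
Proof.
move=> /andP[r0 r1] e0; have [->|rn0] := eqVneq r 0.
  by exists N0.+1 => //; rewrite expr0n mulr0 ltW.
have rp : 0 < r by rewrite lt_def rn0.
pose c := Num.min 1 (r^-1 - 1).
have c0 : 0 < c by rewrite lt_min ltr01 subr_gt0 invf_gt1.
have ch : c <= r^-1 - 1 by rewrite ge_min lexx orbT.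
have c1 : c <= 1 by rewrite ge_min lexx.
have bern M : r ^+ M * (1 + M%:R * c) <= 1.
  elim: M => [|M IH]; first by rewrite expr0 mul1r mul0r addr0.
  apply: le_trans IH; rewrite exprS -mulrA mulrCA ler_wpM2l ?exprn_ge0//.
  have rc : r * c <= 1 - r by rewrite -ler_pdivlMl// mulrBr mulr1 mulVf.
  have Mc : 0 <= M%:R * c by rewrite mulr_ge0// ltW.
  by rewrite -[M.+1%:R]natr1; nra.
have [M [hM M0]] : exists M : nat, 9%:R / (c ^+ 3 * e) <= M.+1%:R /\ (N0 <= M)%N.
  exists (maxn N0 (Num.truncn (9%:R / (c ^+ 3 * e)))); rewrite leq_maxl; split => //.
  by apply: (le_trans (ltW (truncnS_gt _))); rewrite ler_nat ltnS leq_maxr.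
(* Bernoulli bounds x = r^(M + 1) by 1 / (c n) with n = M + 2, where c <= 1 absorbs the shift from M
   + 1. Hence x^3 outweighs (N + 1)^2 <= 9 n^2 with a factor 1 / n to spare. *)
exists (3 * M.+1)%N; first by rewrite (leq_ltn_trans M0)// leq_pmull.
set x := r ^+ M.+1; have x0 : 0 <= x by rewrite exprn_ge0.
pose n : R := M.+2%:R; have n0 : 0 < n by rewrite ltr0n.
have b : x * c * n <= 1.
  apply: le_trans (bern M.+1); rewrite -mulrA ler_wpM2l// /n -[M.+2%:R]natr1; nra.
have cn0 : 0 < c ^+ 3 * n by rewrite mulr_gt0// exprn_gt0.
rewrite (mulnC 3) exprM -/x -(ler_pM2l cn0).
apply: (@le_trans _ _ (9%:R * (x * c * n) ^+ 3)).
  have n3 : (M.+1 * 3).+1%:R <= 3%:R * n.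
    by rewrite -natrM ler_nat mulnC ltn_pmul2l.
  have n4 : (M.+1 * 3).+1%:R ^+ 2 <= (3%:R * n) ^+ 2.
    by rewrite lerXn2r// nnegrE ?mulr_ge0// ltW.
  rewrite (_ : 9%:R * _ = c ^+ 3 * n * ((3%:R * n) ^+ 2 * x ^+ 3)); last by ring.
  by rewrite (ler_wpM2l (ltW cn0))// ler_wpM2r// exprn_ge0.
apply: (@le_trans _ _ 9%:R).
  by rewrite -[leRHS]mulr1 ler_wpM2l// exprn_ile1// mulr_ge0// ?mulr_ge0// ltW.
have c3e : 0 < c ^+ 3 * e by rewrite mulr_gt0// exprn_gt0.
have : 9%:R <= M.+1%:R * (c ^+ 3 * e) by rewrite -ler_pdivrMr.
move=> /le_trans; apply; rewrite (_ : c ^+ 3 * n * e = n * (c ^+ 3 * e)); last by ring.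
by rewrite ler_wpM2r ?(ltW c3e)// ler_nat.
Qed.

Lemma haar_poisson_sum (r : R) N g : SU2 g -> haar (zonal (poisson_sum r N.+1) g) = 1.
Proof.
move=> sg; elim: N => [|N IH].
  rewrite /poisson_sum !big_ord_recr big_ord0 /= add0r mul0r scale0r add0r expr0 mulr1 scale1r.
  exact: haar_chebU1.
by rewrite /poisson_sum big_ord_recr /= haar_zonalD -/(poisson_sum r N.+1) IH haar_zonalZ haar_chebU// mulr0 addr0.
Qed.

(** The Poisson sums have mass 1 and are uniformly close to a positive kernel that concentrates at y
    as r tends to 1. The lower bounds on N and r are for [reproducing], where the term of index |j|
    has to occur in the sum with a coefficient close to 1. *)
Lemma zonal_approx (h : M2 -> R) (e : R) N0 : contS h -> 0 < e ->
  exists r N, [/\ (N0 <= N)%N, 0 <= r < 1, 1 - e <= r & forall y, SU2 y ->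
    `|h y - haar (fun g => zonal (poisson_sum r N.+1) y g * h g)| <= e].
Proof.
move=> ch e0; have [M M0 hM] := contS_bounded ch.
have e4 : 0 < e / 4%:R by rewrite divr_gt0.
have [d d0 hd] := contS_unif ch e4.
have M1 : 0 < M + 1 by lra.
(* s is 1 - r. The last entry of the minimum makes the Poisson kernel outside the cap, times the
   oscillation 2 M of h, at most e / 4. *)
pose s := Num.min (Num.min (2%:R^-1) e) (e * d ^+ 2 / (16%:R * (M + 1))).
have s0 : 0 < s by rewrite !lt_min e0 invr_gt0 ltr0n /= divr_gt0// mulr_gt0// exprn_gt0.
have s1 : s <= 2%:R^-1 by rewrite !ge_min lexx.
have se : s <= e by rewrite !ge_min lexx orbT.
have s2 : 2%:R * s / d ^+ 2 * (2%:R * M) <= e / 4%:R.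
  have : s <= e * d ^+ 2 / (16%:R * (M + 1)) by rewrite ge_min lexx orbT.
  rewrite ler_pdivlMr ?mulr_gt0// => h1.
  rewrite mulrAC ler_pdivrMr ?exprn_gt0//; move: h1; move: (d ^+ 2) => dd h1.
  by have sM := mulr_ge0 (ltW s0) M0; lra.
pose r := 1 - s; have r01 : 0 <= r < 1 by rewrite /r; lra.
have r12 : 2%:R^-1 <= r < 1 by rewrite /r; lra.
pose eta := Num.min (2%:R^-1) (e / (8%:R * (M + 1))).
have eta0 : 0 < eta by rewrite lt_min invr_gt0 ltr0n /= divr_gt0// mulr_gt0.
have eta1 : eta <= 2%:R^-1 by rewrite ge_min lexx.
have eta2 : eta * (2%:R * M) <= e / 4%:R.
  have : eta <= e / (8%:R * (M + 1)) by rewrite ge_min lexx orbT.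
  by rewrite ler_pdivlMr ?mulr_gt0//; lra.
have c0 : 0 < eta * (1 - r) ^+ 4 / 10%:R by rewrite divr_gt0// mulr_gt0// exprn_gt0// /r; lra.
have [[//|N] N0N hN] := geometric_sqr N0 r01 c0.
exists r, N; split => //; first by rewrite /r lerB.
move=> y sy.
have hN' t : `|t| <= 1 -> `|(poisson_sum r N.+1).[t] - poisson r t| <= eta.
  move=> t1; apply: (le_trans (poisson_sum_error N.+1 r01 t1)).
  rewrite ler_pdivrMr; last by rewrite exprn_gt0// /r; lra.
  have := ler_wpM2l (ler0n R 10) hN; rewrite [X in _ <= X -> _]mulrCA mulfV ?pnatr_eq0// mulr1.
  by rewrite mulrA.
set P := zonal (poisson_sum r N.+1) y.
have cP : contS P by exact: contS_zonal.
have cB : contS (fun g => P g * (h y - h g)).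
  by apply: contSM => //; apply: contSD; [exact: contS_cst|under eq_fun do rewrite -mulN1r; exact: contSZ].
have -> : h y - haar (fun g => P g * h g) = haar (fun g => P g * (h y - h g)).
  transitivity (h y * haar P - haar (fun g => P g * h g)).
    by rewrite haar_poisson_sum// mulr1.
  rewrite -haarZ ?contS_hint// -haarB; last 2 first.
  - exact/contS_hint/contSZ.
  - exact/contS_hint/contSM.
  by congr haar; apply/funext => g; ring.
apply: (le_trans (haar_norm (contS_hint cB))).
(* Let Q be the Poisson kernel, so |P - Q| <= eta. Near y the integrand is at most (Q + eta) e / 4
   <= (P + 2 eta) e / 4, and away from y at most e / 2; [B] dominates both, as P >= - eta. Its
   integral is at most e, because P has integral 1 and eta <= 1/2. *)
pose B g := (e / 4%:R) * P g + (eta * (e / 2%:R) + (e / 4%:R + e / 4%:R)).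
have cBB : contS B by apply: contSD; [exact: contSZ|exact: contS_cst].
apply: (@le_trans _ _ (haar B)).
  apply: haar_le; [exact/hint_norm/contS_hint|exact: contS_hint|move=> g sg].
  have t1 := sdot_le1 sy sg; have := hN' _ t1; rewrite /B /P /zonal.
  have P0 := poisson_ge0 (sdot y g) r01.
  have h2M : `|h y - h g| <= 2%:R * M.
    by rewrite (le_trans (ler_normB _ _))// mulr_natl mulr2n lerD// hM.
  have := poisson_away r12 t1 d0; have := hd y g sy sg.
  set S := (poisson_sum _ _).[_]; set Q := poisson _ _ in P0 *; set t := sdot y g.
  rewrite normrM => hclose hfar hSQ.
  have SQ : `|S| <= Q + eta by move: hSQ; rewrite !ler_norml => /andP[? ?]; apply/andP; split; lra.
  have QS : Q <= S + eta by move: hSQ; rewrite ler_norml => /andP[? ?]; lra.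
  apply: (le_trans (ler_wpM2r (normr_ge0 _) SQ)).
  have [tc|tf] := ltP (1 - d) t.
    apply: (@le_trans _ _ ((Q + eta) * (e / 4%:R))).
      by rewrite ler_wpM2l ?hclose//; lra.
    by nra.
  have hf := hfar tf.
  apply: (@le_trans _ _ ((2%:R * (1 - r) / d ^+ 2 + eta) * (2%:R * M))).
    by rewrite ler_pM//; lra.
  rewrite mulrDl (_ : 1 - r = s); last by rewrite /r; lra.
  have SE : 0 <= e / 4%:R * (S + eta) by rewrite mulr_ge0//; lra.
  have ee := mulr_ge0 (ltW eta0) (ltW e0).
  move: s2 eta2 SE ee; move: (2%:R * s / d ^+ 2 * (2%:R * M)) (eta * (2%:R * M)) => u v; clear; lra.
rewrite haarD ?contS_hint//; [|exact: contSZ|exact: contS_cst].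
rewrite haarZ ?contS_hint// haar_cst haar_poisson_sum//; nra.
Qed.
End Approximation.

(** * Exchange of integrals and right invariance *)

Section Invariance.
Variable R : realType.
Local Notation C := R[i].
Local Notation M2 := 'M[C]_2.
Local Notation Re := (@complex.Re R).
Local Notation Im := (@complex.Im R).

Lemma eq_contS (u v : M2 -> R) : (forall g, SU2 g -> u g = v g) -> contS u -> contS v.
Proof.
move=> uv; apply: subspace_eq_continuous => g; rewrite inE => sg; rewrite /from_subspace; exact: uv.
Qed.

Lemma contS_sdotP (u : M2 -> R) : (forall g e, SU2 g -> 0 < e -> exists2 d, 0 < d &
   forall y, SU2 y -> 1 - d < sdot g y -> `|u g - u y| <= e) -> contS u.
Proof.
move=> hu; apply/subspace_continuousP => g sg; rewrite /from_subspace.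
apply/cvgrPdist_le => e e0; have [d d0 hd] := hu g e sg e0.
rewrite /within; apply: (@filterS _ _ (nbhs_filter g) [set y | 1 - d < sdot g y]).
  by move=> y /= h sy; exact: hd.
apply: (cvgr_gt (sdot g g) (@sdot_continuous _ g g)); rewrite sdot_self//.
by rewrite ltrBlDr ltrDl.
Qed.

Lemma contS_mulr (u : M2 -> R) h : SU2 h -> contS u -> contS (fun y => u (y *m h)).
Proof.
move=> sh cu; apply: contS_sdotP => g e sg e0; have [d d0 hd] := contS_unif cu e0.
exists d => // y sy hy; apply: hd; [exact: SU2_mul|exact: SU2_mul|by rewrite sdotMr].
Qed.

Lemma contS_Re (p : M2 -> C) : polyfun p -> contS (fun g => Re (p g)).
Proof.
move=> hp; apply: continuous_subspaceT => g.
by apply: (@continuous_comp _ _ _ p Re); [exact: polyfun_continuous|exact: Re_continuous].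
Qed.

Lemma contS_Im (p : M2 -> C) : polyfun p -> contS (fun g => Im (p g)).
Proof.
move=> hp; apply: continuous_subspaceT => g.
by apply: (@continuous_comp _ _ _ p Im); [exact: polyfun_continuous|exact: Im_continuous].
Qed.

Lemma hintM (a u : M2 -> R) : contS a -> hint u -> hint (fun g => a g * u g).
Proof.
move=> ca hu; have [M M0 hM] := contS_bounded ca.
have h2 : hint (fun g => M * u g) by exact: hintZ.
apply: (le_integrable _ _ _ h2); first exact: measurable_cube.
  apply/measurable_EFinP; apply: measurable_funM; first exact: contS_measurable.
  by case/integrableP : hu => /measurable_EFinP.
move=> p hp; rewrite /= lee_fin !normrM ler_wpM2r// (le_trans (hM _ (hopf_SU2 hp)))//.
by rewrite ger0_norm.
Qed.

(* Kernels for which the order of two integrations can be exchanged by mere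
   linearity. *)
Definition sep (k : M2 -> M2 -> R) := exists n (a b : 'I_n -> M2 -> R),
  [/\ forall i, contS (a i), forall i, contS (b i) &
    forall g y, SU2 g -> SU2 y -> k g y = \sum_i a i g * b i y].

Lemma sep1 (a b : M2 -> R) : contS a -> contS b -> sep (fun g y => a g * b y).
Proof.
by move=> ca cb; exists 1%N, (fun=> a), (fun=> b); split => // g y _ _; rewrite big_ord1.
Qed.

Lemma sepD k k' : sep k -> sep k' -> sep (fun g y => k g y + k' g y).
Proof.
move=> [n [a [b [ca cb h]]]] [n' [a' [b' [ca' cb' h']]]].
exists (n + n')%N, (fun i => match fintype.split i with inl j => a j | inr j => a' j end),
  (fun i => match fintype.split i with inl j => b j | inr j => b' j end); split.
- by move=> i; case: fintype.split.
- by move=> i; case: fintype.split.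
- move=> g y sg sy; rewrite h// h'// big_split_ord; congr (_ + _); apply: eq_bigr => i _.
    by rewrite (unsplitK (inl _ i)).
  by rewrite (unsplitK (inr _ i)).
Qed.

Lemma sepM k k' : sep k -> sep k' -> sep (fun g y => k g y * k' g y).
Proof.
move=> [n [a [b [ca cb h]]]] [n' [a' [b' [ca' cb' h']]]].
pose e := @enum_val ('I_n * 'I_n')%type predT.
exists #|{: 'I_n * 'I_n'}|, (fun i g => a (e i).1 g * a' (e i).2 g),
  (fun i g => b (e i).1 g * b' (e i).2 g); split.
- by move=> i; exact: contSM.
- by move=> i; exact: contSM.
- move=> g y sg sy; rewrite h// h'// big_distrlr /= pair_big /=.
  rewrite (reindex e) /=; last exact/onW_bij/enum_val_bij.
  by apply: eq_bigr => i _; rewrite mulrACA.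
Qed.

Lemma sep_sdot : sep (@sdot R).
Proof.
have e (i j : 'I_2) : sep (fun g y => Re (g i j) * Re (y i j)).
  by apply: sep1; apply: contS_Re; exact: polyfun_entry.
have e' (i j : 'I_2) : sep (fun g y => Im (g i j) * Im (y i j)).
  by apply: sep1; apply: contS_Im; exact: polyfun_entry.
have [n [a [b [ca cb h]]]] := sepD (sepD (sepD (e 0 0) (e' 0 0)) (e 0 1)) (e' 0 1).
by exists n, a, b; split => // g y sg sy; rewrite sdot_coord// h.
Qed.

Lemma sep_zonal p : sep (@zonal R p).
Proof.
rewrite /zonal; elim/poly_ind: p => [|p c IH].
  by exists 0%N, (fun=> fun=> 0), (fun=> fun=> 0); split => [[]|[]|g y _ _] //; rewrite horner0 big_ord0.
have [n [a [b [ca cb h]]]] := sepD (sepM IH sep_sdot) (sep1 (@contS_cst R c) (@contS_cst R 1)).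
by exists n, a, b; split => // g y sg sy; rewrite hornerMXaddC -h// mulr1.
Qed.

Lemma haar_sep k (u : M2 -> R) : sep k -> hint u -> exists n (a b : 'I_n -> M2 -> R),
  [/\ forall i, contS (a i), forall i, contS (b i),
    forall g y, SU2 g -> SU2 y -> k g y = \sum_i a i g * b i y &
    forall g, SU2 g -> haar (fun y => k g y * u y) = \sum_i a i g * haar (fun y => b i y * u y)].
Proof.
move=> [n [a [b [ca cb h]]]] hu; exists n, a, b; split => // g sg.
have hb i : hint (fun y => a i g * (b i y * u y)) by exact/hintZ/hintM.
have [_ e] := haar_sum hb.
transitivity (haar (fun y => \sum_i a i g * (b i y * u y))).
  by apply: eq_haar => y sy; rewrite h// mulr_suml; apply: eq_bigr => i _; rewrite mulrA.
by rewrite e; apply: eq_bigr => i _; rewrite haarZ//; exact: hintM.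
Qed.

Lemma haar_sep_contS k (u : M2 -> R) : sep k -> hint u -> contS (fun g => haar (fun y => k g y * u y)).
Proof.
move=> sk hu; have [n [a [b [ca cb h e]]]] := haar_sep sk hu.
apply: (@eq_contS (fun g => \sum_i a i g * haar (fun y => b i y * u y))).
  by move=> g sg; rewrite e.
by apply: contS_sum => i; apply: contSM => //; exact: contS_cst.
Qed.

Lemma haar_swap k (u v : M2 -> R) : sep k -> hint u -> hint v ->
  haar (fun g => v g * haar (fun y => k g y * u y)) = haar (fun y => u y * haar (fun g => k g y * v g)).
Proof.
move=> sk hu hv; have [n [a [b [ca cb h e]]]] := haar_sep sk hu.
have hav i : hint (fun g => a i g * v g) by exact: hintM.
have hbu i : hint (fun y => b i y * u y) by exact: hintM.
have e1 g : SU2 g -> v g * haar (fun y => k g y * u y) =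
    \sum_i haar (fun y => b i y * u y) * (a i g * v g).
  by move=> sg; rewrite e// mulr_sumr; apply: eq_bigr => i _; ring.
have e2 y : SU2 y -> u y * haar (fun g => k g y * v g) =
    \sum_i haar (fun g => a i g * v g) * (b i y * u y).
  move=> sy; have [_ es] := haar_sum (fun i => hintZ (b i y) (hav i)).
  transitivity (u y * haar (fun g => \sum_i b i y * (a i g * v g))).
    by congr (_ * _); apply: eq_haar => g sg; rewrite h// mulr_suml; apply: eq_bigr => i _; ring.
  by rewrite es mulr_sumr; apply: eq_bigr => i _; rewrite haarZ//; ring.
rewrite (eq_haar e1) (eq_haar e2).
rewrite (haar_sum (fun i => hintZ _ (hav i))).2 (haar_sum (fun i => hintZ _ (hbu i))).2.
by apply: eq_bigr => i _; rewrite !haarZ//; ring.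
Qed.

Lemma zonalC p (g y : M2) : zonal p g y = zonal p y g.
Proof. by rewrite /zonal sdotC. Qed.

(** Once the integrals are exchanged, the Poisson approximation of h pairs to 0 with w, and it
    differs uniformly little from h. w is merely integrable because it will be a component of an L^2
    spinor. *)
Lemma zonal_total (w h : M2 -> R) : hint w ->
  (forall k g, SU2 g -> haar (fun y => zonal (chebU R k) g y * w y) = 0) ->
  contS h -> haar (fun y => h y * w y) = 0.
Proof.
move=> hw w0 ch; apply/eqP; rewrite -normr_le0; apply/ler_addgt0Pr => e e0; rewrite add0r.
have N0 : 0 <= haar (fun y => `|w y|) by apply: haar_ge0.
have [|r [N [_ _ _ hr]]] := @zonal_approx _ _ (e / (haar (fun y => `|w y|) + 1)) 0%N ch.
  by rewrite divr_gt0//; lra.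
set p := poisson_sum r N.+1 in hr.
have P0 g : SU2 g -> haar (fun y => zonal p g y * w y) = 0.
  move=> sg.
  have hi (k : 'I_N.+2) : hint (fun y => (k%:R * r ^+ k.-1) * (zonal (chebU R k) g y * w y)).
    by apply/hintZ/hintM => //; exact: contS_zonal.
  transitivity (haar (fun y => \sum_(k < N.+2) (k%:R * r ^+ k.-1) * (zonal (chebU R k) g y * w y))).
    apply: eq_haar => y _; rewrite /zonal /p /poisson_sum horner_sum mulr_suml.
    by apply: eq_bigr => k _; rewrite hornerZ mulrA.
  rewrite (haar_sum hi).2 big1// => k _; rewrite haarZ ?w0 ?mulr0//.
  by apply: hintM => //; exact: contS_zonal.
have cS : contS (fun y => haar (fun g => zonal p y g * h g)).
  by apply: haar_sep_contS; [exact: sep_zonal|exact: contS_hint].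
have S0 : haar (fun y => w y * haar (fun g => zonal p y g * h g)) = 0.
  rewrite haar_swap//; [|exact: sep_zonal|exact: contS_hint].
  rewrite -[RHS](haar_cst 0); apply: eq_haar => g sg.
  by under eq_fun do rewrite zonalC; rewrite P0// mulr0.
have cD : contS (fun y => h y - haar (fun g => zonal p y g * h g)).
  by apply: contSD => //; under eq_fun do rewrite -mulN1r; exact: contSZ.
have -> : haar (fun y => h y * w y) = haar (fun y => (h y - haar (fun g => zonal p y g * h g)) * w y).
  rewrite -[LHS]subr0 -S0 -haarB; last 2 first.
  - exact: hintM.
  - by under eq_fun do rewrite mulrC; exact: hintM.
  by congr haar; apply/funext => y; ring.
apply: (le_trans (haar_norm (hintM cD hw))).
apply: (@le_trans _ _ (haar (fun y => e / (haar (fun y => `|w y|) + 1) * `|w y|))).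
  apply: haar_le; [exact/hint_norm/hintM|exact/hintZ/hint_norm|move=> y sy].
  by rewrite normrM ler_wpM2r// hr.
rewrite haarZ; last exact: hint_norm.
rewrite mulrAC ler_pdivrMr; last by lra.
by nra.
Qed.

(** Let S be the Poisson smoothing of h. In the integral of S (y s) the inner integral over y is
    that of the zonal kernel centred at g s^-1, which is 1 for every centre; so it equals the
    integral of h, and S is uniformly close to h. *)
Lemma haar_mulr (h : M2 -> R) s : SU2 s -> contS h -> haar (fun y => h (y *m s)) = haar h.
Proof.
move=> ss ch; apply/eqP; rewrite -subr_eq0 -normr_le0; apply/ler_addgt0Pr => e e0; rewrite add0r.
have [|r [N [_ _ _ hr]]] := @zonal_approx _ _ (e / 2%:R) 0%N ch; first by rewrite divr_gt0.
set p := poisson_sum r N.+1 in hr.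
pose S y := haar (fun g => zonal p y g * h g).
have cS : contS S by apply: haar_sep_contS; [exact: sep_zonal|exact: contS_hint].
have close (u v : M2 -> R) : contS u -> contS v -> (forall y, SU2 y -> `|u y - v y| <= e / 2%:R) ->
    `|haar u - haar v| <= e / 2%:R.
  move=> cu cv huv; rewrite -haarB ?contS_hint//.
  have cuv : contS (fun y => u y - v y).
    by apply: contSD => //; under eq_fun do rewrite -mulN1r; exact: contSZ.
  apply: (le_trans (haar_norm (contS_hint cuv))); rewrite -[leRHS]haar_cst.
  by apply: haar_le => //; [exact/hint_norm/contS_hint|exact/contS_hint/contS_cst].
have E : haar (fun y => S (y *m s)) = haar h.
  transitivity (haar (fun y => 1 * haar (fun g => zonal p (y *m s) g * h g))).
    by congr haar; apply/funext => y; rewrite mul1r.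
  have [n [a [b [ca cb hk]]]] := sep_zonal p.
  rewrite haar_swap; last 3 first.
  - exists n, (fun i g => a i (g *m s)), b; split => //; first by move=> i; exact: contS_mulr.
    by move=> g y sg sy; rewrite hk//; exact: SU2_mul.
  - exact: contS_hint.
  - exact/contS_hint/contS_cst.
  apply: eq_haar => g sg; rewrite -[RHS]mulr1; congr (_ * _).
  transitivity (haar (zonal p (g *m adj s))); last exact/haar_poisson_sum/SU2_mul/SU2_adj.
  congr haar; apply/funext => y.
  by rewrite mulr1 zonalC /zonal sdotMr_adj.
rewrite -[haar (fun y => _) - _](subrKA (haar (fun y => S (y *m s)))).
rewrite E (le_trans (ler_normD _ _))// subrr normr0 addr0.
have := @close (fun y => h (y *m s)) (fun y => S (y *m s)); rewrite E => c1.
apply: (le_trans (c1 _ _ _)); [exact: contS_mulr|exact: contS_mulr|move=> y sy|lra].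
by apply: hr; exact: SU2_mul.
Qed.
End Invariance.

(** * Symmetry of the Dirac operator and completeness *)

Section Symmetry.
Variable R : realType.
Local Notation C := R[i].
Local Notation M2 := 'M[C]_2.
Local Notation V := 'cV[C]_2.
Local Notation Re := (@complex.Re R).
Local Notation Im := (@complex.Im R).

Lemma cos_near0 (d : R) : 0 < d -> exists2 t, 0 < t & forall s, `|s| <= t -> 1 - d < cos s.
Proof.
move=> d0.
have : \forall s \near (0 : R), 1 - d < cos s.
  by apply: (cvgr_gt (cos 0) (@continuous_cos R 0)); rewrite cos0 ltrBlDr ltrDl.
move=> /nbhs_ballP[e /= e0 he]; exists (e / 2%:R); first by rewrite divr_gt0.
move=> s hs; apply: he; rewrite /ball /= sub0r normrN (le_lt_trans hs)//.
by rewrite ltr_pdivrMr// ltr_pMr// ltr1n.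
Qed.

Lemma expmx_add (X : M2) (s t : R) : X *m X = - 1%:M ->
  expmx ((s + t)%:C *: X) = expmx (s%:C *: X) *m expmx (t%:C *: X).
Proof.
move=> XX; rewrite !expmx_sqrN1// cosD sinD mulmxDl !mulmxDr -!scalemxAl !mul_scalar_mx.
rewrite -!scalemxAr XX mul_mx_scalar !scalerN !scalerA !scale_scalar_mx mulr1.
have -> : (cos s * cos t - sin s * sin t)%:C = (cos s)%:C * (cos t)%:C - (sin s)%:C * (sin t)%:C :> C.
  by rewrite rmorphB !rmorphM.
have -> : (sin s * cos t + cos s * sin t)%:C = (sin s)%:C * (cos t)%:C + (cos s)%:C * (sin t)%:C :> C.
  by rewrite rmorphD !rmorphM.
rewrite [(_ - _)%:M]raddfB /= scalerDl -!addrA; congr (_ + _).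
by rewrite addrC -addrA [RHS]addrCA.
Qed.

Lemma sdot_exp (g X : M2) (t : R) : X \in [:: mxI R; mxJ R; mxK R] -> SU2 g ->
  sdot g (g *m expmx (t%:C *: X)) = cos t.
Proof.
move=> hX sg; rewrite /sdot mulmxA SU2_adjl// mul1mx expmx_sqrN1; last exact: frame_sqr.
rewrite mxtraceD mxtrace_scalar mxtraceZ (_ : \tr X = 0).
  by rewrite mulr0 addr0 -[(cos t)%:C *+ 2]mulr_natl mulKf ?pnatr_eq0.
by move: hX; rewrite !inE => /or3P[] /eqP ->; rewrite mx2_tr ?subrr ?addr0.
Qed.

Lemma is_derive1_translate (F : R -> R) s a : is_derive (0 : R) 1 (fun t => F (s + t)) a ->
  is_derive s 1 F a.
Proof.
move=> h; have E : F = (fun y => F (s + (- s + y))) by apply/funext => y; rewrite addrA subrr add0r.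
by rewrite E; apply: (@is_derive1_shift R (fun t => F (s + t)) s (- s)); rewrite addNr.
Qed.

(** By invariance, h (g exp (t X)) and h g have the same integral. Their difference is uniformly
    close to t h' g by the mean value theorem, because [sdot_exp] places the curve in a small cap,
    where h' is nearly constant. *)
Lemma haar_lie0 X (h h' : M2 -> R) : X \in [:: mxI R; mxJ R; mxK R] -> contS h -> contS h' ->
  (forall g, SU2 g -> is_derive (0 : R) 1 (fun t => h (g *m expmx (t%:C *: X))) (h' g)) ->
  haar h' = 0.
Proof.
move=> hX ch ch' dh; have XX := frame_sqr hX.
apply/eqP; rewrite -normr_le0; apply/ler_addgt0Pr => e e0; rewrite add0r.
have [d d0 hd] := contS_unif ch' e0; have [t t0 ht] := cos_near0 d0.
have sE s : SU2 (expmx (s%:C *: X)) by exact: SU2_exp.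
have dF g s : SU2 g -> is_derive (s : R) 1 (fun t => h (g *m expmx (t%:C *: X))) (h' (g *m expmx (s%:C *: X))).
  move=> sg; have := dh _ (SU2_mul sg (sE s)); under eq_fun do rewrite -mulmxA -expmx_add//.
  move=> hs; exact: (@is_derive1_translate (fun t => h (g *m expmx (t%:C *: X)))).
pose D g := h (g *m expmx (t%:C *: X)) - h g - t * h' g.
have cD : contS D.
  apply: contSD; last by under eq_fun do rewrite -mulNr; exact: contSZ.
  by apply: contSD; [exact: contS_mulr|under eq_fun do rewrite -mulN1r; exact: contSZ].
have Db g : SU2 g -> `|D g| <= e * t.
  move=> sg; have [c hc] := @mean_value _ _ _ 0 t (fun s => dF g s sg).
  rewrite expmx0// mulmx1 subr0 => E; rewrite /D E [h' _ * t]mulrC -mulrBr normrM gtr0_norm// mulrC.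
  rewrite ler_wpM2r ?(ltW t0)// distrC hd ?sdot_exp//; first exact: SU2_mul.
  by apply: ht; rewrite subr0 in hc; rewrite (le_trans hc)// subr0 gtr0_norm.
have hD : haar D = - (t * haar h').
  have c1 : contS (fun g => h (g *m expmx (t%:C *: X))) by exact: contS_mulr.
  have c2 : contS (fun g => h (g *m expmx (t%:C *: X)) - h g).
    by apply: contSD => //; under eq_fun do rewrite -mulN1r; exact: contSZ.
  rewrite haarB ?contS_hint//; last exact: contSZ.
  by rewrite haarB ?contS_hint// haar_mulr// subrr sub0r haarZ// contS_hint.
have : `|haar D| <= e * t.
  apply: (le_trans (haar_norm (contS_hint cD))); rewrite -[leRHS]haar_cst.
  by apply: haar_le => //; [exact/hint_norm/contS_hint|exact/contS_hint/contS_cst].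
by rewrite hD normrN normrM gtr0_norm// mulrC ler_pM2r.
Qed.

Definition cdot (v w : V) : C := (adj v *m w) 0 0.
Definition chaar (f : M2 -> C) : C := haar (fun y => Re (f y)) +i* haar (fun y => Im (f y)).
Definition chint (f : M2 -> C) := hint (fun y => Re (f y)) /\ hint (fun y => Im (f y)).
Definition ccontS (f : M2 -> C) := contS (fun y => Re (f y)) /\ contS (fun y => Im (f y)).

Lemma cdotE v w : cdot v w = conjc (v 0 0) * w 0 0 + conjc (v 1 0) * w 1 0.
Proof. by rewrite /cdot mulmx2E !mxE. Qed.

Lemma cdotDl u v w : cdot (u + v) w = cdot u w + cdot v w.
Proof. by rewrite /cdot adjD mulmxDl mxE. Qed.
Lemma cdotDr u v w : cdot w (u + v) = cdot w u + cdot w v.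
Proof. by rewrite /cdot mulmxDr mxE. Qed.
Lemma cdotZl k v w : cdot (k *: v) w = conjc k * cdot v w.
Proof. by rewrite /cdot adjZ -scalemxAl mxE. Qed.
Lemma cdotZr k v w : cdot v (k *: w) = k * cdot v w.
Proof. by rewrite /cdot -scalemxAr mxE. Qed.
Lemma cdotMl (A : M2) v w : cdot (A *m v) w = cdot v (adj A *m w).
Proof. by rewrite /cdot adjM mulmxA. Qed.
Lemma cdotC v w : cdot w v = conjc (cdot v w).
Proof. by rewrite !cdotE conjcD !conjcM !conjcK; congr (_ + _); rewrite mulrC. Qed.
Lemma cdotNr v w : cdot v (- w) = - cdot v w.
Proof. by rewrite -scaleN1r cdotZr mulN1r. Qed.

Lemma ccontS_chint f : ccontS f -> chint f.
Proof. by case=> a b; split; exact: contS_hint. Qed.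

Lemma chintD f h : chint f -> chint h -> chint (fun y => f y + h y).
Proof.
by move=> [fr fi] [hr hi]; split; [under eq_fun do rewrite Re_add|under eq_fun do rewrite Im_add]; exact: hintD.
Qed.

Lemma chaarD f h : chint f -> chint h -> chaar (fun y => f y + h y) = chaar f + chaar h.
Proof.
move=> [fr fi] [hr hi]; rewrite /chaar; under eq_fun do rewrite Re_add.
by under [X in _ +i* haar X]eq_fun do rewrite Im_add; rewrite !haarD.
Qed.

Lemma chintZ k f : chint f -> chint (fun y => k * f y).
Proof.
move=> [fr fi]; split.
  under eq_fun do rewrite Re_mul -mulNr; apply: hintD; exact: hintZ.
by under eq_fun do rewrite Im_mul; apply: hintD; exact: hintZ.
Qed.

Lemma chaarZ k f : chint f -> chaar (fun y => k * f y) = k * chaar f.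
Proof.
move=> [fr fi]; rewrite /chaar; apply: complex_ext => /=.
  under eq_fun do rewrite Re_mul; rewrite haarB ?haarZ//; [|exact: hintZ|exact: hintZ].
  by rewrite Re_mul.
under eq_fun do rewrite Im_mul; rewrite haarD ?haarZ//; [|exact: hintZ|exact: hintZ].
by rewrite Im_mul.
Qed.

Lemma chaarN f : chint f -> chaar (fun y => - f y) = - chaar f.
Proof. by move=> cf; rewrite -mulN1r -chaarZ//; congr chaar; apply/funext => y; rewrite mulN1r. Qed.

Lemma eq_chaar f h : (forall g, SU2 g -> f g = h g) -> chaar f = chaar h.
Proof. by move=> e; rewrite /chaar; congr (_ +i* _); apply: eq_haar => g sg; rewrite e. Qed.

Lemma chaar_conj f : chint f -> chaar (fun y => conjc (f y)) = conjc (chaar f).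
Proof.
move=> [fr fi]; rewrite /chaar /= -haarN//; congr (haar _ +i* haar _); apply/funext => y; by case: (f y).
Qed.

Lemma chaar_sum n (f : 'I_n -> M2 -> C) : (forall i, chint (f i)) ->
  chint (fun y => \sum_i f i y) /\ chaar (fun y => \sum_i f i y) = \sum_i chaar (f i).
Proof.
move=> hf; have hr i := (hf i).1; have hi i := (hf i).2.
have [r1 r2] := haar_sum hr; have [i1 i2] := haar_sum hi.
split; first by split; [under eq_fun do rewrite Re_sum|under eq_fun do rewrite Im_sum].
apply: complex_ext => /=; rewrite ?Re_sum ?Im_sum.
  by rewrite -r2; under eq_fun do rewrite Re_sum.
by rewrite -i2; under eq_fun do rewrite Im_sum.
Qed.

Lemma chaar_cst k : chaar (fun=> k) = k.
Proof. by rewrite /chaar !haar_cst; case: k. Qed.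

Lemma ccontS_cst k : ccontS (fun=> k).
Proof. by split; exact: contS_cst. Qed.

Lemma ccontSD f h : ccontS f -> ccontS h -> ccontS (fun y => f y + h y).
Proof.
by move=> [fr fi] [hr hi]; split; [under eq_fun do rewrite Re_add|under eq_fun do rewrite Im_add]; exact: contSD.
Qed.

Lemma ccontSM f h : ccontS f -> ccontS h -> ccontS (fun y => f y * h y).
Proof.
move=> [fr fi] [hr hi]; split.
  under eq_fun do rewrite Re_mul -mulN1r; apply: contSD; [exact: contSM|exact/contSZ/contSM].
by under eq_fun do rewrite Im_mul; apply: contSD; exact: contSM.
Qed.

Lemma ccontS_conj f : ccontS f -> ccontS (fun y => conjc (f y)).
Proof.
move=> [fr fi]; split; first by move: fr; congr contS; apply/funext => y; case: (f y).
have := @contSZ R (-1) _ fi; congr contS; apply/funext => y; rewrite mulN1r; by case: (f y).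
Qed.

Lemma chintM f h : ccontS f -> chint h -> chint (fun y => f y * h y).
Proof.
move=> [fr fi] [hr hi]; split.
  under eq_fun do rewrite Re_mul -mulN1r; apply: hintD; [exact: hintM|exact/hintZ/hintM].
by under eq_fun do rewrite Im_mul; apply: hintD; exact: hintM.
Qed.

Lemma polyfun_ccontS p : polyfun p -> ccontS p.
Proof. by move=> hp; split; [exact: contS_Re|exact: contS_Im]. Qed.

Lemma chaar_lie0 X (f f' : M2 -> C) : X \in [:: mxI R; mxJ R; mxK R] -> ccontS f -> ccontS f' ->
  (forall g, SU2 g -> is_cderive (fun t => f (g *m expmx (t%:C *: X))) 0 (f' g)) ->
  chaar f' = 0.
Proof.
move=> hX [fr fi] [fr' fi'] df; apply: complex_ext => /=.
  by apply: (haar_lie0 hX fr fr') => g sg; case: (df g sg).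
by apply: (haar_lie0 hX fi fi') => g sg; case: (df g sg).
Qed.
End Symmetry.

(** * Square-integrable spinors and their pairing *)

Section SpinorAnalysis.
Variable R : realType.
Local Notation C := R[i].
Local Notation M2 := 'M[C]_2.
Local Notation V := 'cV[C]_2.
Local Notation Re := (@complex.Re R).
Local Notation Im := (@complex.Im R).
Local Notation spinor := (spinor R).
Local Notation cube := (@unit_cube R : set (measurableTypeR R * measurableTypeR R * measurableTypeR R)%type).

Definition hspin (psi : spinor) := forall i, chint (fun y => psi y i 0).
Definition cspin (psi : spinor) := forall i, ccontS (fun y => psi y i 0).
Definition nsq (v : V) : R := \sum_(i < 2) Normc.normc (v i 0) ^+ 2.
Definition sqint (psi : spinor) := hspin psi /\ hint (fun y => nsq (psi y)).
Definition cip (chi phi : spinor) : C := chaar (fun y => cdot (chi y) (phi y)).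

Lemma nsqE v : nsq v = Re (v 0 0) ^+ 2 + Im (v 0 0) ^+ 2 + (Re (v 1 0) ^+ 2 + Im (v 1 0) ^+ 2).
Proof. by rewrite /nsq sum_I2 !normc_sqr. Qed.

Lemma nsq_ge0 v : 0 <= nsq v.
Proof. by rewrite nsqE !addr_ge0 ?sqr_ge0. Qed.

Lemma cdot_self v : cdot v v = (nsq v)%:C.
Proof.
rewrite cdotE nsqE; case: (v 0 0) => a b; case: (v 1 0) => c d.
by apply: complex_ext => /=; ring.
Qed.

Lemma Re_cdot v w : Re (cdot v w) = Re (v 0 0) * Re (w 0 0) + Im (v 0 0) * Im (w 0 0) +
  (Re (v 1 0) * Re (w 1 0) + Im (v 1 0) * Im (w 1 0)).
Proof.
by rewrite cdotE; case: (v 0 0) => ? ?; case: (v 1 0) => ? ?; case: (w 0 0) => ? ?; case: (w 1 0) => ? ? /=; ring.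
Qed.

Lemma nsqB v w : nsq (v - w) = nsq v - 2%:R * Re (cdot w v) + nsq w.
Proof. by rewrite !nsqE Re_cdot !mxE !Re_add !Im_add !Re_opp !Im_opp; ring. Qed.

Lemma nsqD_le v w : nsq (v + w) <= 2%:R * nsq v + 2%:R * nsq w.
Proof.
rewrite !nsqE !mxE !Re_add !Im_add.
move: (Re (v 0 0)) (Im (v 0 0)) (Re (v 1 0)) (Im (v 1 0)) => a b c d.
move: (Re (w 0 0)) (Im (w 0 0)) (Re (w 1 0)) (Im (w 1 0)) => a' b' c' d'.
have := sqr_ge0 (a - a'); have := sqr_ge0 (b - b'); have := sqr_ge0 (c - c'); have := sqr_ge0 (d - d').
by lra.
Qed.

Lemma nsqZ k v : nsq (k *: v) = Normc.normc k ^+ 2 * nsq v.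
Proof. by rewrite !nsqE normc_sqr !mxE !Re_mul !Im_mul; ring. Qed.

(* AM-GM with a free parameter: the Cauchy-Schwarz inequality in disguise. *)
Lemma Re_cdot_le v w t : 0 < t -> `|Re (cdot v w)| <= nsq v / t + t * nsq w.
Proof.
move=> t0; rewrite Re_cdot !nsqE mulrDl !mulrDl.
have key (a b : R) : `|a * b| <= a ^+ 2 / t + t * b ^+ 2.
  pose c := a / t; have t1 : t != 0 by rewrite gt_eqF.
  have -> : a ^+ 2 / t = t * c ^+ 2 by rewrite /c; field.
  have -> : a = t * c by rewrite /c; field.
  have := mulr_ge0 (ltW t0) (sqr_ge0 (c + b)); have := mulr_ge0 (ltW t0) (sqr_ge0 (c - b)).
  have := mulr_ge0 (ltW t0) (sqr_ge0 c); have := mulr_ge0 (ltW t0) (sqr_ge0 b).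
  by move=> *; rewrite ler_norml; apply/andP; split; lra.
move: (key (Re (v 0 0)) (Re (w 0 0))) (key (Im (v 0 0)) (Im (w 0 0)))
  (key (Re (v 1 0)) (Re (w 1 0))) (key (Im (v 1 0)) (Im (w 1 0))) => h1 h2 h3 h4.
apply: (le_trans (ler_normD _ _)); apply: (le_trans (lerD (ler_normD _ _) (ler_normD _ _))).
apply: (le_trans (lerD (lerD h1 h2) (lerD h3 h4))).
by rewrite mulrDr !mulrDr le_eqVlt; apply/orP; left; apply/eqP; ring.
Qed.

Lemma Im_cdot_le v w t : 0 < t -> `|Im (cdot v w)| <= nsq v / t + t * nsq w.
Proof.
move=> t0; have := Re_cdot_le v ((0 +i* (-1)) *: w) t0; rewrite cdotZr nsqZ normc_sqr Re_mul /=.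
by rewrite mul0r sub0r mulN1r opprK expr0n /= add0r sqrrN expr1n mul1r.
Qed.

Lemma hint_measurable (u : M2 -> R) : hint u -> measurable_fun cube (fun p => u (hopf p) : R).
Proof. by case/integrableP => /measurable_EFinP. Qed.

Lemma hint_bound (u v : M2 -> R) : measurable_fun cube (fun p => u (hopf p) : R) -> hint v ->
  (forall g, SU2 g -> `|u g| <= v g) -> hint u.
Proof.
move=> mu' hv uv; apply: (le_integrable _ _ _ hv); first exact: measurable_cube.
  exact/measurable_EFinP.
by move=> p hp; rewrite /= lee_fin (le_trans (uv _ (hopf_SU2 hp)))// ler_norm.
Qed.

(** Since the total mass is 1, |a| <= 1 + a^2 makes the components of a square-integrable spinor
    integrable. *)
Lemma L2_sqint psi : measurable_spinor psi -> (normsq_L2 psi < +oo)%E ->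
  sqint psi /\ normsq_L2 psi = (haar (fun y => nsq (psi y)))%:E.
Proof.
move=> mpsi fin.
have mr i : measurable_fun cube (fun p => Re (psi (hopf p) i 0) : R) by exact: (mpsi i).1.
have mi i : measurable_fun cube (fun p => Im (psi (hopf p) i 0) : R) by exact: (mpsi i).2.
have mn : measurable_fun cube (fun p => nsq (psi (hopf p)) : R).
  under eq_fun do rewrite nsqE.
  by repeat apply: measurable_funD; apply: measurable_funX.
have hn : hint (fun y => nsq (psi y)).
  apply/integrableP; split; first exact/measurable_EFinP.
  apply: le_lt_trans fin; rewrite le_eqVlt; apply/orP; left; apply/eqP.
  by apply: eq_integral => p _; rewrite /= ger0_norm// nsq_ge0.
have E : normsq_L2 psi = (haar (fun y => nsq (psi y)))%:E.
  by rewrite /haar /Rintegral fineK//; apply: integrable_fin_num => //; exact: measurable_cube.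
have le1 (a b : R) : a ^+ 2 <= b -> `|a| <= 1 + b.
  by move=> ab; have := sqr_ge0 (a - 1); have := sqr_ge0 (a + 1); rewrite ler_norml => *; apply/andP; split; lra.
split => //; split => // i; split.
- apply: (hint_bound (mr i) (hintD (contS_hint (@contS_cst R 1)) hn)) => g _; apply: le1.
  by move: i {mr mi}; apply: forall_I2; rewrite nsqE; 
    move: (sqr_ge0 (Re (psi g 0 0))) (sqr_ge0 (Im (psi g 0 0))) (sqr_ge0 (Re (psi g 1 0))) (sqr_ge0 (Im (psi g 1 0))); lra.
- apply: (hint_bound (mi i) (hintD (contS_hint (@contS_cst R 1)) hn)) => g _; apply: le1.
  by move: i {mr mi}; apply: forall_I2; rewrite nsqE; 
    move: (sqr_ge0 (Re (psi g 0 0))) (sqr_ge0 (Im (psi g 0 0))) (sqr_ge0 (Re (psi g 1 0))) (sqr_ge0 (Im (psi g 1 0))); lra.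
Qed.

Lemma hint_normsq psi : hint (fun y => nsq (psi y)) -> normsq_L2 psi = (haar (fun y => nsq (psi y)))%:E.
Proof.
by move=> hn; rewrite /haar /Rintegral fineK//; apply: integrable_fin_num => //; exact: measurable_cube.
Qed.

Lemma sqint_measurable psi : sqint psi -> measurable_spinor psi.
Proof. by move=> [h _] i; have [hr hi] := h i; split; [exact: (hint_measurable hr)|exact: (hint_measurable hi)]. Qed.

Lemma cspin_hspin psi : cspin psi -> hspin psi.
Proof. by move=> c i; exact: ccontS_chint. Qed.

Lemma cspin_nsq psi : cspin psi -> contS (fun y => nsq (psi y)).
Proof.
move=> c; under eq_fun do rewrite nsqE; have [a b] := c 0; have [a' b'] := c 1.
by under eq_fun do rewrite !expr2; repeat apply: contSD; exact: contSM.
Qed.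

Lemma cspin_sqint psi : cspin psi -> sqint psi.
Proof. by move=> c; split; [exact: cspin_hspin|exact/contS_hint/cspin_nsq]. Qed.

Lemma hspinD f h : hspin f -> hspin h -> hspin (fun y => f y + h y).
Proof. by move=> hf hh i; under eq_fun do rewrite mxE; exact: chintD. Qed.

Lemma hspinZ k f : hspin f -> hspin (fun y => k *: f y).
Proof. by move=> hf i; under eq_fun do rewrite mxE; exact: chintZ. Qed.

Lemma cspinD f h : cspin f -> cspin h -> cspin (fun y => f y + h y).
Proof. by move=> hf hh i; under eq_fun do rewrite mxE; exact: ccontSD. Qed.

Lemma cspinM (A : M2) f : cspin f -> cspin (fun y => A *m f y).
Proof.
move=> hf i; under eq_fun do rewrite mulmx2E.
by apply: ccontSD; apply: ccontSM => //; exact: ccontS_cst.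
Qed.

Lemma cspinZ k f : cspin f -> cspin (fun y => k *: f y).
Proof. by move=> hf i; under eq_fun do rewrite mxE; apply: ccontSM => //; exact: ccontS_cst. Qed.

Lemma sqintD f h : sqint f -> sqint h -> sqint (fun y => f y + h y).
Proof.
move=> [hf nf] [hh nh]; have hs := hspinD hf hh; split => //.
have m i : measurable_fun cube (fun p => Re ((f (hopf p) + h (hopf p)) i 0) : R) by exact: hint_measurable (hs i).1.
have m' i : measurable_fun cube (fun p => Im ((f (hopf p) + h (hopf p)) i 0) : R) by exact: hint_measurable (hs i).2.
apply: (@hint_bound _ (fun y => 2%:R * nsq (f y) + 2%:R * nsq (h y))).
- under eq_fun do rewrite nsqE.
  by repeat apply: measurable_funD; apply: measurable_funX.
- by apply: hintD; exact: hintZ.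
- by move=> g _; rewrite ger0_norm ?nsq_ge0// nsqD_le.
Qed.

Lemma sqintZ k f : sqint f -> sqint (fun y => k *: f y).
Proof.
move=> [hf nf]; split; first exact: hspinZ.
by under eq_fun do rewrite nsqZ; exact: hintZ.
Qed.

Lemma sqintB f h : sqint f -> sqint h -> sqint (fun y => f y - h y).
Proof. by move=> hf hh; under eq_fun do rewrite -scaleN1r; apply: sqintD => //; exact: sqintZ. Qed.

Lemma sqint_sum n (f : 'I_n -> spinor) : (forall i, sqint (f i)) -> sqint (fun y => \sum_i f i y).
Proof.
elim: n f => [|n IH] f hf.
  under eq_fun do rewrite big_ord0; apply: cspin_sqint => i.
  by under eq_fun do rewrite mxE; exact: ccontS_cst.
by under eq_fun do rewrite big_ord_recl; apply: sqintD => //; exact: IH.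
Qed.

Lemma chint_cdot f h : cspin f -> hspin h -> chint (fun y => cdot (f y) (h y)).
Proof.
move=> cf hh; under eq_fun do rewrite cdotE.
by apply: chintD; apply: chintM => //; exact: ccontS_conj.
Qed.

Lemma cipC f h : cspin f -> hspin h -> cip h f = conjc (cip f h).
Proof.
by move=> cf hh; rewrite /cip -chaar_conj; [by apply: eq_chaar => g _; rewrite cdotC|exact: chint_cdot].
Qed.

Lemma cipDr f u v : cspin f -> hspin u -> hspin v -> cip f (fun y => u y + v y) = cip f u + cip f v.
Proof. by move=> cf hu hv; rewrite /cip -chaarD; [by apply: eq_chaar => g _; rewrite cdotDr|exact: chint_cdot|exact: chint_cdot]. Qed.

Lemma cipZr f k u : cspin f -> hspin u -> cip f (fun y => k *: u y) = k * cip f u.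
Proof. by move=> cf hu; rewrite /cip -chaarZ; [by apply: eq_chaar => g _; rewrite cdotZr|exact: chint_cdot]. Qed.

Lemma cipDl f u v : cspin u -> cspin v -> hspin f -> cip (fun y => u y + v y) f = cip u f + cip v f.
Proof. by move=> cu cv hf; rewrite /cip -chaarD; [by apply: eq_chaar => g _; rewrite cdotDl|exact: chint_cdot|exact: chint_cdot]. Qed.

Lemma cipZl f k u : cspin u -> hspin f -> cip (fun y => k *: u y) f = conjc k * cip u f.
Proof. by move=> cf hu; rewrite /cip -chaarZ; [by apply: eq_chaar => g _; rewrite cdotZl|exact: chint_cdot]. Qed.

Lemma cipBr f u v : cspin f -> hspin u -> hspin v -> cip f (fun y => u y - v y) = cip f u - cip f v.
Proof.
move=> cf hu hv; have hv' : hspin (fun y => (-1) *: v y) by exact: hspinZ.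
rewrite -[RHS](_ : cip f u + (-1) * cip f v = _); last by rewrite mulN1r.
rewrite -(cipZr _ cf hv) -(cipDr cf hu hv').
by apply: eq_chaar => g _; rewrite scaleN1r.
Qed.

Lemma cip_sumr n f (u : 'I_n -> spinor) : cspin f -> (forall i, hspin (u i)) ->
  cip f (fun y => \sum_i u i y) = \sum_i cip f (u i).
Proof.
move=> cf hu; have h i := chint_cdot cf (hu i); rewrite -(chaar_sum h).2.
by apply: eq_chaar => g _; rewrite /cdot mulmx_sumr summxE.
Qed.

Lemma cip_self f : cip f f = (haar (fun y => nsq (f y)))%:C.
Proof.
rewrite /cip /chaar; apply: complex_ext => /=.
  by apply: eq_haar => y _; rewrite cdot_self.
by rewrite -[RHS](haar_cst 0); apply: eq_haar => y _; rewrite cdot_self.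
Qed.

(** Continuity of the pairing for the L^2 norm, from [Re_cdot_le] with t = 1 / e; the factor 2 in
    the constant counts real and imaginary parts. *)
Lemma cip_small phi : cspin phi -> exists2 B, 0 <= B & forall xi e, sqint xi -> 0 < e ->
  (normsq_L2 xi < (e ^+ 2)%:E)%E -> Normc.normc (cip phi xi) <= e * B.
Proof.
move=> cp; pose N := haar (fun y => nsq (phi y)).
have N0 : 0 <= N by apply: haar_ge0 => g _; exact: nsq_ge0.
exists (2%:R * (N + 1)); first by rewrite mulr_ge0// addr_ge0.
move=> xi e [hx nx] e0; rewrite hint_normsq// lte_fin => hn.
have [cr ci] := chint_cdot cp hx.
have hB : hint (fun y => nsq (phi y) / e^-1 + e^-1 * nsq (xi y)).
  apply: hintD; last exact: hintZ.
  by under eq_fun do rewrite mulrC; apply/hintZ/contS_hint/cspin_nsq.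
have e1 : 0 < e^-1 by rewrite invr_gt0.
have B : haar (fun y => nsq (phi y) / e^-1 + e^-1 * nsq (xi y)) <= e * (N + 1).
  rewrite haarD; [|by under eq_fun do rewrite mulrC; apply/hintZ/contS_hint/cspin_nsq|exact: hintZ].
  under eq_fun do rewrite mulrC.
  rewrite !haarZ//; last exact/contS_hint/cspin_nsq.
  by rewrite invrK -/N mulrDr lerD2l mulr1 ler_pdivrMl// -expr2 ltW.
apply: (le_trans (normc_le_ReIm _)); rewrite mulrCA mulr_natl mulr2n /cip /chaar lerD//.
  apply: (le_trans (haar_norm cr)); apply: le_trans B.
  by apply: haar_le => //; [exact: hint_norm|move=> g _; exact: Re_cdot_le].
apply: (le_trans (haar_norm ci)); apply: le_trans B.
by apply: haar_le => //; [exact: hint_norm|move=> g _; exact: Im_cdot_le].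
Qed.
End SpinorAnalysis.

(** * Integration by parts for the Dirac operator *)

Section DiracSymmetry.
Variable R : realType.
Local Notation C := R[i].
Local Notation M2 := 'M[C]_2.
Local Notation V := 'cV[C]_2.
Local Notation Re := (@complex.Re R).
Local Notation Im := (@complex.Im R).
Local Notation spinor := (spinor R).
Local Notation frame := [:: mxI R; mxJ R; mxK R].

Lemma eq_cipl (u w f : spinor) : (forall y, SU2 y -> u y = w y) -> cip u f = cip w f.
Proof. by move=> e; apply: eq_chaar => y sy; rewrite e. Qed.

Lemma eq_cipr (u w f : spinor) : (forall y, SU2 y -> u y = w y) -> cip f u = cip f w.
Proof. by move=> e; apply: eq_chaar => y sy; rewrite e. Qed.

Lemma normcM (x y : C) : Normc.normc (x * y) = Normc.normc x * Normc.normc y.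
Proof. by apply: (@complexI R); rewrite rmorphM /= -!normr_normc normrM. Qed.

Lemma normc_real (x : R) : Normc.normc x%:C = `|x|.
Proof. by rewrite /= expr0n /= addr0 sqrtr_sqr. Qed.

Lemma normcB_le (x y : C) : Normc.normc (x - y) <= Normc.normc x + Normc.normc y.
Proof. by rewrite -lecR rmorphD /= -!normr_normc ler_normB. Qed.

Lemma frame_adj X : X \in frame -> adj X = - X.
Proof.
by rewrite !inE => /or3P[] /eqP ->; rewrite adj_mx2 mx2_opp; congr mx2;
  apply: complex_ext => /=; rewrite ?(oppr0, opprK).
Qed.

Lemma within_cspin (psi : spinor) : {within @SU2 R, continuous psi} -> cspin psi.
Proof.
move=> /subspace_continuousP c i; split; apply/subspace_continuousP => g sg; rewrite /from_subspace;
  have := c g sg; rewrite /from_subspace => h.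
  have c1 : continuous (fun v : V => Re (v i 0)).
    by move=> v; apply: (@continuous_comp _ _ _ (fun v : V => v i 0) Re); [exact: coord_continuous|exact: Re_continuous].
  exact: (cvg_comp _ _ h (c1 (psi g))).
have c1 : continuous (fun v : V => Im (v i 0)).
  by move=> v; apply: (@continuous_comp _ _ _ (fun v : V => v i 0) Im); [exact: coord_continuous|exact: Im_continuous].
exact: (cvg_comp _ _ h (c1 (psi g))).
Qed.

Lemma Ck_cspin k (psi : spinor) : Ck k psi -> cspin psi.
Proof. by case: k => [|k] [h _]; exact: within_cspin. Qed.

Lemma polyspinor_cspin (psi : spinor) : polyspinor psi -> cspin psi.
Proof. by move=> h i; exact: polyfun_ccontS. Qed.

Lemma Ck1_lie X (psi : spinor) : X \in frame -> Ck 1 psi -> cspin (lie_deriv X psi) /\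
  forall g i, SU2 g -> is_cderive (fun t => psi (g *m expmx (t%:C *: X)) i 0) 0 (lie_deriv X psi g i 0).
Proof.
move=> hX [_ /(_ X hX) [d hl]]; have c := @Ck_cspin 0 _ hl; split => // g i sg; have [dr di] := d g i sg.
by rewrite mxE; split; exact: derivable_is_derive1.
Qed.

Lemma smooth_cspin_dirac (psi : spinor) : Ck 1 psi -> cspin (dirac_op psi).
Proof.
move=> h; have c X : X \in frame -> cspin (fun g => X *m lie_deriv X psi g).
  by move=> hX; apply: cspinM; case: (Ck1_lie hX h).
have c3 : cspin (fun g => (- (3%:R / 2%:R)) *: psi g) by apply/cspinZ/(Ck_cspin h).
rewrite /dirac_op; under eq_fun do rewrite -scaleNr.
by do 3?[apply: cspinD => //]; apply: c; rewrite !inE eqxx ?orbT.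
Qed.

Lemma is_cderive_conj (u : R -> C) t a : is_cderive u t a -> is_cderive (fun x => conjc (u x)) t (conjc a).
Proof.
move=> [ur ui]; split; first by case: a ur {ui} => a b /=; congr is_derive; apply/funext => x; case: (u x).
have := is_derive1Z (-1) ui; rewrite mulN1r; case: a {ur ui} => a b /=.
by congr is_derive; apply/funext => x; rewrite mulN1r; case: (u x).
Qed.

Lemma is_cderive_cdot (u w : R -> V) t (a b : V) :
  (forall i, is_cderive (fun x => u x i 0) t (a i 0)) ->
  (forall i, is_cderive (fun x => w x i 0) t (b i 0)) ->
  is_cderive (fun x => cdot (u x) (w x)) t (cdot a (w t) + cdot (u t) b).
Proof.
move=> ha hb; under eq_fun do rewrite cdotE.
apply: (is_cderive_eq (is_cderiveD (is_cderiveM (is_cderive_conj (ha 0)) (hb 0))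
  (is_cderiveM (is_cderive_conj (ha 1)) (hb 1)))).
by rewrite !cdotE; ring.
Qed.

(** Two signs cancel: X is skew-Hermitian, and integration by parts contributes a minus, the
    derivative of <chi, X phi> along X having integral 0. *)
Lemma lie_sym X (chi phi : spinor) : X \in frame -> Ck 1 chi -> Ck 1 phi ->
  cip (fun y => X *m lie_deriv X chi y) phi = cip chi (fun y => X *m lie_deriv X phi y).
Proof.
move=> hX hc hp; have XX := frame_sqr hX.
have [cc dc] := Ck1_lie hX hc; have [cp dp] := Ck1_lie hX hp.
have c0 := Ck_cspin hc; have p0 := Ck_cspin hp.
pose f y := cdot (chi y) (X *m phi y).
pose f' y := cdot (lie_deriv X chi y) (X *m phi y) + cdot (chi y) (X *m lie_deriv X phi y).
have ccd (u w : spinor) : cspin u -> cspin w -> ccontS (fun y => cdot (u y) (w y)).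
  move=> hu hw; under eq_fun do rewrite cdotE.
  by apply: ccontSD; apply: ccontSM => //; exact: ccontS_conj.
have : chaar f' = 0.
  apply: (@chaar_lie0 R X f) => //; first by apply: ccd => //; exact: cspinM.
    by apply: ccontSD; apply: ccd => //; exact: cspinM.
  move=> g sg.
  have dX i : is_cderive (fun t => (X *m phi (g *m expmx (t%:C *: X))) i 0) 0 ((X *m lie_deriv X phi g) i 0).
    rewrite mulmx2E; under eq_fun do rewrite mulmx2E.
    by apply: is_cderiveD; apply: is_cderiveZ; exact: dp.
  have := @is_cderive_cdot (fun t => chi (g *m expmx (t%:C *: X))) (fun t => X *m phi (g *m expmx (t%:C *: X))) 0 _ _
    (fun i => dc g i sg) dX.
  by rewrite expmx0// mulmx1.
rewrite /f' chaarD; last 2 first.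
- by apply: ccontS_chint; apply: ccd => //; exact: cspinM.
- by apply: ccontS_chint; apply: ccd => //; exact: cspinM.
move/eqP; rewrite addrC addr_eq0 => /eqP E; rewrite [RHS]E.
rewrite -chaarN; last by apply: ccontS_chint; apply: ccd => //; exact: cspinM.
by apply: eq_chaar => y _; rewrite cdotMl frame_adj// mulNmx cdotNr.
Qed.

Lemma dirac_sym (chi phi : spinor) : Ck 1 chi -> Ck 1 phi ->
  cip (dirac_op chi) phi = cip chi (dirac_op phi).
Proof.
move=> hc hp; have c0 := Ck_cspin hc; have p0 := Ck_cspin hp.
have cc X : X \in frame -> cspin (fun g => X *m lie_deriv X chi g).
  by move=> hX; apply: cspinM; case: (Ck1_lie hX hc).
have cp X : X \in frame -> cspin (fun g => X *m lie_deriv X phi g).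
  by move=> hX; apply: cspinM; case: (Ck1_lie hX hp).
have fI : mxI R \in frame by rewrite !inE eqxx.
have fJ : mxJ R \in frame by rewrite !inE eqxx orbT.
have fK : mxK R \in frame by rewrite !inE eqxx !orbT.
have h1 := cspinD (cspinD (cc _ fI) (cc _ fJ)) (cc _ fK).
have h2 := cspinD (cspinD (cp _ fI) (cp _ fJ)) (cp _ fK).
have E1 : cip (dirac_op chi) phi = cip (fun g => (mxI R *m lie_deriv (mxI R) chi g + mxJ R *m lie_deriv (mxJ R) chi g
    + mxK R *m lie_deriv (mxK R) chi g) + (- (3%:R / 2%:R)) *: chi g) phi.
  by apply: eq_chaar => g _; rewrite /dirac_op scaleNr.
have E2 : cip chi (dirac_op phi) = cip chi (fun g => (mxI R *m lie_deriv (mxI R) phi g + mxJ R *m lie_deriv (mxJ R) phi g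
    + mxK R *m lie_deriv (mxK R) phi g) + (- (3%:R / 2%:R)) *: phi g).
  by apply: eq_chaar => g _; rewrite /dirac_op scaleNr.
have hh (s : spinor) : cspin s -> hspin s := @cspin_hspin R s.
rewrite E1 E2 (cipDl h1 (cspinZ _ c0) (hh _ p0)) (cipDr c0 (hh _ h2) (hh _ (cspinZ _ p0))).
rewrite (cipDl (cspinD (cc _ fI) (cc _ fJ)) (cc _ fK) (hh _ p0)) (cipDl (cc _ fI) (cc _ fJ) (hh _ p0)).
rewrite (cipDr c0 (hh _ (cspinD (cp _ fI) (cp _ fJ))) (hh _ (cp _ fK))) (cipDr c0 (hh _ (cp _ fI)) (hh _ (cp _ fJ))).
have e3 : cip (fun g => (- (3%:R / 2%:R)) *: chi g) phi = cip chi (fun g => (- (3%:R / 2%:R)) *: phi g).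
  rewrite (cipZl _ c0 (hh _ p0)) (cipZr _ c0 (hh _ p0)) (_ : 3%:R / 2%:R = (3%:R / 2%:R : R)%:C).
    by rewrite -rmorphN /= oppr0.
  by rewrite rmorphM fmorphV /= !rmorph_nat.
exact: (f_equal2 +%R (f_equal2 +%R (f_equal2 +%R (lie_sym fI hc hp) (lie_sym fJ hc hp)) (lie_sym fK hc hp)) e3).
Qed.

(** psi cannot be differentiated, but its approximants chi can: as <phi, D chi> = m <phi, chi>, one
    has (l - m) <phi, psi> = <phi, l psi - D chi> - m <phi, psi - chi>, where both terms are
    small. *)
Lemma eigen_orth G (l m : R) (psi phi : spinor) : eigenspinor G l psi -> polyspinor phi ->
  (forall y, SU2 y -> dirac_op phi y = m%:C *: phi y) -> m != l -> cip phi psi = 0.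
Proof.
move=> [[_ mpsi fpsi] _ appr] pphi ephi ml.
have [sq _] := L2_sqint mpsi fpsi.
have cphi := polyspinor_cspin pphi.
have [B B0 hB] := cip_small cphi.
have k0 : 0 < `|l - m| by rewrite normr_gt0 subr_eq0 eq_sym.
suff key e : 0 < e -> `|l - m| * Normc.normc (cip phi psi) <= e * ((1 + `|m|) * B).
  apply/eqP; case: eqVneq => // n0.
  have p0 : 0 < Normc.normc (cip phi psi).
    rewrite lt0r (le_trans (normr_ge0 _) (Re_le_normc _)) andbT.
    by apply: contra_neq n0; exact: Normc.eq0_normc.
  have d0 : 0 < (1 + `|m|) * B + 1.
    by rewrite ltr_wpDl// mulr_ge0// addr_ge0.
  have kp : 0 < `|l - m| * Normc.normc (cip phi psi) by rewrite mulr_gt0.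
  move: kp key d0; move: (`|l - m| * _) ((1 + `|m|) * B) => a K a0 key K0.
  have q0 : 0 < a / (K + 1) by rewrite divr_gt0.
  have := key _ q0; have : a / (K + 1) * (K + 1) = a by rewrite divfK// gt_eqF.
  by move: q0; move: (a / _) => q q0; lra.
move=> e0; have [chi [sm _ n1 n2]] := appr (e ^+ 2) (exprn_gt0 2 e0).
have c0 := Ck_cspin (sm 0%N); have cD := smooth_cspin_dirac (sm 1%N).
have s1 : sqint (fun g => psi g - chi g) by apply: sqintB => //; exact: cspin_sqint.
have s2 : sqint (fun g => l%:C *: psi g - dirac_op chi g).
  by apply: sqintB; [exact: sqintZ|exact: cspin_sqint].
have b1 := hB _ _ s1 e0 n1; have b2 := hB _ _ s2 e0 n2.
have h1 : cip phi (dirac_op chi) = m%:C * cip phi chi.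
  rewrite (cipC cD (cspin_hspin cphi)) (dirac_sym (sm 1%N) (polyspinor_smooth pphi 1)).
  rewrite (@eq_cipr _ _ chi ephi) (cipZr _ c0 (cspin_hspin cphi)) conjcM -(cipC c0 (cspin_hspin cphi)).
  by congr (_ * _); apply: complex_ext => /=; rewrite ?oppr0.
have E : (l - m)%:C * cip phi psi = cip phi (fun g => l%:C *: psi g - dirac_op chi g) -
    m%:C * cip phi (fun g => psi g - chi g).
  rewrite (cipBr cphi (hspinZ _ sq.1) (cspin_hspin cD)) (cipBr cphi sq.1 (cspin_hspin c0)).
  by rewrite (cipZr _ cphi sq.1) h1 rmorphB; ring.
rewrite -(normc_real (l - m)) -normcM E (le_trans (normcB_le _ _))// normcM normc_real.
rewrite (_ : e * _ = e * B + `|m| * (e * B)); last by ring.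
exact: (lerD b2 (ler_wpM2l (normr_ge0 m) b1)).
Qed.
End DiracSymmetry.

(** * Completeness and the reproducing property *)

Section Completeness.
Variable R : realType.
Local Notation C := R[i].
Local Notation M2 := 'M[C]_2.
Local Notation V := 'cV[C]_2.
Local Notation Re := (@complex.Re R).
Local Notation Im := (@complex.Im R).
Local Notation spinor := (spinor R).

Definition level (j : int) : R := j%:~R - 2%:R^-1.

Lemma kerfun_exact j g v y : SU2 g -> SU2 y ->
  dirac_op (kerfun j g v) y = (level j)%:C *: kerfun j g v y.
Proof.
by move=> sg sy; rewrite dirac_kerfun// /level rmorphB /= rmorph_int fmorphV rmorph_nat.
Qed.

Lemma level_inj : injective level.
Proof. by move=> i j /addIr /intr_inj. Qed.

Lemma chebCN j : chebC R (- j) = - chebC R j.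
Proof. by rewrite /chebC sgzN abszN rmorphN mulNr. Qed.

Lemma kerfun0 (g : M2) (v : V) y : kerfun 0 g v y = 0.
Proof.
rewrite /kerfun /kernel /kerp /kerA /kerB (_ : chebC R 0 = 0).
  by rewrite deriv0 !mulr0 oppr0 !addr0 horner0 raddf0 scale0r addr0 scaler0 mul0mx.
by rewrite /chebC sgz0 mul0r.
Qed.

(* Reduces the completeness of the kernels to that of scalar zonal functions. *)
Lemma kerfun_pair (k : nat) (g y : M2) (v : V) : SU2 g -> SU2 y ->
  kerfun k%:Z g v y + kerfun (- k%:Z) g v y = (k%:R * zonal (chebU R k) g y)%:C *: v.
Proof.
move=> sg sy; rewrite /kerfun -mulmxDl /kernel /kerp -scalerDr addrACA -scalerDl -raddfD /=.
rewrite sdotE// -!hornerD.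
have -> : kerB R k%:Z + kerB R (- k%:Z) = 0 by rewrite /kerB chebCN derivN opprK addNr.
have -> : kerA R k%:Z + kerA R (- k%:Z) = 2%:R * (k%:R * chebC R k%:Z).
  rewrite /kerA chebCN derivN (_ : (- k%:Z)%:~R = - k%:R :> {poly C}); last by rewrite rmorphN.
  by rewrite (_ : (k%:Z)%:~R = k%:R :> {poly C})//; ring.
rewrite horner0 scale0r addr0 hornerM hornerM chebC_horner chebZ_nat.
rewrite -!(rmorph_nat polyC) !hornerC scale_scalar_mx mulKf ?pnatr_eq0// mul_scalar_mx.
by rewrite rmorphM rmorph_nat.
Qed.

Lemma chaar_zonal (k : nat) (g : M2) (v : V) (eta : spinor) : SU2 g -> hspin eta ->
  chaar (fun y => (k%:R * zonal (chebU R k) g y)%:C * cdot v (eta y)) =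
  cip (kerfun k%:Z g v) eta + cip (kerfun (- k%:Z) g v) eta.
Proof.
move=> sg he; rewrite -cipDl//; [|exact/polyspinor_cspin/kerfun_poly|exact/polyspinor_cspin/kerfun_poly].
apply: eq_chaar => y sy; rewrite kerfun_pair// cdotZl; congr (_ * _).
by apply: complex_ext => //=; rewrite oppr0.
Qed.

Lemma chaar_Re (f : M2 -> R) h : chaar (fun y => (f y)%:C * h y) =
  haar (fun y => f y * Re (h y)) +i* haar (fun y => f y * Im (h y)).
Proof.
rewrite /chaar; congr (haar _ +i* haar _); apply/funext => y; case: (h y) => a b /=; ring.
Qed.

Lemma cdot_delta (w : V) i : cdot (delta_mx i 0) w = w i 0.
Proof.
by move: i; apply: forall_I2; rewrite cdotE !mxE !rmorph_nat /= ?mul1r ?mul0r ?addr0 ?add0r.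
Qed.

(** A basis vector for v isolates one component of eta, and [kerfun_pair] turns the hypothesis into
    orthogonality to all zonal U_k. Zonal functions being real, real and imaginary parts
    separate. *)
Lemma cip_complete (eta chi : spinor) : hspin eta -> cspin chi ->
  (forall j g v, SU2 g -> cip (kerfun j g v) eta = 0) -> cip chi eta = 0.
Proof.
move=> he cc h0.
have hz i k g : SU2 g -> haar (fun y => zonal (chebU R k) g y * Re (eta y i 0)) = 0 /\
    haar (fun y => zonal (chebU R k) g y * Im (eta y i 0)) = 0.
  move=> sg; case: k => [|k].
    by rewrite !(@eq_haar _ _ (fun=> 0)) ?haar_cst// => y _; rewrite /zonal chebU0 horner0 mul0r.
  have [hr hi] := he i.
  have E0 := etrans (f_equal2 +%R (h0 k.+1%:Z g (delta_mx i 0) sg) (h0 (- k.+1%:Z) g (delta_mx i 0) sg)) (addr0 0).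
  have E := etrans (esym (chaar_Re _ _)) (etrans (chaar_zonal k.+1 (delta_mx i 0) sg he) E0).
  have E1 := congr1 Re E; have E2 := congr1 Im E; move: E1 E2 => /=.
  have z1 : hint (fun y => zonal (chebU R k.+1) g y * Re (eta y i 0)) by apply: hintM => //; exact: contS_zonal.
  have z2 : hint (fun y => zonal (chebU R k.+1) g y * Im (eta y i 0)) by apply: hintM => //; exact: contS_zonal.
  under eq_fun do rewrite cdot_delta -mulrA.
  under [X in _ -> haar X = _ -> _]eq_fun do rewrite cdot_delta -mulrA.
  rewrite !haarZ// => /eqP; rewrite mulf_eq0 pnatr_eq0 /= => /eqP -> /eqP.
  by rewrite mulf_eq0 pnatr_eq0 /= => /eqP ->.
have hr i := zonal_total (he i).1 (fun k g sg => (hz i k g sg).1).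
have hi i := zonal_total (he i).2 (fun k g sg => (hz i k g sg).2).
rewrite /cip (_ : (fun y => cdot (chi y) (eta y)) = fun y => conjc (chi y 0 0) * eta y 0 0 + conjc (chi y 1 0) * eta y 1 0).
  have z i : chaar (fun y => conjc (chi y i 0) * eta y i 0) = 0.
    have [cr ci] := ccontS_conj (cc i); have [er ei] := he i.
    apply: complex_ext => /=.
      under eq_fun do rewrite Re_mul; rewrite haarB; [|exact: hintM|exact: hintM].
      by rewrite (hr _ i cr) (hi _ i ci) subr0.
    under eq_fun do rewrite Im_mul; rewrite haarD; [|exact: hintM|exact: hintM].
    by rewrite (hr _ i ci) (hi _ i cr) addr0.
  by rewrite chaarD ?z ?addr0//; apply: chintM => //; exact: ccontS_conj.
by apply/funext => y; rewrite cdotE.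
Qed.

(* By completeness eta is orthogonal to every continuous chi, hence
   |eta|^2 <= |eta - chi|^2, which can be made arbitrarily small. *)
Lemma cip_null (eta : spinor) : sqint eta ->
  (forall j g v, SU2 g -> cip (kerfun j g v) eta = 0) ->
  (forall e, 0 < e -> exists2 chi, cspin chi & (normsq_L2 (fun y => (eta y - chi y)%R) < e%:E)%E) ->
  haar (fun y => nsq (eta y)) = 0.
Proof.
move=> [he ne] h0 appr; apply/eqP; rewrite eq_le haar_ge0 ?andbT; last by move=> g _; exact: nsq_ge0.
apply/ler_addgt0Pr => e e0; rewrite add0r; have [chi cc] := appr e e0.
have c0 := cip_complete he cc h0.
have hB := (sqintB (conj he ne) (cspin_sqint cc)).2.
rewrite (hint_normsq hB) lte_fin => /ltW; apply: le_trans.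
have hc := (chint_cdot cc he).1.
have hn := contS_hint (cspin_nsq cc).
have hcZ := hintZ (- 2%:R) hc.
rewrite [X in _ <= X](@eq_haar _ _ (fun y => (nsq (eta y) + (- 2%:R) * Re (cdot (chi y) (eta y))) + nsq (chi y))); last first.
  by move=> y _; rewrite nsqB mulNr.
rewrite haarD//; last exact: hintD.
rewrite haarD// haarZ// [haar (fun y => Re _)](_ : _ = 0); last by have := congr1 Re c0.
by rewrite mulr0 addr0 lerDl haar_ge0// => g _; exact: nsq_ge0.
Qed.

Lemma exact_orth (l m : R) (phi chi : spinor) : polyspinor phi -> polyspinor chi ->
  (forall y, SU2 y -> dirac_op phi y = l%:C *: phi y) ->
  (forall y, SU2 y -> dirac_op chi y = m%:C *: chi y) -> l != m -> cip phi chi = 0.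
Proof.
move=> pphi pchi ephi echi lm; have cp := polyspinor_cspin pphi; have cc := polyspinor_cspin pchi.
have := dirac_sym (polyspinor_smooth pphi 1) (polyspinor_smooth pchi 1).
rewrite (eq_cipl chi ephi) (eq_cipr phi echi) (cipZl _ cp (cspin_hspin cc)) (cipZr _ cp (cspin_hspin cc)).
have -> : conjc l%:C = l%:C :> C by apply: complex_ext => //=; rewrite oppr0.
move/eqP; rewrite -subr_eq0 -mulrBl mulf_eq0 => /orP[|/eqP//].
by rewrite -rmorphB /= => /eqP /(congr1 Re) /= /eqP; rewrite subr_eq0 (negbTE lm).
Qed.

(** As j is nonzero, the pair k, -k with k = |j| has two distinct members, and exactly one of them
    is j. *)
Lemma pair_pick (a : int -> C) j : j != 0 -> (forall m, m != j -> a m = 0) ->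
  forall k : nat, a k%:Z + a (- k%:Z) = if k == `|j|%N then a j else 0.
Proof.
move=> j0 orth k; have [->|kj] := eqVneq k `|j|%N; last first.
  by rewrite !orth ?addr0//; apply: contra_neq kj => <-; rewrite ?abszN absz_nat.
case: (intP j) j0 orth => [|n|n] // _ orth.
  by rewrite absz_nat (orth (- _)) ?addr0//.
by rewrite abszN absz_nat addrC (orth (Posz n.+1)) ?addr0//.
Qed.

Lemma power_close (r e : R) n : 0 <= r < 1 -> 1 - e <= r -> `|1 - r ^+ n| <= n%:R * e.
Proof.
move=> /andP[r0 r1] re; rewrite ger0_norm ?subr_ge0 ?exprn_ile1 ?(ltW r1)//.
elim: n => [|n IH]; first by rewrite expr0 subrr mul0r.
rewrite exprS -natr1 mulrDl mul1r.
have : r ^+ n <= 1 by rewrite exprn_ile1// ltW.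
have : 0 <= r ^+ n by rewrite exprn_ge0.
by nra.
Qed.

(** By orthogonality only the index |j| survives when <v, phi> is integrated against the Poisson sum
    at g, which leaves r^(|j| - 1) <K_j v, phi>. As r tends to 1 the same integral tends to <v, phi
    g>, so no norm of the kernel has to be computed. *)
Lemma reproducing (j : int) (phi : spinor) g v : j != 0 -> polyspinor phi ->
  (forall y, SU2 y -> dirac_op phi y = (level j)%:C *: phi y) -> SU2 g ->
  cip (kerfun j g v) phi = cdot v (phi g).
Proof.
move=> j0 pphi ephi sg; have cp := polyspinor_cspin pphi; have hp := cspin_hspin cp.
have orth m : m != j -> cip (kerfun m g v) phi = 0.
  move=> mj; apply: (@exact_orth (level m) (level j)) => //; first exact: kerfun_poly.
    by move=> y sy; exact: kerfun_exact.
  by apply: contra_neq mj; exact: level_inj.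
set T := cip _ _.
have S := pair_pick j0 orth.
have cw : ccontS (fun y => cdot v (phi y)).
  under eq_fun do rewrite cdotE; by apply: ccontSD; apply: ccontSM => //; exact: ccontS_cst.
have key (w : M2 -> R) (t : R) : contS w -> (forall k : nat, haar (fun y => (k%:R * zonal (chebU R k) g y) * w y) =
    if k == `|j|%N then t else 0) -> t = w g.
  move=> ctw hk.
  apply/eqP; rewrite -subr_eq0 -normr_le0; apply/ler_addgt0Pr => e e0; rewrite add0r.
  (* [B] adds up the two errors in units of e / B: 1 from [zonal_approx], and (|j| - 1) |t| from
     replacing r^(|j| - 1) by 1. *)
  pose B := 1 + `|j|%N.-1%:R * `|t|.
  have B0 : 0 < B by rewrite ltr_pwDl// mulr_ge0.
  have eB : 0 < e / B by rewrite divr_gt0.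
  have [r [N [jN r01 re hr]]] := @zonal_approx _ w (e / B) `|j|%N ctw eB.
  have := hr g sg.
  have hi (k : 'I_N.+2) : hint (fun y => r ^+ k.-1 * ((k%:R * zonal (chebU R k) g y) * w y)).
    by apply/hintZ/contS_hint/contSM => //; apply/contSZ/contS_zonal.
  have -> : haar (fun y => zonal (poisson_sum r N.+1) g y * w y) = r ^+ `|j|%N.-1 * t.
    rewrite (@eq_haar _ _ (fun y => \sum_(k < N.+2) r ^+ k.-1 * ((k%:R * zonal (chebU R k) g y) * w y))); last first.
      move=> y _; rewrite /zonal /poisson_sum horner_sum mulr_suml.
      by apply: eq_bigr => k _; rewrite hornerZ; ring.
    rewrite (haar_sum hi).2.
    transitivity (\sum_(k < N.+2) r ^+ k.-1 * (if k == `|j|%N :> nat then t else 0)).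
      apply: eq_bigr => k _; rewrite haarZ ?hk//.
      by apply/contS_hint/contSM => //; apply/contSZ/contS_zonal.
    have jN2 : (`|j| < N.+2)%N by rewrite ltnS (leq_trans jN).
    rewrite (bigD1 (Ordinal jN2)) //= eqxx big1 ?addr0// => k /eqP kj.
    by rewrite ifN ?mulr0//; apply/eqP => E; apply: kj; exact: val_inj.
  move=> h1; have h2 := power_close `|j|%N.-1 r01 re.
  have -> : t - w g = (1 - r ^+ `|j|%N.-1) * t - (w g - r ^+ `|j|%N.-1 * t) by ring.
  apply: (le_trans (ler_normB _ _)); rewrite normrM.
  apply: (le_trans (lerD (ler_wpM2r (normr_ge0 t) h2) h1)).
  have -> : `|j|%N.-1%:R * (e / B) * `|t| + e / B = e / B * B by rewrite /B; ring.
  by rewrite divfK// gt_eqF.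
have Z (k : nat) := chaar_zonal k v sg hp.
have Y (k : nat) := etrans (esym (chaar_Re _ _)) (etrans (Z k) (S k)).
apply: complex_ext.
  apply: (key _ (Re T) cw.1) => k; apply: etrans (congr1 Re (Y k)) _; by case: ifP.
apply: (key _ (Im T) cw.2) => k; apply: etrans (congr1 Im (Y k)) _; by case: ifP.
Qed.
End Completeness.

(** * Multiplicities and the spectral action *)

Section EquivariantKernel.
Variable R : realType.
Local Notation C := R[i].
Local Notation M2 := 'M[C]_2.
Local Notation V := 'cV[C]_2.
Local Notation Re := (@complex.Re R).
Local Notation Im := (@complex.Im R).
Local Notation spinor := (spinor R).

Lemma polyspinorD (f h : spinor) : polyspinor f -> polyspinor h -> polyspinor (fun y => f y + h y).
Proof. by move=> hf hh i; under eq_fun do rewrite mxE; exact: polyfunD. Qed.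

Lemma polyspinorZ k (f : spinor) : polyspinor f -> polyspinor (fun y => k *: f y).
Proof. by move=> hf i; under eq_fun do rewrite mxE; apply: polyfunM => //; exact: polyfun_cst. Qed.

Lemma polyspinor0 : polyspinor (fun=> 0 : V).
Proof. by move=> i; under eq_fun do rewrite mxE; exact: polyfun_cst. Qed.

Lemma polyspinor_along X (f : spinor) : X \in [:: mxI R; mxJ R; mxK R] -> polyspinor f ->
  forall g i, SU2 g -> is_cderive (along X f g i) 0 (lie_deriv X f g i 0).
Proof. by move=> hX hf g i sg; exact: (Ck1_lie hX (polyspinor_smooth hf 1)).2. Qed.

Lemma addr4ACA (W : zmodType) (a b c d a' b' c' d' : W) :
  a + a' + (b + b') + (c + c') + (d + d') = a + b + c + d + (a' + b' + c' + d').
Proof. by rewrite (addrACA a a') (addrACA (a + b)) (addrACA (a + b + c)). Qed.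

Lemma dirac_opD (f h : spinor) g : polyspinor f -> polyspinor h -> SU2 g ->
  dirac_op (fun y => f y + h y) g = dirac_op f g + dirac_op h g.
Proof.
move=> hf hh sg.
have L X : X \in [:: mxI R; mxJ R; mxK R] -> lie_deriv X (fun y => f y + h y) g = lie_deriv X f g + lie_deriv X h g.
  move=> hX; apply: lie_deriv_is => i; rewrite mxE /along; under eq_fun do rewrite mxE.
  by apply: is_cderiveD; exact: polyspinor_along.
rewrite /dirac_op !L ?inE ?eqxx ?orbT// !mulmxDr scalerDr opprD.
exact: addr4ACA.
Qed.

Lemma dirac_opZ k (f : spinor) g : polyspinor f -> SU2 g ->
  dirac_op (fun y => k *: f y) g = k *: dirac_op f g.
Proof.
move=> hf sg.
have L X : X \in [:: mxI R; mxJ R; mxK R] -> lie_deriv X (fun y => k *: f y) g = k *: lie_deriv X f g.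
  move=> hX; apply: lie_deriv_is => i; rewrite mxE /along; under eq_fun do rewrite mxE.
  by apply: is_cderiveZ; exact: polyspinor_along.
by rewrite /dirac_op !L ?inE ?eqxx ?orbT// -!scalemxAr [in RHS]scalerBr !scalerDr !scalerA [k * _]mulrC.
Qed.

Variable G : {fset M2}.
Hypothesis hG : subgroup_SU2 G.

(** Eigenspinors in the pointwise sense, for which evaluation at a point and D are meaningful. By
    [maximal_span], at the levels with j nonzero every eigenspinor is a combination of such ones up
    to a null spinor. *)
Definition exactspinor (l : R) (f : spinor) := [/\ polyspinor f, equivariant G f &
  forall y, SU2 y -> dirac_op f y = l%:C *: f y].

Lemma exactspinorD l f h : exactspinor l f -> exactspinor l h -> exactspinor l (fun y => f y + h y).
Proof.
move=> [pf ef df] [ph eh dh]; split; first exact: polyspinorD.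
  by move=> g c sg cG; rewrite ef// eh// mulmxDr.
by move=> y sy; rewrite dirac_opD// df// dh// scalerDr.
Qed.

Lemma exactspinorZ l k f : exactspinor l f -> exactspinor l (fun y => k *: f y).
Proof.
move=> [pf ef df]; split; first exact: polyspinorZ.
  by move=> g c sg cG; rewrite ef// -scalemxAr.
by move=> y sy; rewrite dirac_opZ// df// !scalerA mulrC.
Qed.

Lemma group_SU2 c : c \in G -> SU2 c.
Proof. by case: hG => h _ _ _ cG; exact: h. Qed.

Lemma group_gt0 : (0 < #|` G|)%N.
Proof. by case: hG => _ h _ _; rewrite cardfs_gt0; apply/fset0Pn; exists 1%:M. Qed.

Lemma group_adj c : c \in G -> adj c \in G.
Proof. by move=> cG; rewrite -SU2_invmx; [case: hG => _ _ _; exact|exact: group_SU2]. Qed.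

Lemma sum_mull (W : zmodType) (F : M2 -> W) d : d \in G ->
  \sum_(c <- G) F (d *m c) = \sum_(c <- G) F c.
Proof.
move=> dG; have [_ _ hm _] := hG; rewrite -(big_map (fun c => d *m c) xpredT F); apply: perm_big.
have inj : injective (fun c : M2 => d *m c).
  by move=> x y /(congr1 (mulmx (adj d))); rewrite !mulmxA SU2_adjl ?mul1mx//; exact: group_SU2.
apply: uniq_perm.
- by rewrite map_inj_uniq// fset_uniq.
- exact: fset_uniq.
move=> x; apply/mapP/idP => [[c cG ->]|xG]; first exact: hm.
exists (adj d *m x); first by apply: hm => //; exact: group_adj.
by rewrite mulmxA SU2_adjr ?mul1mx//; exact: group_SU2.
Qed.

(** The kernel as a function of the single matrix q = g^* y; it commutes with conjugation of q,
    which is what averaging over the group relies on. *)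
Definition kerq j (q : M2) : M2 := 2%:R^-1 *: ((kerA R j).[2%:R^-1 * \tr q]%:M +
  (kerB R j).[2%:R^-1 * \tr q] *: q).

Lemma kerq_conj j (a b q : M2) : a *m b = 1%:M -> kerq j (a *m q *m b) = a *m kerq j q *m b.
Proof.
move=> ab; have ba : b *m a = 1%:M by exact: mulmx1C.
have et : \tr (a *m q *m b) = \tr q by rewrite mxtrace_mulC mulmxA ba mul1mx.
rewrite /kerq et -scalemxAr -scalemxAl; congr (_ *: _).
rewrite mulmxDr mulmxDl -!scalemxAr -!scalemxAl mul_mx_scalar -scalemxAl ab scalemx1.
by [].
Qed.

(** By [kerfun_mulr] the summand of c is c K (y c): this is the projection of [kerfun j g v] onto
    the equivariant spinors. The form chosen shows each summand as a kernel, hence as an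
    eigenspinor. *)
Definition gker j (g : M2) (v : V) : spinor := fun y =>
  (#|` G|%:R)^-1 *: \sum_(c <- G) kerfun j (g *m adj c) (c *m v) y.

Lemma kerfun_translate j (g c : M2) (v : V) (y : M2) : kerfun j (g *m adj c) (c *m v) y = kerq j (c *m (adj g *m y)) *m (c *m v).
Proof.
have e : adj (g *m adj c) *m y = c *m (adj g *m y) by rewrite adjM adjK mulmxA.
by rewrite -e.
Qed.

Lemma gker_equivariant j g v : equivariant G (gker j g v).
Proof.
move=> y d sy dG; have sd := group_SU2 dG; rewrite SU2_invmx// /gker -scalemxAr mulmx_sumr; congr (_ *: _).
rewrite -[RHS](sum_mull _ dG); apply: eq_bigr => c _; rewrite !kerfun_translate.
have -> : c *m (adj g *m (y *m d)) = adj d *m (d *m c *m (adj g *m y)) *m d.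
  by rewrite !mulmxA SU2_adjl// mul1mx.
by rewrite kerq_conj ?SU2_adjl// !mulmxA.
Qed.

Lemma kerfun_mulr j (g c : M2) (v : V) (y : M2) : SU2 c -> kerfun j (g *m adj c) (c *m v) y = c *m kerfun j g v (y *m c).
Proof.
move=> sc; rewrite kerfun_translate.
have -> : c *m (adj g *m y) = c *m (adj g *m (y *m c)) *m adj c.
  by rewrite -!mulmxA SU2_adjr// mulmx1.
by rewrite kerq_conj ?SU2_adjr// -!mulmxA (mulmxA (adj c)) SU2_adjl// mul1mx.
Qed.

Lemma gker_exact j g v : SU2 g -> exactspinor (level R j) (gker j g v).
Proof.
move=> sg.
have [p d] : polyspinor (fun y => \sum_(c <- G) kerfun j (g *m adj c) (c *m v) y) /\
    forall y, SU2 y -> dirac_op (fun y => \sum_(c <- G) kerfun j (g *m adj c) (c *m v) y) y =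
      (level R j)%:C *: \sum_(c <- G) kerfun j (g *m adj c) (c *m v) y.
  have : {subset enum_fset G <= G} by [].
  elim: (enum_fset G) => [|c s IH] sub.
    split; first by under eq_fun do rewrite big_nil; exact: polyspinor0.
    move=> y sy; under [in LHS]eq_fun do rewrite big_nil.
    have := @dirac_opZ 0 _ _ polyspinor0 sy; under eq_fun do rewrite scaler0.
    by move=> ->; rewrite scale0r big_nil scaler0.
  have [|p d] := IH; first by move=> x xs; apply: sub; rewrite inE xs orbT.
  have cG : c \in G by apply: sub; rewrite inE eqxx.
  split; first by under eq_fun do rewrite big_cons; apply: polyspinorD => //; exact: kerfun_poly.
  move=> y sy; under [in LHS]eq_fun do rewrite big_cons.
  rewrite dirac_opD//; last exact: kerfun_poly.
  rewrite d// kerfun_exact//; last by apply: SU2_mul => //; apply: SU2_adj; exact: group_SU2.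
  by rewrite big_cons scalerDr.
split; first exact: polyspinorZ.
  exact: gker_equivariant.
by move=> y sy; rewrite dirac_opZ// d// /gker !scalerA mulrC.
Qed.

Lemma chaar_mulr (f : M2 -> C) s : SU2 s -> ccontS f -> chaar (fun y => f (y *m s)) = chaar f.
Proof. by move=> ss [cr ci]; rewrite /chaar (haar_mulr ss cr) (haar_mulr ss ci). Qed.

Lemma ccontS_cdot (u w : spinor) : cspin u -> cspin w -> ccontS (fun y => cdot (u y) (w y)).
Proof.
move=> hu hw; under eq_fun do rewrite cdotE.
by apply: ccontSD; apply: ccontSM => //; exact: ccontS_conj.
Qed.

Lemma cip_sumG (F : M2 -> spinor) chi : (forall c, cspin (F c)) -> hspin chi ->
  cip (fun y => \sum_(c <- G) F c y) chi = \sum_(c <- G) cip (F c) chi.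
Proof.
move=> hF hc; suff [_ ->] : cspin (fun y => \sum_(c <- G) F c y) /\
  cip (fun y => \sum_(c <- G) F c y) chi = \sum_(c <- G) cip (F c) chi by [].
elim: (enum_fset G) => [|c s [IH1 IH2]].
  split; first by move=> i; under eq_fun do rewrite big_nil mxE; exact: ccontS_cst.
  by rewrite big_nil -[RHS](chaar_cst 0); apply: eq_chaar => y _; rewrite big_nil /cdot /adj linear0 map_mx0 mul0mx mxE.
split; first by under eq_fun do rewrite big_cons; apply: cspinD.
rewrite big_cons -IH2; apply: etrans (cipDl (hF c) IH1 hc); apply: eq_cipl => y _.
by rewrite big_cons.
Qed.

(** Each summand c K (y c) pairs with chi like K itself: c moves across the inner product,
    equivariance turns its adjoint applied to chi y into chi (y c), and the integral is invariant
    under y |-> y c. *)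
Lemma cip_gker j g v (chi : spinor) : SU2 g -> cspin chi -> equivariant G chi ->
  cip (gker j g v) chi = cip (kerfun j g v) chi.
Proof.
move=> sg cc ec; have hk (c : M2) (w : V) : cspin (kerfun j c w) by exact/polyspinor_cspin/kerfun_poly.
have n0 : #|` G|%:R != 0 :> C by rewrite pnatr_eq0 -lt0n group_gt0.
have cS : cspin (fun y => \sum_(c <- G) kerfun j (g *m adj c) (c *m v) y).
  elim: (enum_fset G) => [|c s IH]; first by move=> i; under eq_fun do rewrite big_nil mxE; exact: ccontS_cst.
  by under eq_fun do rewrite big_cons; apply: cspinD.
rewrite /gker (cipZl _ cS (cspin_hspin cc)) (cip_sumG (F := fun c => kerfun j (g *m adj c) (c *m v)) (fun c => hk _ _) (cspin_hspin cc)).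
rewrite (eq_big_seq (fun=> cip (kerfun j g v) chi)); last first.
  move=> c cG; have sc := group_SU2 cG.
  rewrite -[RHS](chaar_mulr sc (ccontS_cdot (hk _ _) cc)).
  by apply: eq_chaar => y sy; rewrite kerfun_mulr// cdotMl ec// SU2_invmx.
rewrite big_const_seq count_predT iter_addr addr0.
rewrite -[cip _ _ *+ _]mulr_natl mulrA fmorphV rmorph_nat mulVf// mul1r//.
Qed.

(** An eigenspinor is an L^2 limit of smooth equivariant spinors, and the pairing with kappa is
    continuous. *)
Lemma eigen_test l psi (kappa : spinor) : eigenspinor G l psi -> cspin kappa ->
  (forall chi, cspin chi -> equivariant G chi -> cip kappa chi = 0) -> cip kappa psi = 0.
Proof.
move=> [[_ mpsi fpsi] _ appr] ck h0; have [sq _] := L2_sqint mpsi fpsi.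
have [B B0 hB] := cip_small ck.
have key e : 0 < e -> Normc.normc (cip kappa psi) <= e * B.
  move=> e0; have [chi [sm ec n1 _]] := appr (e ^+ 2) (exprn_gt0 2 e0).
  have c0 := Ck_cspin (sm 0%N).
  have s1 : sqint (fun g => psi g - chi g) by apply: sqintB => //; exact: cspin_sqint.
  have := hB _ _ s1 e0 n1.
  by rewrite (cipBr ck sq.1 (cspin_hspin c0)) (h0 _ c0 ec) subr0.
apply: Normc.eq0_normc; apply/eqP; rewrite eq_le (le_trans (normr_ge0 _) (Re_le_normc _)) andbT.
apply/ler_addgt0Pr => e e0; rewrite add0r.
have B1 : 0 < B + 1 by rewrite ltr_wpDl.
apply: (le_trans (key (e / (B + 1)) (divr_gt0 e0 B1))).
by rewrite mulrAC ler_pdivrMr// ler_pM2l// lerDl ler01.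
Qed.

Lemma cip_gker_eigen l psi j g v : eigenspinor G l psi -> SU2 g ->
  cip (gker j g v) psi = cip (kerfun j g v) psi.
Proof.
move=> ep sg; have [[_ mpsi fpsi] _ _] := ep; have [sq _] := L2_sqint mpsi fpsi.
have ck : cspin (kerfun j g v) by exact/polyspinor_cspin/kerfun_poly.
have cg : cspin (gker j g v) by apply: polyspinor_cspin; case: (gker_exact j v sg).
have ckN := cspinZ (-1) ck; have cd := cspinD cg ckN.
have E (f : spinor) : hspin f -> cip (fun y => gker j g v y + (-1) *: kerfun j g v y) f =
    cip (gker j g v) f - cip (kerfun j g v) f.
  by move=> hf; rewrite (cipDl cg ckN hf) (cipZl _ ck hf) rmorphN rmorph1 mulN1r.
apply/eqP; rewrite -subr_eq0 -(E _ sq.1); apply/eqP.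
apply: (eigen_test ep cd) => chi cc ec; rewrite (E _ (cspin_hspin cc)).
by rewrite cip_gker// subrr.
Qed.

(** The formula sin ((j - 1) x) = cos x sin (j x) - sin x cos (j x) divided by sin x; the absolute
    value reflects that T is even in j. *)
Lemma chebZ_pred (t : R) j : chebZ t (j - 1) = t * chebZ t j - (chebT R `|j|%N).[t].
Proof.
case: (intP j) => [|n|n].
- by rewrite sub0r chebZN !(chebZ_nat t 1) (chebZ_nat t 0) chebU1 chebU0 chebT0 horner0 hornerC; ring.
- rewrite (_ : n.+1%:Z - 1 = n%:Z); last by rewrite -addn1 PoszD addrK.
  by rewrite !chebZ_nat absz_nat chebUS chebTS !hornerE; ring.
- rewrite (_ : - n.+1%:Z - 1 = - n.+2%:Z); last by rewrite -opprD -PoszD addn1.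
  by rewrite !chebZN !chebZ_nat abszN absz_nat (chebUS _ n.+1) !hornerE; ring.
Qed.

Lemma real_complex_half (a b t : R) :
  2%:R^-1 * (a%:C * (2%:R * t%:C) + b%:C * (2%:R * t%:C * (2%:R * t%:C) - 1 *+ 2)) =
  (2%:R^-1 * (a * (2%:R * t) + b * (2%:R * t * (2%:R * t) - 1 *+ 2)))%:C :> C.
Proof.
have e1 : 1 *+ 2 = (1 *+ 2 : R)%:C :> C by rewrite rmorphMn rmorph1.
have ei : 2%:R^-1 = (2%:R^-1 : R)%:C :> C by rewrite fmorphV rmorph_nat.
by rewrite ei e1; rewrite -!(rmorphM (real_complex R)) -!(rmorphB (real_complex R)) -!(rmorphM (real_complex R)) -!(rmorphD (real_complex R)) -!(rmorphM (real_complex R)).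
Qed.

(* tr K_j(c) for c in SU(2), with eigenvalues e^{it}, e^{-it}: j sin((j-1)t) / sin t. *)
Lemma kerq_trace j c : SU2 c -> \tr (kerq j c *m c) = (j%:~R * chebZ (sdot 1%:M c) (j - 1))%:C.
Proof.
move=> sc; have [_ dc] := sc.
have et : 2%:R^-1 * \tr c = (sdot 1%:M c)%:C by rewrite -(sdotE (@SU2_1 R) sc) adj_scalar conjc1 mul1mx.
move: et; set t := sdot _ _ => et.
have tr1 : \tr c = 2%:R * t%:C by rewrite -et mulVKf// pnatr_eq0.
rewrite /kerq et -scalemxAl mxtraceZ mulmxDl mul_scalar_mx -scalemxAl mxtraceD !mxtraceZ.
rewrite cayley_hamilton2 dc mxtraceD raddfN /= mxtraceZ mxtrace_scalar tr1.
pose u := (chebU R `|j|%N).[t]; pose u' := (chebU R `|j|%N)^`().[t]; pose s : R := (sgz j)%:~R.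
have eU : (chebC R j).[t%:C] = (s * u)%:C by rewrite chebC_horner.
have eU' : (chebC R j)^`().[t%:C] = (s * u')%:C.
  rewrite /chebC -(rmorph_int polyC) mul_polyC derivZ hornerZ deriv_map horner_map.
  by rewrite rmorphM rmorph_int.
have du : (1 - t ^+ 2) * u' = t * u - `|j|%N%:R * (chebT R `|j|%N).[t].
  by have := congr1 (horner^~ t) (chebU_deriv R `|j|%N); rewrite !hornerE /= -!(rmorph_nat polyC) !hornerC.
have eA : (kerA R j).[t%:C] = (j%:~R * (s * u) + t * (s * u') - s * u)%:C.
  move: eU eU'; rewrite /kerA; move: (chebC R j) => p eU eU'.
  rewrite hornerD hornerN hornerD !hornerM hornerX eU eU' -(rmorph_int polyC) hornerC rmorphB rmorphD !rmorphM /= rmorph_int.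
  by rewrite /s rmorph_int.
have eB : (kerB R j).[t%:C] = (- (s * u'))%:C by rewrite /kerB hornerN eU' rmorphN.
rewrite eA eB chebZ_pred /chebZ -/u -/s.
rewrite real_complex_half.
congr (_%:C); have sj : j%:~R = s * `|j|%N%:R :> R.
  by rewrite /s {1}(intEsg j) rmorphM /= -pmulrn.
rewrite sj.
(* The derivative of U occurs only as (1 - t^2) U', which [chebU_deriv] eliminates. *)
transitivity (s * `|j|%N%:R * s * u * t - s * (t * u) + s * ((1 - t ^+ 2) * u')); first by field.
by rewrite du; ring.
Qed.

Definition kertrace j : R := (#|` G|%:R)^-1 * \sum_(c <- G) j%:~R * chebZ (sdot 1%:M c) (j - 1).

(** On the diagonal g^* y = 1, so the summand of c is the trace of [kerq j c *m c], whatever g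
    is. *)
Lemma gker_trace j g : SU2 g -> \sum_(a < 2) gker j g (delta_mx a 0) g a 0 = (kertrace j)%:C.
Proof.
move=> sg; have n0 : #|` G|%:R != 0 :> C by rewrite pnatr_eq0 -lt0n group_gt0.
under eq_bigr => a _ do rewrite /gker mxE summxE.
rewrite -mulr_sumr exchange_big /= /kertrace rmorphM fmorphV rmorph_nat; congr (_ * _).
rewrite rmorph_sum; apply: eq_big_seq => c cG; have sc := group_SU2 cG.
apply: etrans (kerq_trace j sc); rewrite /mxtrace; apply: eq_bigr => a _.
rewrite kerfun_translate SU2_adjl// mulmx1 mulmxA mxE.
by rewrite (bigD1 a) //= [delta_mx _ _ _ _]mxE !eqxx mulr1 big1 ?addr0// => k /negbTE ka; rewrite [delta_mx _ _ _ _]mxE ka mulr0.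
Qed.

End EquivariantKernel.

(** * The dimension of an eigenspace *)

Section Multiplicity.
Variable R : realType.
Local Notation C := R[i].
Local Notation M2 := 'M[C]_2.
Local Notation V := 'cV[C]_2.
Local Notation Re := (@complex.Re R).
Local Notation Im := (@complex.Im R).
Local Notation spinor := (spinor R).

Lemma cip0l (f : spinor) : cip (fun=> 0) f = 0.
Proof.
rewrite -[RHS](chaar_cst 0); apply: eq_chaar => y _.
by rewrite -(scale0r (0 : V)) cdotZl rmorph0 mul0r.
Qed.

Lemma cdot_sumr n (u : 'I_n -> V) w : cdot w (\sum_i u i) = \sum_i cdot w (u i).
Proof. by rewrite /cdot mulmx_sumr summxE. Qed.

Lemma cdot_suml n (u : 'I_n -> V) w : cdot (\sum_i u i) w = \sum_i cdot (u i) w.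
Proof.
by rewrite cdotC cdot_sumr rmorph_sum /=; apply: eq_bigr => i _; rewrite -cdotC.
Qed.

Lemma cip_suml n f (u : 'I_n -> spinor) : hspin f -> (forall i, cspin (u i)) ->
  cip (fun y => \sum_i u i y) f = \sum_i cip (u i) f.
Proof.
move=> cf hu; have h i := chint_cdot (hu i) cf; rewrite -(chaar_sum h).2.
by apply: eq_chaar => g _; rewrite cdot_suml.
Qed.

Lemma sum_delta n (a : 'I_n -> C) k : \sum_i a i * (k == i)%:R = a k.
Proof.
rewrite (bigD1 k) //= eqxx mulr1 big1 ?addr0// => i; rewrite eq_sym => /negbTE ->.
by rewrite mulr0.
Qed.

Lemma normc_sqrC (z : C) : conjc z * z = (Normc.normc z ^+ 2)%:C.
Proof. by rewrite normc_sqr; case: z => a b; apply: complex_ext => /=; ring. Qed.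

#[local] Opaque cip haar kerfun gker.

Lemma cip_null0 (kappa xi : spinor) : cspin kappa -> sqint xi -> haar (fun y => nsq (xi y)) = 0 ->
  cip kappa xi = 0.
Proof.
move=> ck sx n0; have [B B0 hB] := cip_small ck.
apply: Normc.eq0_normc; apply/eqP; rewrite eq_le (le_trans (normr_ge0 _) (Re_le_normc _)) andbT.
apply/ler_addgt0Pr => e e0; rewrite add0r.
have B1 : 0 < B + 1 by rewrite ltr_wpDl.
have e1 : 0 < e / (B + 1) by rewrite divr_gt0.
have h := hB xi (e / (B + 1)) sx e1; apply: (le_trans (h _)).
  by rewrite (hint_normsq sx.2) n0 lte_fin exprn_gt0.
by rewrite mulrAC ler_pdivrMr// ler_pM2l// lerDl ler01.
Qed.

Lemma null_comb n (eta : 'I_n -> spinor) (c : 'I_n -> C) : (forall i, sqint (eta i)) ->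
  (forall i, haar (fun y => nsq (eta i y)) = 0) ->
  haar (fun y => nsq (\sum_i c i *: eta i y)) = 0.
Proof.
elim: n eta c => [|n IH] eta c se ne.
  rewrite -[RHS](haar_cst 0); apply: eq_haar => y _; rewrite big_ord0 nsqE !mxE /= expr0n /= !addr0//.
have s1 : sqint (fun y => \sum_(i < n) c (lift ord0 i) *: eta (lift ord0 i) y).
  by apply: sqint_sum => i; exact: sqintZ.
have h1 := IH (fun i => eta (lift ord0 i)) (fun i => c (lift ord0 i)) (fun i => se _) (fun i => ne _).
have s0 : sqint (fun y => c ord0 *: eta ord0 y) by exact: sqintZ.
apply/eqP; rewrite eq_le haar_ge0 ?andbT; last by move=> g _; exact: nsq_ge0.
have h2 : hint (fun y => 2%:R * nsq (c ord0 *: eta ord0 y) +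
   2%:R * nsq (\sum_(i < n) c (lift ord0 i) *: eta (lift ord0 i) y)).
  by apply: hintD; apply: hintZ; [exact: s0.2|exact: s1.2].
apply: (@le_trans _ _ (haar (fun y => 2%:R * nsq (c ord0 *: eta ord0 y) +
   2%:R * nsq (\sum_(i < n) c (lift ord0 i) *: eta (lift ord0 i) y)))).
  apply: haar_le => //; last by move=> g _; rewrite big_ord_recl; exact: nsqD_le.
  by have := (sqintD s0 s1).2; apply: eq_hint => g _; rewrite big_ord_recl.
rewrite haarD ?haarZ; [|exact: s1.2|exact: s0.2|exact/hintZ/s0.2|exact/hintZ/s1.2].
rewrite h1 mulr0 addr0 (_ : haar _ = 0) ?mulr0//.
under eq_fun do rewrite nsqZ.
by rewrite haarZ ?ne ?mulr0//; exact: (se ord0).2.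
Qed.

Variable G : {fset M2}.
Hypothesis hG : subgroup_SU2 G.

Lemma eigen_sqint l psi : eigenspinor G l psi -> sqint psi.
Proof. by move=> [[_ m f] _ _]; case: (L2_sqint m f). Qed.

Lemma eigen_approx l psi : eigenspinor G l psi -> forall e, 0 < e ->
  exists2 chi, cspin chi & (normsq_L2 (fun y => (psi y - chi y)%R) < e%:E)%E.
Proof.
by move=> [_ _ h] e /h[chi [sm _ n1 _]]; exists chi => //; exact: Ck_cspin (sm 0%N).
Qed.

Lemma cspin_L2 (f : spinor) : cspin f -> equivariant G f -> L2_spinor G f.
Proof.
move=> cf ef; have sf := cspin_sqint cf; split => //; first exact: sqint_measurable.
by rewrite (hint_normsq sf.2) ltry.
Qed.

Lemma normsq_SU2_0 (f : spinor) : (forall y, SU2 y -> f y = 0) -> normsq_L2 f = 0%E.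
Proof.
move=> h; have n0 y : SU2 y -> nsq (f y) = 0 by move=> sy; rewrite h// nsqE !mxE /= expr0n /= !addr0.
rewrite hint_normsq; first by rewrite (eq_haar n0) haar_cst.
by apply: (@eq_hint _ (fun=> 0)) => [y sy|]; [rewrite n0|exact/contS_hint/contS_cst].
Qed.

Lemma exact_eigen l f : exactspinor G l f -> eigenspinor G l f.
Proof.
move=> [pf ef df]; have cf := polyspinor_cspin pf; split.
- exact: cspin_L2.
- apply: cspin_L2; first exact: cspinZ.
  by move=> g c sg cG; rewrite ef// -scalemxAr.
move=> e e0; exists f; split => //; first exact: polyspinor_smooth.
  by rewrite normsq_SU2_0 ?lte_fin// => y _; rewrite subrr.
by rewrite normsq_SU2_0 ?lte_fin// => y sy; rewrite df// subrr.
Qed.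

Lemma exact_cspin l f : exactspinor G l f -> cspin f.
Proof. by case=> pf _ _; exact: polyspinor_cspin. Qed.

Lemma exact0 l : exactspinor G l (fun=> 0).
Proof.
have p0 : polyspinor (fun=> 0 : V) by exact: polyspinor0.
split => //; first by move=> g c _ _; rewrite mulmx0.
move=> y sy; have := @dirac_opZ R 0 _ y p0 sy; under eq_fun do rewrite scaler0.
by move=> ->; rewrite scale0r scaler0.
Qed.

Lemma exact_sum l n (e : 'I_n -> spinor) (c : 'I_n -> C) : (forall i, exactspinor G l (e i)) ->
  exactspinor G l (fun y => \sum_i c i *: e i y).
Proof.
elim: n e c => [|n IH] e c he.
  by under eq_fun do rewrite big_ord0; exact: exact0.
under eq_fun do rewrite big_ord_recl.
apply: exactspinorD; first exact: exactspinorZ.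
exact: (IH (fun i => e (lift ord0 i)) (fun i => c (lift ord0 i)) (fun i => he _)).
Qed.

Lemma no_eigen l psi : (forall j, j != 0 -> l != level R j) -> eigenspinor G l psi ->
  haar (fun y => nsq (psi y)) = 0.
Proof.
move=> hl ep; have sq := eigen_sqint ep; apply: (cip_null sq); last exact: eigen_approx ep.
move=> j g v sg; have [->|j0] := eqVneq j 0.
  by rewrite -[RHS](cip0l psi); apply: eq_cipl => y _; exact: kerfun0.
apply: (eigen_orth ep (kerfun_poly j g v)) => [y sy|]; first exact: kerfun_exact.
by rewrite eq_sym hl.
Qed.

Variable j : int.
Hypothesis j0 : j != 0.
Local Notation l := (level R j).

Definition orthosystem n (e : 'I_n -> spinor) := (forall i, exactspinor G l (e i)) /\
  forall i k, cip (e i) (e k) = (i == k)%:R.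

(** f minus its orthogonal projection onto the span of e. *)
Definition residue n (e : 'I_n -> spinor) (f : spinor) : spinor :=
  fun y => f y + \sum_i (- cip (e i) f) *: e i y.

Lemma residue_orth n (e : 'I_n -> spinor) f k : orthosystem e -> hspin f -> cip (e k) (residue e f) = 0.
Proof.
move=> [he oe] hf; have ce i := exact_cspin (he i).
have hs i : hspin (fun y => (- cip (e i) f) *: e i y) by exact/hspinZ/cspin_hspin.
have hS : hspin (fun y => \sum_i (- cip (e i) f) *: e i y).
  by apply: cspin_hspin; apply: exact_cspin; exact: exact_sum.
rewrite /residue (cipDr (ce k) hf hS) (cip_sumr (ce k) hs).
have -> : \sum_i cip (e k) (fun y => - cip (e i) f *: e i y) = - cip (e k) f.
  apply: etrans (sum_delta (fun i => - cip (e i) f) k); apply: eq_bigr => i _.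
  by rewrite (cipZr _ (ce k) (cspin_hspin (ce i))) oe.
exact: subrr.
Qed.

Lemma residue_exact n (e : 'I_n -> spinor) f : orthosystem e -> exactspinor G l f ->
  exactspinor G l (residue e f).
Proof. by move=> [he _] hf; apply: exactspinorD => //; exact: exact_sum. Qed.

Lemma cip_gker_exact f g v : SU2 g -> exactspinor G l f -> cip (gker G j g v) f = cdot v (f g).
Proof.
move=> sg hf; have [pf ef df] := hf.
by rewrite (cip_gker hG j v sg (polyspinor_cspin pf) ef) reproducing.
Qed.

(** The residue is orthogonal to the span of e, so its square norm is its pairing with the kernel,
    that is <v, value at g> by the reproducing property. The coefficients <e_i, K v> are the
    conjugates of <v, e_i g>. *)
Lemma residue_gker n (e : 'I_n -> spinor) g v : orthosystem e -> SU2 g ->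
  haar (fun y => nsq (residue e (gker G j g v) y)) =
  Re (cdot v (gker G j g v g)) - \sum_i Normc.normc (cdot v (e i g)) ^+ 2.
Proof.
move=> oe sg; have [he o] := oe; have hk := gker_exact hG j v sg.
have hr := residue_exact oe hk; have ce i := exact_cspin (he i); have ck := exact_cspin hk.
have cr := exact_cspin hr.
have E : cip (residue e (gker G j g v)) (residue e (gker G j g v)) = cip (gker G j g v) (residue e (gker G j g v)).
  have cz i : cspin (fun y => (- cip (e i) (gker G j g v)) *: e i y) by exact: cspinZ.
  have cS : cspin (fun y => \sum_i (- cip (e i) (gker G j g v)) *: e i y) by apply: exact_cspin; exact: exact_sum.
  apply: etrans (cipDl ck cS (cspin_hspin cr)) _.
  rewrite (cip_suml (cspin_hspin cr) cz) [X in _ + X]big1; first exact: addr0.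
  move=> i _; rewrite (cipZl _ (ce i) (cspin_hspin cr)) (residue_orth i oe (cspin_hspin ck)).
  exact: mulr0.
have F : cip (gker G j g v) (residue e (gker G j g v)) = cdot v (residue e (gker G j g v) g).
  exact: cip_gker_exact.
have K : cdot v (residue e (gker G j g v) g) = cdot v (gker G j g v g) +
    \sum_i - (Normc.normc (cdot v (e i g)) ^+ 2)%:C.
  rewrite cdotDr cdot_sumr; apply: f_equal; apply: eq_bigr => i _.
  rewrite cdotZr (cipC ck (cspin_hspin (ce i))) (cip_gker_exact v sg (he i)) mulNr.
  by apply: f_equal; exact: normc_sqrC.
have := congr1 Re (etrans (esym (cip_self _)) (etrans E (etrans F K))).
rewrite Re_add Re_sum; move=> /= ->; congr (_ + _); rewrite -sumrN.
by [].
Qed.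

Lemma residue_sum n (e : 'I_n -> spinor) g : orthosystem e -> SU2 g ->
  \sum_(a < 2) haar (fun y => nsq (residue e (gker G j g (delta_mx a 0)) y)) =
  kertrace G j - \sum_i nsq (e i g).
Proof.
move=> oe sg; under eq_bigr do rewrite residue_gker//.
have := congr1 Re (gker_trace hG j sg); rewrite Re_sum /= => <-.
rewrite big_split sumrN /=; congr (_ - _).
  by apply: eq_bigr => a _; rewrite cdot_delta.
rewrite exchange_big; apply: eq_bigr => i _ /=.
by apply: eq_bigr => a _; rewrite cdot_delta.
Qed.

Lemma ortho_haar n (e : 'I_n -> spinor) : orthosystem e ->
  hint (fun g => \sum_i nsq (e i g)) /\ haar (fun g => \sum_i nsq (e i g)) = n%:R.
Proof.
move=> [he o]; have h i := contS_hint (cspin_nsq (exact_cspin (he i))).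
have [h1 h2] := haar_sum h; split => //; rewrite h2.
transitivity (\sum_(i < n) (1 : R)); last by rewrite sumr_const card_ord.
apply: eq_bigr => i _; apply: (@complexI R); rewrite -cip_self o eqxx//.
Qed.

(** The residues of the kernels at g give [kertrace G j] - sum_i |e_i g|^2 >= 0; integrating over g
    counts the e_i. The bound makes a maximal system exist. *)
Lemma bessel n (e : 'I_n -> spinor) : orthosystem e -> n%:R <= kertrace G j.
Proof.
move=> oe; have [h1 h2] := ortho_haar oe; rewrite -h2 -[leRHS]haar_cst; apply: haar_le => //.
  exact/contS_hint/contS_cst.
move=> g sg; rewrite -subr_ge0 -residue_sum// sumr_ge0// => a _.
by apply: haar_ge0 => y _; exact: nsq_ge0.
Qed.

Lemma maximal_orthosystem : exists n (e : 'I_n -> spinor), orthosystem e /\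
  forall e' : 'I_n.+1 -> spinor, ~ orthosystem e'.
Proof.
pose P n := `[< exists e : 'I_n -> spinor, orthosystem e >].
have P0 : exists n, P n.
  exists 0%N; apply/asboolP; exists (fun=> fun=> 0); by split=> [[]|[]].
have Pb n : P n -> (n <= Num.truncn (kertrace G j))%N.
  move=> /asboolP[e /bessel b]; have k0 := le_trans (ler0n R n) b.
  by rewrite -ltnS -(@ltr_nat R); apply: le_lt_trans b (truncnS_gt _).
have [n /asboolP[e oe] mx] := ex_maxnP P0 Pb.
exists n, e; split => // e' oe'; have := mx n.+1; rewrite ltnn => /(_ _)/notF; apply.
by apply/asboolP; exists e'.
Qed.

Section Maximal.
Variables (n : nat) (e : 'I_n -> spinor).
Hypothesis oe : orthosystem e.
Hypothesis mx : forall e' : 'I_n.+1 -> spinor, ~ orthosystem e'.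

(** Otherwise f, normalised, could be appended to the system. *)
Lemma maximal_null f : exactspinor G l f -> (forall i, cip (e i) f = 0) ->
  haar (fun y => nsq (f y)) = 0.
Proof.
move=> hf o; set N := haar _; apply/eqP; case: eqVneq => // N0.
have Np : 0 < N by rewrite lt_def N0 haar_ge0// => y _; exact: nsq_ge0.
have [he oo] := oe; have cf := exact_cspin hf; have ce i := exact_cspin (he i).
pose k : C := (Num.sqrt N)^-1%:C.
have kc : conjc k = k by apply: complex_ext => //=; rewrite oppr0.
pose f' : spinor := fun y => k *: f y.
have hf' : exactspinor G l f' by exact: exactspinorZ.
have ff : cip f' f' = 1.
  rewrite /f' (cipZl _ cf (cspin_hspin (cspinZ k cf))) (cipZr _ cf (cspin_hspin cf)) cip_self -/N kc.
  rewrite -!rmorphM /=; congr (_%:C); rewrite mulrA -expr2 exprVn sqr_sqrtr ?ltW// mulVf//.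
exfalso; apply: (mx (e' := fun i => if unlift ord_max i is Some k then e k else f')); split.
  by move=> i; case: unliftP.
move=> i i'; case: unliftP => [a ->|->]; case: unliftP => [b ->|->].
- by rewrite oo (inj_eq lift_inj).
- rewrite /f' (cipZr _ (ce a) (cspin_hspin cf)) o mulr0 eq_sym (negbTE (neq_lift _ _))//.
- rewrite /f' (cipZl _ cf (cspin_hspin (ce b))) (cipC (ce b) (cspin_hspin cf)) o conjc0 mulr0.
  by rewrite (negbTE (neq_lift _ _)).
- by rewrite ff eqxx.
Qed.

(** A null spinor pairs to 0 with the kernels, and these reproduce its values. *)
Lemma maximal_zero f : exactspinor G l f -> (forall i, cip (e i) f = 0) -> forall y, SU2 y -> f y = 0.
Proof.
move=> hf o y sy; have N0 := maximal_null hf o; have [pf _ df] := hf; have cf := exact_cspin hf.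
apply/colP => i; rewrite -cdot_delta -(reproducing (delta_mx i 0) j0 pf df sy) mxE.
by apply: cip_null0 => //; [exact/polyspinor_cspin/kerfun_poly|exact: cspin_sqint].
Qed.

(** By maximality the residues of the averaged kernels are null, so equality holds in [bessel]. *)
Lemma maximal_card : n%:R = kertrace G j.
Proof.
have [h1 h2] := ortho_haar oe; rewrite -h2 -[RHS]haar_cst; apply: eq_haar => g sg.
apply/eqP; rewrite eq_sym -subr_eq0 -residue_sum// big1// => a _.
have hk := gker_exact hG j (delta_mx a 0) sg.
apply: maximal_null; first exact: residue_exact.
by move=> i; apply: residue_orth => //; exact: cspin_hspin (exact_cspin hk).
Qed.

(** The residue is orthogonal to all kernels, hence null by [cip_null]. For m <> j this is
    orthogonality of different eigenvalues; for m = j the kernel may be averaged over the group, and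
    the averaged kernel lies in the span of e by [maximal_zero]. *)
Lemma maximal_span psi : eigenspinor G l psi -> haar (fun y => nsq (residue e psi y)) = 0.
Proof.
move=> ep; have sq := eigen_sqint ep; have [he oo] := oe.
have ce i := exact_cspin (he i).
have hS : exactspinor G l (fun y => \sum_i (- cip (e i) psi) *: e i y) by exact: exact_sum.
have cS := exact_cspin hS.
have sr : sqint (residue e psi) by apply: sqintD => //; exact: cspin_sqint.
apply: (cip_null sr) => [m g v sg|t t0].
  have ck : cspin (kerfun m g v) by exact/polyspinor_cspin/kerfun_poly.
  rewrite /residue (cipDr ck sq.1 (cspin_hspin cS)).
  have [->|mj] := eqVneq m j; last first.
    have ml : level R m != l by apply: contra_neq mj; exact: level_inj.
    rewrite (eigen_orth ep (kerfun_poly m g v) _ ml); last by move=> y sy; exact: kerfun_exact.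
    have [pS _ dS] := hS.
    rewrite (exact_orth (kerfun_poly m g v) pS _ dS ml) ?addr0//.
    by move=> y sy; exact: kerfun_exact.
  have hk := gker_exact hG j v sg; have cg := exact_cspin hk; have hr := residue_exact oe hk.
  rewrite -(cip_gker_eigen hG j v ep sg) -(cip_gker hG j v sg cS); last by case: hS.
  rewrite -(cipDr cg sq.1 (cspin_hspin cS)) -/(residue e psi).
  have r0 := maximal_zero hr (fun i => residue_orth i oe (cspin_hspin cg)).
  have E y : SU2 y -> gker G j g v y = \sum_i (cip (e i) (gker G j g v)) *: e i y.
    move=> sy; have := r0 y sy; rewrite /residue => /eqP; rewrite addr_eq0 => /eqP ->.
    by rewrite -sumrN; apply: eq_bigr => i _; rewrite scaleNr opprK.
  have cE : cspin (fun y => \sum_i (cip (e i) (gker G j g v)) *: e i y) by apply: exact_cspin; exact: exact_sum.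
  have cz i : cspin (fun y => cip (e i) (gker G j g v) *: e i y) by exact: cspinZ.
  rewrite (eq_cipl _ E) (cip_suml sr.1 cz); apply: big1 => i _.
  rewrite (cipZl _ (ce i) sr.1) (residue_orth i oe sq.1); exact: mulr0.
have [chi cc hc] := eigen_approx ep t0.
exists (fun y => chi y + \sum_i (- cip (e i) psi) *: e i y); first exact: cspinD.
by move: hc; congr (normsq_L2 _ < _)%E; apply/funext => y; rewrite /residue opprD addrACA subrr addr0.
Qed.

Lemma mult_eq : mult G l = (n%:R)%:E.
Proof.
have [he oo] := oe; have ce i := exact_cspin (he i).
apply/eqP; rewrite eq_le; apply/andP; split.
  apply: ge_ereal_sup => _ [m [psi [hpsi ind]] <-]; rewrite lee_fin ler_nat leqNgt.
  apply/negP => nm.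
  (* With m > n there is a nonzero row c with c A = 0. It annihilates the projections, so the
     combination of the psi_i equals that of their null residues, against independence. *)
  pose A : 'M[C]_(m, n) := \matrix_(i, k) cip (e k) (psi i).
  have /rowV0Pn[c /sub_kermxP cA c0] : kermx A != 0.
    rewrite kermx_eq0 /row_free; apply/negP => /eqP r.
    by have := rank_leq_col A; rewrite r leqNgt nm.
  pose eta i := residue e (psi i).
  have sq i := eigen_sqint (hpsi i).
  have seta i : sqint (eta i).
    apply: sqintD => //; apply: cspin_sqint; apply: exact_cspin; exact: exact_sum.
  have E y : \sum_i c 0 i *: psi i y = \sum_i c 0 i *: eta i y.
    rewrite /eta /residue; under [RHS]eq_bigr do rewrite scalerDr scaler_sumr.
    rewrite big_split /= exchange_big /= [X in _ + X]big1 ?addr0// => k _.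
    have := congr1 (fun B : 'rV[C]_n => B 0 k) cA; rewrite !mxE => ck.
    under eq_bigr do rewrite scalerA mulrN; rewrite -scaler_suml sumrN.
    rewrite (_ : \sum_i c 0 i * cip (e k) (psi i) = 0) ?oppr0 ?scale0r//.
    by rewrite -[RHS]ck; apply: eq_bigr => i _; rewrite mxE.
  have sE : sqint (fun y => \sum_i c 0 i *: eta i y) by apply: sqint_sum => i; exact: sqintZ.
  have N0 : normsq_L2 (fun y => \sum_i c 0 i *: psi i y) = 0%E.
    rewrite (_ : (fun y => \sum_i c 0 i *: psi i y) = fun y => \sum_i c 0 i *: eta i y); last exact/funext.
    rewrite (hint_normsq sE.2) (null_comb _ seta)// => i; exact: maximal_span.
  move/eqP: c0; apply; apply/rowP => i; rewrite mxE.
  exact: (ind (fun i => c 0 i) N0 i).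
apply: ereal_sup_ubound; exists n => //=; exists e; split; first by move=> i; exact: exact_eigen.
move=> c N0 i.
have hS : exactspinor G l (fun y => \sum_i c i *: e i y) by exact: exact_sum.
have cS := exact_cspin hS.
have z : cip (e i) (fun y => \sum_k c k *: e k y) = 0.
  apply: (cip_null0 (ce i) (cspin_sqint cS)).
  by move: N0; rewrite (hint_normsq (cspin_sqint cS).2) => -[].
have hZ k : hspin (fun y => c k *: e k y) by exact/hspinZ/cspin_hspin.
have := cip_sumr (ce i) hZ; rewrite z => z'.
apply: etrans (esym (sum_delta c i)) _; rewrite [RHS]z'; apply: eq_bigr => k _.
by rewrite (cipZr _ (ce i) (cspin_hspin (ce k))) oo.
Qed.
End Maximal.

Lemma mult_level : exists n, mult G l = (n%:R)%:E /\ n%:R = kertrace G j.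
Proof.
have [n [e [oe mx]]] := maximal_orthosystem.
by exists n; split; [exact: (mult_eq oe mx)|exact: (maximal_card oe mx)].
Qed.

End Multiplicity.

Section Spectrum.
Variables (R : realType) (G : {fset 'M[R[i]]_2}).
Hypothesis hG : subgroup_SU2 G.

Lemma Spec_level l : Spec G l -> exists2 j, j != 0 & l = level R j.
Proof.
move=> [psi [ep nz]]; apply: contrapT => h; apply: nz.
have sq := eigen_sqint ep; rewrite (hint_normsq sq.2) (no_eigen _ ep)// => j j0.
by apply/eqP => e; apply: h; exists j.
Qed.

Lemma level_Spec j : j != 0 -> kertrace G j != 0 -> Spec G (level R j).
Proof.
move=> j0 k0; have [n [e [oe mx]]] := maximal_orthosystem hG j0.
have nk := maximal_card hG j0 oe mx.
case: n e oe mx nk => [|n] e oe mx nk; first by move: k0; rewrite -nk eqxx.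
exists (e ord0); split; first by apply: exact_eigen; exact: oe.1.
have ce := exact_cspin (oe.1 ord0).
rewrite (hint_normsq (cspin_sqint ce).2) => -[] h.
by have := cip_self (e ord0); rewrite oe.2 eqxx h => /(congr1 (@complex.Re R)) /= /eqP; rewrite oner_eq0.
Qed.
End Spectrum.

(** * The spectral action as a sum over the group *)

Section Assembly.
Variable R : realType.
Local Notation C := R[i].
Local Notation M2 := 'M[C]_2.
Local Notation Re := (@complex.Re R).
Local Notation Im := (@complex.Im R).
Local Notation leb := (@lebesgue_measure R).

(** The parts j > 0 and j <= 0 are the images of n + 1 and of -n, which matches the pairing in
    [zterm]. *)
Lemma esum_int (b : int -> R) B : (forall j, 0 <= b j) -> zdom b B ->
  (\esum_(j in setT) (b j)%:E)%E = (zsum b)%:E.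
Proof.
move=> b0 hb.
have b0' j : (0 <= (b j)%:E)%E by rewrite lee_fin.
rewrite (@esumID _ _ [set j | 0 < j])// !setTI.
have -> : [set j : int | 0 < j] = (fun n : nat => n.+1%:Z) @` setT.
  apply/seteqP; split => [j /=|_ [n _ <-] //=].
  by case: j => [[|n]|n] // _; exists n.
have -> : ~` ((fun n : nat => n.+1%:Z) @` setT) = (fun n : nat => - n%:Z) @` setT.
  apply/seteqP; split => [j /= h|_ [n _ <-] [m _] /=].
    case: j h => [[|n]|n] h; first by exists 0%N.
      by exfalso; apply: h; exists n.
    by exists n.+1 => //; rewrite NegzE.
  by case: n => [|n].
rewrite !esum_image; last 2 first.
- by move=> n m _ _ /oppr_inj [].
- by move=> n m _ _ [].
rewrite -esumD// -nneseries_esumT; last by move=> n; rewrite adde_ge0.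
apply: cvg_lim => //; rewrite (_ : (fun n => _) = EFin \o series (zterm b)).
  by apply: cvg_EFin; [exact: nearW|exact: zsum_cvg hb].
by apply/funext => n; rewrite /= /series /= -sumEFin.
Qed.

Lemma esum_level (J : set int) (T : R -> \bar R) (b : int -> R) B : (forall j, 0 <= b j) -> zdom b B ->
  (forall j, J j -> T (level R j) = (b j)%:E) -> (forall j, ~ J j -> b j = 0) ->
  (\esum_(l in level R @` J) T l)%E = (zsum b)%:E.
Proof.
move=> b0 hb hT hJ; rewrite esum_image; last by move=> i j _ _; exact: level_inj.
rewrite -(esum_int b0 hb) esum_mkcond; apply: eq_esum => j _.
by case: ifPn => [|/negP]; rewrite inE => h; [rewrite hT|rewrite hJ].
Qed.

Lemma fourier0 (h : R -> R) : fourier h 0 = (\int[leb]_x h x)%R%:C.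
Proof.
rewrite /fourier; apply: complex_ext => /=.
  apply: eq_Rintegral => x _; rewrite mulr0 oppr0 /expi cos0 sin0 /=; ring.
rewrite /Rintegral -[RHS]/(fine 0%E) -(integral0 leb setT); congr fine; apply: eq_integral => x _.
by rewrite mulr0 oppr0 /expi cos0 sin0 /= mul0r mulr0 addr0.
Qed.

Lemma tiny_inv s : tiny s -> forall k : R, 0 < k ->
  exists M : R, \forall L \near +oo_R, `|s L^-1| <= M * L `^ (- k).
Proof.
(* m exceeds k, and the four further powers cancel the divisor d^4 in [bigO]. *)
move=> ts k k0; pose m := (Num.truncn k).+1.
have [B hB] := ts (4 + m)%N; exists `|B|; near=> L.
have L1 : 1 <= L by near: L; exact: nbhs_pinfty_ge.
have L0 : 0 < L by exact: lt_le_trans L1.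
have d01 : 0 < L^-1 <= 1 by rewrite invr_gt0 L0 /= invf_le1.
have E : L^-1 ^+ (4 + m) / L^-1 ^+ 4 = L `^ (- m%:R).
  by rewrite exprD mulrAC mulfV ?mul1r ?expf_neq0 ?invr_eq0 ?gt_eqF// powRN powR_mulrn ?ltW// exprVn.
have h := hB _ d01; rewrite E in h.
apply: (le_trans h); apply: (@le_trans _ _ (`|B| * L `^ (- m%:R))).
  by apply: ler_wpM2r (ler_norm _); exact: powR_ge0.
apply: ler_wpM2l => //; apply: ler_powR => //; rewrite lerN2 ltW//.
exact: truncnS_gt.
Unshelve. all: by end_near.
Qed.

Variable G : {fset M2}.
Hypothesis hG : subgroup_SU2 G.
Local Notation tau := (kertrace G).

Lemma tau0 : tau 0 = 0.
Proof. by rewrite /kertrace big1 ?mulr0// => c _; rewrite mul0r. Qed.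

(** Where the trace vanishes, the maximal system is empty and an eigenspinor is its own residue,
    hence null. In particular j = 0 and j = 1 drop out, by the weight j and by U_0 = 0, so that
    neither -1/2 nor 1/2 is an eigenvalue. *)
Lemma Spec_image : Spec G = level R @` [set j | tau j != 0].
Proof.
apply/seteqP; split => [l sl|_ [j /= tj <-]]; last first.
  by apply: level_Spec => //; apply: contra_neq tj => ->; exact: tau0.
have [j j0 e] := Spec_level sl; exists j => //=; apply/negP => /eqP t0.
move: sl => [psi [ep nz]]; apply: nz.
have [n [oe [ho mx]]] := maximal_orthosystem hG j0.
have nk := maximal_card hG j0 ho mx; rewrite t0 in nk.
move/eqP: nk; rewrite pnatr_eq0 => /eqP n0; subst n.
rewrite e in ep; have := maximal_span hG j0 ho mx ep.
move=> h; rewrite (hint_normsq (eigen_sqint ep).2) -[RHS]/(0%:E) -h.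
congr (haar _)%:E; apply/funext => y.
by rewrite /residue big_ord0 addr0.
Qed.

Lemma mult_tau j : tau j != 0 -> mult G (level R j) = (tau j)%:E.
Proof.
move=> tj; have j0 : j != 0 by apply: contra_neq tj => ->; exact: tau0.
by have [n [-> <-]] := mult_level hG j0.
Qed.

Lemma group_sdot c : c \in G -> `|sdot 1%:M c| <= 1.
Proof. by move=> cG; apply: sdot_le1; [exact: SU2_1|exact: group_SU2 hG c cG]. Qed.

(** 1 is the only element of SU(2) with trace 2. All others, -1 included, have s <> 1 and fall under
    [wsum_tiny]. *)
Lemma sdot1_eq1 (c : M2) : SU2 c -> sdot 1%:M c = 1 -> c = 1%:M.
Proof.
move=> sc h; have s1 := @SU2_1 R.
have n1 := SU2_coord sc; have := sdot_coord s1 sc; rewrite h !mxE /= !mul0r mul1r !addr0 => r1.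
have [r0 i1 i2] : [/\ Im (c 0 0) = 0, Re (c 0 1) = 0 & Im (c 0 1) = 0].
  move: n1; rewrite -r1; move: (Im (c 0 0)) (Re (c 0 1)) (Im (c 0 1)) => x y z n1.
  have := sqr_ge0 x; have := sqr_ge0 y; have := sqr_ge0 z => z2 y2 x2.
  by split; apply/eqP; rewrite -sqrf_eq0; apply/eqP; lra.
have [e10 e11] := SU2_row1 sc.
have c00 : c 0 0 = 1 by apply: complex_ext.
have c01 : c 0 1 = 0 by apply: complex_ext.
apply: mx2P; rewrite ?e10 ?e11 ?c00 ?c01 !mxE //=; by apply: complex_ext => /=; rewrite ?oppr0.
Qed.

Lemma tau_sum f L : schwartz f -> 0 < L ->
  (exists B, zdom (fun j => tau j * f (level R j / L)) B) /\
  zsum (fun j => tau j * f (level R j / L)) =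
  (#|` G|%:R)^-1 * \sum_(c <- G) wsum (sdot 1%:M c) f L^-1.
Proof.
move=> sf L0; have d0 : 0 < L^-1 by rewrite invr_gt0.
have E : (fun j => tau j * f (level R j / L)) = (fun j => (#|` G|%:R)^-1 *
    \sum_(c <- G) j%:~R * chebZ (sdot 1%:M c) (j - 1) * f (node L^-1 j)).
  by apply/funext => j; rewrite /kertrace -mulrA mulr_suml.
have [[B hB] hs] : (exists B, zdom (fun j => \sum_(c <- G) j%:~R * chebZ (sdot 1%:M c) (j - 1) * f (node L^-1 j)) B) /\
   zsum (fun j => \sum_(c <- G) j%:~R * chebZ (sdot 1%:M c) (j - 1) * f (node L^-1 j)) =
   \sum_(c <- G) wsum (sdot 1%:M c) f L^-1.
  have : {subset enum_fset G <= G} by [].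
  elim: (enum_fset G) => [|c s IH] sub.
    have z0 : zdom (fun j : int => \sum_(c <- [::] : seq M2) j%:~R * chebZ (sdot 1%:M c) (j - 1) * f (node L^-1 j)) 0.
      by move=> j; rewrite big_nil normr0 mul0r.
    split; first by exists 0.
    apply/eqP; rewrite big_nil -normr_le0; have := zsum_le z0; rewrite mulr0; exact.
  have [|[B hB] hs] := IH; first by move=> x xs; apply: sub; rewrite inE xs orbT.
  have cG : c \in G by apply: sub; rewrite inE eqxx.
  have [[B' hB'] _] := wsum_zdom (group_sdot cG) sf d0.
  have Ec : (fun j => \sum_(c <- c :: s) j%:~R * chebZ (sdot 1%:M c) (j - 1) * f (node L^-1 j)) =
    (fun j => j%:~R * chebZ (sdot 1%:M c) (j - 1) * f (node L^-1 j) +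
      \sum_(c <- s) j%:~R * chebZ (sdot 1%:M c) (j - 1) * f (node L^-1 j)).
    by apply/funext => j; rewrite big_cons.
  rewrite Ec big_cons; split.
    by exists (B' + B); exact: zdomD.
  by rewrite (zsumD hB' hB) hs.
rewrite E; split; first by exists (`|(#|` G|%:R)^-1| * B); exact: zdomZ.
by rewrite (zsumZ _ hB) hs.
Qed.

(** Levels outside the spectrum have trace 0, so the sum extends to all integers. Positive and
    negative parts are each dominated by the same constant, and their sums recombine by linearity of
    [zsum]. *)
Lemma spectral_sum f L : schwartz f -> 0 < L -> summable (Spec G) (spectral_term G f L) /\
  spectral_action G f L = (#|` G|%:R)^-1 * \sum_(c <- G) wsum (sdot 1%:M c) f L^-1.
Proof.
move=> sf L0; have [[B hB] <-] := tau_sum sf L0; set a := (fun j => _) in hB *.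
have ha j : tau j != 0 -> spectral_term G f L (level R j) = (a j)%:E.
  by move=> tj; rewrite /spectral_term mult_tau// -EFinM.
have za j : ~ (tau j != 0) -> a j = 0 by move=> /negP; rewrite negbK /a => /eqP ->; rewrite mul0r.
have hn : zdom (fun j => `|a j|) B by move=> j; rewrite normr_id.
have hp : zdom (fun j => Num.max (a j) 0) B.
  by move=> j; apply: le_trans (hB j); case: (leP (a j) 0); rewrite ?normr0.
have hm : zdom (fun j => Num.max (- a j) 0) B.
  by move=> j; apply: le_trans (hB j); case: (leP (- a j) 0); rewrite ?normr0 ?normrN.
rewrite /summable /spectral_action Spec_image; split.
  rewrite (@esum_level _ _ (fun j => `|a j|) B)//.
  - exact: ltry.
  - by move=> j /ha ->.
  - by move=> j /za ->; rewrite normr0.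
rewrite (@esum_level _ _ (fun j => Num.max (a j) 0) B)//; last 3 first.
- by move=> j; rewrite le_max lexx orbT.
- by move=> j /ha; rewrite funeposE => ->; rewrite EFin_max.
- by move=> j /za ->; rewrite maxxx.
rewrite (@esum_level _ _ (fun j => Num.max (- a j) 0) B)//; last 3 first.
- by move=> j; rewrite le_max lexx orbT.
- by move=> j /ha; rewrite funenegE => ->; rewrite EFin_max.
- by move=> j /za ->; rewrite oppr0 maxxx.
rewrite -EFinB /=.
have hm' := zdomZ (-1) hm.
rewrite -[_ - _](_ : zsum (fun j => Num.max (a j) 0) + (-1) * zsum (fun j => Num.max (- a j) 0) = _); last by rewrite mulN1r.
rewrite -(zsumZ _ hm) -(zsumD hp hm'); congr zsum; apply/funext => j.
by rewrite mulN1r; case: (leP (a j) 0); case: (leP (- a j) 0) => *; lra.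
Qed.

Lemma tiny_sumG (F : M2 -> R -> R) : (forall c, c \in G -> c != 1%:M -> tiny (F c)) ->
  tiny (fun d => \sum_(c <- G | c != 1%:M) F c d).
Proof.
move=> hF; have : {subset enum_fset G <= G} by [].
elim: (enum_fset G) => [|c s IH] sub.
  apply: (@eq_tiny _ (fun=> 0)) => [d _|]; first by rewrite big_nil.
  by move=> M; exists 0 => d _; rewrite normr0 mul0r.
have {}IH : tiny (fun d => \sum_(c <- s | c != 1%:M) F c d).
  by apply: IH => x xs; apply: sub; rewrite inE xs orbT.
have cG : c \in G by apply: sub; rewrite inE eqxx.
have [c1|c1] := eqVneq c 1%:M.
  by apply: eq_tiny IH => d _; rewrite big_cons c1 eqxx.
apply: (@eq_tiny _ (fun d => F c d + \sum_(c <- s | c != 1%:M) F c d)).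
  by move=> d _; rewrite big_cons c1.
by apply: tinyD => //; exact: hF.
Qed.

Lemma spectral_error_tiny f : schwartz f -> tiny (fun d =>
  (#|` G|%:R)^-1 * (\sum_(c <- G) wsum (sdot 1%:M c) f d -
    (d^-1 ^+ 3 * (\int[leb]_x (x ^+ 2 * f x))%R - 4%:R^-1 * d^-1 * (\int[leb]_x f x)%R))).
Proof.
move=> sf; apply: tinyZ.
have oneG : 1%:M \in G by case: hG.
have t1 : tiny (fun d => \sum_(c <- G | c != 1%:M) wsum (sdot 1%:M c) f d).
  apply: tiny_sumG => c cG c1; apply: wsum_tiny => //; first exact: group_sdot.
  by apply: contra_neq c1; apply: sdot1_eq1; exact: group_SU2 hG c cG.
apply: eq_tiny (tinyD (wsum1_tiny sf) t1) => d _.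
rewrite (bigD1_seq 1%:M) ?fset_uniq//= sdot_self; last exact: SU2_1.
by ring.
Qed.

End Assembly.

Theorem theorem1p1 (R : realType) (G : {fset 'M[R[i]]_2}) (f : R -> R)
    (hG : subgroup_SU2 G) (hf : schwartz f) :
  (forall L : R, 0 < L -> summable (Spec G) (spectral_term G f L)) /\
  negligible_at_infinity (fun L : R =>
    (spectral_action G f L)%:C
    - (#|` G|%:R)^-1 * ((L ^+ 3)%:C * fourier_moment 2 f 0
                        - 4%:R^-1 * L%:C * fourier f 0)).
Proof.
split=> [L L0|k k0]; first exact: (spectral_sum hG hf L0).1.
have [M hM] := tiny_inv (spectral_error_tiny hG hf) k0.
exists M; near=> L.
have L0 : 0 < L by near: L; exact: nbhs_pinfty_gt.
rewrite (spectral_sum hG hf L0).2 /fourier_moment !fourier0.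
have hn n : (n%:R)^-1 = ((n%:R)^-1)%:C :> R[i] by rewrite -[LHS]/((n%:R)^-1) -(rmorph_nat (real_complex R)) -fmorphV.
rewrite !hn -!(rmorphM (real_complex R)) -(rmorphB (real_complex R)) -!(rmorphM (real_complex R)) -(rmorphB (real_complex R)) /= -mulrBr.
rewrite expr0n addr0 sqrtr_sqr.
suff : `|(#|` G|%:R)^-1 * (\sum_(c <- G) wsum (sdot 1%:M c) f L^-1 -
    (L^-1^-1 ^+ 3 * (\int[lebesgue_measure]_x (x ^+ 2 * f x))%R -
     4%:R^-1 * L^-1^-1 * (\int[lebesgue_measure]_x f x)%R))| <= M * L `^ (- k).
  by rewrite invrK.
by near: L; exact: hM.
Unshelve. all: by end_near.
Qed.
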